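(* Let $A^2_\nu$ be a Zen space, with associated weight $w(t)=2\pi\int_0^\infty e^{-2rt}\,d\tilde\nu(r)$, $t>0$, for which the Laplace transform $\mathfrak{L}:L^2_w(0,\infty)\to A^2_\nu$ is surjective. Let $\varphi:\mathbb{C}_+\to\mathbb{C}_+$ be holomorphic. The composition operator $C_\varphi F:=F\circ\varphi$ is bounded on $A^2_\nu$ if and only if $\varphi$ has a finite angular derivative $0<\lambda<\infty$ at infinity. If $C_\varphi$ is bounded, then $$\lambda\inf_{t>0}\frac{w(t)}{w(\lambda t)}\le\|C_\varphi\|^2_{A^2_\nu}\le\lambda\sup_{t>0}\frac{w(t/\lambda)}{w(t)}.$$
   Context: $\mathbb{C}_+=\{z\in\mathbb{C}:\operatorname{Re}(z)>0\}$ and $\overline{\mathbb{C}_+}=[0,\infty)\times i\mathbb{R}$. Zen spaces: let $\tilde\nu$ be a positive regular Borel measure on $[0,\infty)$ with $0<\tilde\nu[0,r)<\infty$ for all $r>0$, satisfying $\sup_{r>0}\tilde\nu[0,2r)/\tilde\nu[0,r)<\infty$. Let $\nu$ be the product of $\tilde\nu$ with Lebesgue measure on $i\mathbb{R}$, a measure on $\overline{\mathbb{C}_+}$. The Zen space $A^2_\nu$ is the space of analytic $F:\mathbb{C}_+\to\mathbb{C}$ with $\|F\|^2_{A^2_\nu}:=\sup_{\varepsilon>0}\int_{\overline{\mathbb{C}_+}}|F(z+\varepsilon)|^2\,d\nu(z)<\infty$. $L^2_w(0,\infty)$ is the space of measurable $f:(0,\infty)\to\mathbb{C}$ with $\|f\|^2=\int_0^\infty|f(t)|^2w(t)\,dt<\infty$.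 It is known that the Laplace transform $\mathfrak{L}f(z)=\int_0^\infty e^{-tz}f(t)\,dt$ is an isometry from $L^2_w(0,\infty)$ into $A^2_\nu$. Angular derivative: a sequence $z_n=x_n+iy_n\in\mathbb{C}_+$ approaches $\infty$ non-tangentially if $x_n\to\infty$ and $\sup_n|y_n|/x_n<\infty$. The map $\varphi$ fixes infinity non-tangentially if $\varphi(z_n)\to\infty$ whenever $z_n\to\infty$ non-tangentially. If this holds and the non-tangential limit $\lim_{z\to\infty}z/\varphi(z)$ exists and is finite, then $\varphi$ is said to have a finite angular derivative at infinity, and the angular derivative is this limit. *)

(* Defs.v *)
(* The complex numbers are R[i] over an arbitrary R : realType. *)
From HB Require Import structures.
From mathcomp Require Import all_boot all_order all_algebra.
From mathcomp Require Import complex.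
From mathcomp Require Import all_classical all_reals all_analysis.

Set Implicit Arguments.
Unset Strict Implicit.
Unset Printing Implicit Defensive.

Import Order.TTheory GRing.Theory Num.Theory.
Import numFieldNormedType.Exports.

Local Open Scope ring_scope.
Local Open Scope complex_scope.
Local Open Scope classical_set_scope.

Section HalfPlane.
Variable R : realType.
Local Notation C := R[i].

Definition modulus (z : C) : R := complex.Re `|z|.

Definition half_plane : set C := [set z | 0 < complex.Re z].

(* Differentiability over the field C itself: the increment h in the
   difference quotient h^-1 *: (F (h *: 1 + z) - F z) ranges over C. *)
Definition holomorphic_on_half_plane (F : C -> C) : Prop :=
  forall z, half_plane z -> derivable (F : C^o -> C^o) z 1.

Definition cexp (z : C) : C :=
  (expR (complex.Re z))%:C * (cos (complex.Im z) +i* sin (complex.Im z)).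

End HalfPlane.

Section ZenSpace.
Variable R : realType.
Local Notation C := R[i].
Local Notation mu := (@lebesgue_measure R).

Definition regular_measure (nu : {measure set (measurableTypeR R) -> \bar R}) :=
  forall A : set R, measurable A ->
    nu A = ereal_inf [set nu U | U in [set U : set R | open U /\ A `<=` U]] /\
    nu A = ereal_sup [set nu K | K in [set K : set R | compact K /\ K `<=` A]].

(* A measure on [0, +oo[ is encoded as a measure on R carried by [0, +oo[. *)
Record zen_measure (nu : {measure set (measurableTypeR R) -> \bar R}) : Prop :=
  ZenMeasure {
    zen_carried : nu `]-oo, 0[ = 0%E ;
    zen_regular : regular_measure nu ;
    zen_pos_finite : forall r : R, 0 < r -> (0 < nu `[0%R, r[ < +oo)%E ;
    zen_doubling :
      (ereal_sup [set nu `[0%R, (2 * r)%R[ / nu `[0%R, r[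
                     | r in [set r : R | (0 < r)%R]]
         < +oo)%E
  }.

Section Space.
Variable nu : {measure set (measurableTypeR R) -> \bar R}.

(* The closed half-plane is identified with [0, +oo[ x R via x + iy <-> (x, y). *)
Definition zen_norm (F : C -> C) : \bar R :=
  (ereal_sup [set \int[nu \x mu]_(p in `[0%R, +oo[ `*` setT)
      (modulus (F ((p.1 + eps) +i* p.2)) ^+ 2)%:E
    | eps in [set eps : R | (0 < eps)%R]] `^ 2^-1)%E.

(* Only the values on the open half-plane matter: in zen_norm, F is evaluated
   at points of real part at least eps > 0. *)
Definition zen_space : set (C -> C) :=
  [set F | holomorphic_on_half_plane F /\ (zen_norm F < +oo)%E].

(* For a Zen measure the integral is finite for every t > 0, by doubling. *)
Definition zen_weight (t : R) : R :=
  2 * pi * \int[nu]_(r in `[0, +oo[) expR (- (2 * r * t)).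

Definition bounded_composition (phi : C -> C) : Prop :=
  (forall F, zen_space F -> zen_space (F \o phi)) /\
  exists M : R, forall F, zen_space F ->
    (zen_norm (F \o phi) <= M%:E * zen_norm F)%E.

Definition composition_norm (phi : C -> C) : \bar R :=
  ereal_sup [set zen_norm (F \o phi)
    | F in [set F | zen_space F /\ (zen_norm F <= 1)%E]].

End Space.

Definition weighted_L2 (w : R -> R) : set (R -> C) :=
  [set f : R -> C | [/\ measurable_fun (`]0, +oo[ : set R) (fun t : R => complex.Re (f t)),
               measurable_fun (`]0, +oo[ : set R) (fun t : R => complex.Im (f t)) &
    (\int[mu]_(t in `]0%R, +oo[) (modulus (f t) ^+ 2 * w t)%:E < +oo)%E]].

Definition cintegral (D : set R) (g : R -> C) : C :=
  (\int[mu]_(t in D) complex.Re (g t)) +i* (\int[mu]_(t in D) complex.Im (g t)).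

Definition laplace (f : R -> C) (z : C) : C :=
  cintegral `]0, +oo[ (fun t => cexp (- (t%:C * z)) * f t).

Definition laplace_surjective
    (nu : {measure set (measurableTypeR R) -> \bar R}) : Prop :=
  forall F, zen_space nu F ->
    exists2 f, weighted_L2 (zen_weight nu) f &
      forall z, half_plane z -> F z = laplace f z.

End ZenSpace.

Section AngularDerivative.
Variable R : realType.
Local Notation C := R[i].

Definition nontangential (z : nat -> C) : Prop :=
  [/\ forall n, half_plane (z n),
      (fun n => complex.Re (z n)) @ \oo --> +oo &
      has_ubound (range (fun n => `|complex.Im (z n)| / complex.Re (z n)))].

(* phi (z n) --> oo is convergence to the point at infinity of the Riemann
   sphere: only the modulus is required to diverge. *)
Definition fixes_infinity (phi : C -> C) : Prop :=
  forall z, nontangential z -> (fun n => modulus (phi (z n))) @ \oo --> +oo.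

Definition angular_derivative (phi : C -> C) (l : C) : Prop :=
  fixes_infinity phi /\
  forall z, nontangential z ->
    (fun n => z n / phi (z n) : C^o) @ \oo --> (l : C^o).

End AngularDerivative.

(* Main.v *)
(** The Laplace transform carries everything to [L^2_w].  If [phi] has angular
    derivative [l] at infinity, Julia's lemma (from the Pick inequality, itself a
    consequence of the Poisson formula on vertical lines) gives
    [Re (phi z) >= Re z / l].  For [a < x / l] the Poisson formula for [F^2] and
    Tonelli bound the integral of [|F (phi (x + iy))|^2] over [y] by [l] times that
    of [|F (a + iu)|^2] over [u]; Plancherel on each line, followed by integration
    in [nu], gives [|F o phi|^2 <= l \int |f t|^2 w (t / l) dt].
    Conversely, testing on reproducing kernels gives
    [kappa (Re (phi z)) <= |C_phi|^2 kappa (Re z)] with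
    [kappa x = \int e^(-2tx) / w t dt].  Since [w] is nonincreasing this forces
    [Re (phi z) >= c Re z], hence a finite angular derivative; letting [z] tend to
    infinity along the positive reals gives the lower bound, as the doubling
    property makes [w] vary slowly under dilations close to 1. *)
Require Import Defs.
From HB Require Import structures.
From mathcomp Require Import all_boot all_order all_algebra.
From mathcomp Require Import complex ring lra.
From mathcomp Require Import all_classical all_reals all_analysis.
From mathcomp Require Import measurable_realfun.
Import Order.TTheory GRing.Theory Num.Theory.
Import numFieldNormedType.Exports.
Local Open Scope ring_scope.
Local Open Scope complex_scope.
Local Open Scope classical_set_scope.
Local Notation Re := complex.Re.
Local Notation Im := complex.Im.
Local Notation "z ^*c" := (conjc z) (at level 1, format "z ^*c").

Set Implicit Arguments.
Unset Strict Implicit.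
Unset Printing Implicit Defensive.

(** The complex analysis is reduced to real integrals over vertical lines. Goursat's bisection is
    run only on the imaginary part of the boundary integral; through [cexp (- 2 * w)] and a Cayley
    map it yields circle means, hence the Poisson formula for a bounded holomorphic function on a
    slightly larger half-plane. That margin shapes the later estimates: the line at [r + e] is
    compared with the line at [(r + e / 2) / l], strictly inside the image, and the shift left over
    only adds a factor at most 1. Surjectivity of the Laplace transform serves twice: it writes any
    [F] as [laplace f] in the upper bound, and [F \o phi] as [laplace g] in the lower bound, where
    the value at a point is then estimated inside [L^2_w]. Boundedness for every [l] needs a finite
    [S] with [w (t / l) <= S * w t]. It comes from doubling, because the integral defining [w t] is
    comparable to the mass of [[0, 1 / (2 t)[]; the same comparison gives the slow variation behind
    the lower bound. *)

(** * Arithmetic of real parts, imaginary parts and moduli *)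

Section Modulus.
Variable R : realType.
Local Notation C := R[i].
Implicit Types (x y a b : R) (z w : C).

Lemma ReM z w : Re (z * w) = Re z * Re w - Im z * Im w.
Proof. by case: z w => [a b] [c d]. Qed.

Lemma ImM z w : Im (z * w) = Re z * Im w + Im z * Re w.
Proof. by case: z w => [a b] [c d]. Qed.

Lemma ReZ a z : Re (a%:C * z) = a * Re z.
Proof. by rewrite ReM /= mul0r subr0. Qed.

Lemma ImZ a z : Im (a%:C * z) = a * Im z.
Proof. by rewrite ImM /= mul0r addr0. Qed.

Lemma ReD z w : Re (z + w) = Re z + Re w.
Proof. by case: z w => [a b] [c d]. Qed.

Lemma ImD z w : Im (z + w) = Im z + Im w.
Proof. by case: z w => [a b] [c d]. Qed.

Lemma ReN z : Re (- z) = - Re z.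
Proof. by case: z. Qed.

Lemma ImN z : Im (- z) = - Im z.
Proof. by case: z. Qed.

Lemma Re_conj z : Re z^*c = Re z.
Proof. by case: z. Qed.

Lemma Im_conj z : Im z^*c = - Im z.
Proof. by case: z. Qed.

Definition ReE := (ReM, ImM, ReD, ImD, ReN, ImN, Re_conj, Im_conj).

Lemma complex_ext z w : Re z = Re w -> Im z = Im w -> z = w.
Proof. by case: z w => [a b] [c d] /= -> ->. Qed.

Lemma modulusE z : modulus z = Num.sqrt (Re z ^+ 2 + Im z ^+ 2).
Proof. by rewrite /modulus normc_def. Qed.

Lemma normc_modulus z : `|z| = (modulus z)%:C.
Proof. by rewrite modulusE normc_def. Qed.

Lemma modulus_ge0 z : 0 <= modulus z.
Proof. by rewrite modulusE sqrtr_ge0. Qed.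

Lemma sqr_modulus z : modulus z ^+ 2 = Re z ^+ 2 + Im z ^+ 2.
Proof. by rewrite modulusE sqr_sqrtr // addr_ge0 // sqr_ge0. Qed.

Lemma modulusM z w : modulus (z * w) = modulus z * modulus w.
Proof.
rewrite !modulusE -sqrtrM ?addr_ge0 ?sqr_ge0 // ReM ImM; congr Num.sqrt; ring.
Qed.

Lemma modulusD z w : modulus (z + w) <= modulus z + modulus w.
Proof. by rewrite -lecR rmorphD /= -!normc_modulus ler_normD. Qed.

Lemma modulusN z : modulus (- z) = modulus z.
Proof. by rewrite !modulusE ReN ImN !sqrrN. Qed.

Lemma modulusB z w : modulus (z - w) = modulus (w - z).
Proof. by rewrite -modulusN opprB. Qed.

Lemma modulus_conj z : modulus z^*c = modulus z.
Proof. by rewrite !modulusE Re_conj Im_conj sqrrN. Qed.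

Lemma modulus_real x : modulus x%:C = `|x|.
Proof. by rewrite modulusE /= expr0n /= addr0 sqrtr_sqr. Qed.

Lemma modulus0 : modulus (0 : C) = 0.
Proof. by rewrite modulusE /= expr0n /= addr0 sqrtr0. Qed.

Lemma modulus1 : modulus (1 : C) = 1.
Proof. by rewrite modulusE /= expr0n /= addr0 expr1n sqrtr1. Qed.

Lemma modulus_eq0 z : (modulus z == 0) = (z == 0).
Proof. by rewrite -(inj_eq (@complexI R)) -normc_modulus normr_eq0. Qed.

Lemma modulus_gt0 z : (0 < modulus z) = (z != 0).
Proof. by rewrite lt_def modulus_ge0 andbT modulus_eq0. Qed.

Lemma modulusV z : modulus z^-1 = (modulus z)^-1.
Proof.
have [->|z0] := eqVneq z 0; first by rewrite invr0 modulus0 invr0.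
apply: (mulfI (_ : modulus z != 0)); first by rewrite modulus_eq0.
by rewrite -modulusM !divff ?modulus1 // modulus_eq0.
Qed.

Lemma modulusX z n : modulus (z ^+ n) = modulus z ^+ n.
Proof.
by elim: n => [|n IH]; rewrite ?expr0 ?modulus1 // !exprS modulusM IH.
Qed.

Lemma normRe_le z : `|Re z| <= modulus z.
Proof. by rewrite modulusE -sqrtr_sqr ler_wsqrtr // lerDl sqr_ge0. Qed.

Lemma normIm_le z : `|Im z| <= modulus z.
Proof. by rewrite modulusE -sqrtr_sqr ler_wsqrtr // lerDr sqr_ge0. Qed.

Lemma Re_le z : Re z <= modulus z.
Proof. exact: le_trans (ler_norm _) (normRe_le z). Qed.

Lemma modulus_le z : modulus z <= `|Re z| + `|Im z|.
Proof.
rewrite -ler_sqr ?nnegrE ?modulus_ge0 ?addr_ge0 //.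
by rewrite sqr_modulus sqrrD !real_normK ?num_real // lerD2r lerDl mulrn_wge0 // mulr_ge0.
Qed.

Lemma conj_invr z : z^-1 = ((modulus z ^+ 2)^-1)%:C * z^*c.
Proof.
have [->|z0] := eqVneq z 0; first by rewrite invr0; apply: complex_ext; rewrite !ReE /= ?(oppr0, mulr0, mul0r, subrr, addr0).
apply: (mulfI z0); rewrite divff // mulrCA.
have -> : z * z^*c = (modulus z ^+ 2)%:C.
  by apply: complex_ext; rewrite sqr_modulus !ReE /=; ring.
by rewrite -rmorphM mulVf // expf_neq0 // modulus_eq0.
Qed.

Lemma ReV z : Re z^-1 = Re z / modulus z ^+ 2.
Proof. by rewrite conj_invr !ReE /= mul0r subr0 mulrC. Qed.

Lemma ImV z : Im z^-1 = - Im z / modulus z ^+ 2.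
Proof. by rewrite conj_invr !ReE /= mul0r addr0 mulrC. Qed.

Lemma Re_gt0_neq0 z : 0 < Re z -> z != 0.
Proof. by move=> z0; apply: contraTneq z0 => ->; rewrite /= ltxx. Qed.

End Modulus.

(** * Complex differentiability with real tolerances *)

Section Cderivable.
Variable R : realType.
Local Notation C := R[i].
Implicit Types (F G : C -> C) (z w : C).

Definition cderivable F z := derivable (F : C^o -> C^o) z 1.

Lemma gt0_complex (e : C) : 0 < e -> exists2 r : R, 0 < r & e = r%:C.
Proof.
case: e => a b; rewrite ltcE /= => /andP[/eqP b0 a0].
by exists a => //; rewrite b0.
Qed.

(** The norm of [C^o] takes values in [C] itself, whose positive elements are exactly the positive
    reals, so real tolerances suffice. *)
Lemma cvg_complexP (T : Type) (A : set_system T) (FA : Filter A) (f : T -> C) (l : C) :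
  (f x : C^o) @[x --> A] --> (l : C^o) <->
  forall e : R, 0 < e -> \forall x \near A, modulus (f x - l) <= e.
Proof.
split=> [|H].
  move/cvgrPdist_le => H e e0.
  have := H e%:C; rewrite ltcR => /(_ e0).
  by apply: filterS => x; rewrite normc_modulus lecR modulusB.
apply/cvgrPdist_le => _ /gt0_complex[e e0 ->].
have := H e e0.
by apply: filterS => x; rewrite normc_modulus lecR modulusB.
Qed.

Lemma near_complexP (P : C -> Prop) (z : C) :
  (\forall w \near (z : C^o), P w) <->
  exists2 d : R, 0 < d & forall w, modulus (w - z) < d -> P w.
Proof.
split=> [/nbhs_normP[e /= /gt0_complex[r r0 ->]] H|[d d0 H]].
  exists r => // w wz; apply: H => /=.
  by rewrite normc_modulus ltcR modulusB.
apply/nbhs_normP; exists d%:C => /=; first by rewrite ltcR.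
by move=> w /=; rewrite normc_modulus ltcR modulusB => /H.
Qed.

(** Multiplying by [h] removes the quotient, so [h = 0] is no exception. Goursat's estimate and
    differentiation under the Laplace integral both use this form. *)
Lemma cderivableP F z : cderivable F z <->
  exists d : C, forall e : R, 0 < e -> exists2 r : R, 0 < r &
    forall h, modulus h < r -> modulus (F (h + z) - F z - d * h) <= e * modulus h.
Proof.
rewrite /cderivable /derivable; split=> [/cvg_ex[d]|[d H]].
  move=> /cvg_complexP H; exists d => e /H.
  move/(near_complexP (fun h => h != 0 -> modulus (h^-1 * (F (h * 1 + z) - F z) - d) <= e)) => [r r0 {}H].
  exists r => // h hr.
  have [->|h0] := eqVneq h 0.
    by rewrite add0r subrr mulr0 subr0 !modulus0 mulr0.
  have := H h; rewrite subr0 => /(_ hr h0); rewrite mulr1 => {}H.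
  have -> : F (h + z) - F z - d * h = h * (h^-1 * (F (h + z) - F z) - d).
    by rewrite mulrBr mulVKf // (mulrC d).
  by rewrite modulusM mulrC ler_wpM2r // modulus_ge0.
apply/cvg_ex; exists d; apply/cvg_complexP => e /H[r r0 {}H].
apply/(near_complexP (fun h => h != 0 -> modulus (h^-1 * (F (h * 1 + z) - F z) - d) <= e)).
exists r => // h; rewrite subr0 => hr h0; rewrite mulr1.
have := H h hr.
have -> : F (h + z) - F z - d * h = h * (h^-1 * (F (h + z) - F z) - d).
  by rewrite mulrBr mulVKf // (mulrC d).
by rewrite modulusM (mulrC e) ler_pM2l // modulus_gt0.
Qed.

Lemma cderivable_cst (k z : C) : cderivable (fun=> k) z.
Proof. exact: derivable_cst. Qed.

Lemma cderivable_id z : cderivable id z.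
Proof. exact: derivable_id. Qed.

Lemma cderivableD F G z : cderivable F z -> cderivable G z ->
  cderivable (fun w => F w + G w) z.
Proof. exact: derivableD. Qed.

Lemma cderivableN F z : cderivable F z -> cderivable (fun w => - F w) z.
Proof. exact: derivableN. Qed.

Lemma cderivableM F G z : cderivable F z -> cderivable G z ->
  cderivable (fun w => F w * G w) z.
Proof. exact: (@derivableM C C^o). Qed.

Lemma cderivableV F z : F z != 0 -> cderivable F z ->
  cderivable (fun w => (F w)^-1) z.
Proof. exact: (@derivableV C C^o). Qed.

Lemma cderivable_comp F G z : cderivable F z -> cderivable G (F z) ->
  cderivable (fun w => G (F w)) z.
Proof.
move=> /derivable1_diffP dF /derivable1_diffP dG; apply/derivable1_diffP.
exact: (differentiable_comp dF dG).
Qed.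

Lemma cderivable_continuous F z (e : R) : cderivable F z -> 0 < e ->
  exists2 r : R, 0 < r & forall w, modulus (w - z) < r -> modulus (F w - F z) < e.
Proof.
move=> /derivable1_diffP/differentiable_continuous Fz e0.
apply/(near_complexP (fun w => modulus (F w - F z) < e)).
move: Fz => /cvgrPdist_lt /(_ e%:C); rewrite ltcR => /(_ e0).
by apply: filterS => w; rewrite normc_modulus ltcR modulusB.
Qed.

End Cderivable.

(** * Bisection of rectangles *)

Section RectangleFunction.
Variable R : realType.

(* Bisection, as in the proof of Goursat's lemma. *)
Lemma rectangle_function_eq0 (S : R -> R -> R -> R -> R) (X Y W H : R) :
  0 < W -> 0 < H ->
  (forall x y w h, 0 < w -> 0 < h ->
     X <= x -> x + 2 * w <= X + W -> Y <= y -> y + 2 * h <= Y + H ->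
     S x y (2 * w) (2 * h) =
     S x y w h + S (x + w) y w h + S x (y + h) w h + S (x + w) (y + h) w h) ->
  (forall p q, X <= p <= X + W -> Y <= q <= Y + H ->
     forall e, 0 < e -> exists2 d, 0 < d &
     forall x y w h, 0 < w < d -> 0 < h < d -> x <= p <= x + w -> y <= q <= y + h ->
       X <= x -> x + w <= X + W -> Y <= y -> y + h <= Y + H ->
       `|S x y w h| <= e * (w + h) ^+ 2) ->
  S X Y W H = 0.
Proof.
move=> W0 H0 Sadd Sloc.
apply/eqP; apply: contraT => S0.
have half0 n : 0 < (2^-1 : R) ^+ n by rewrite exprn_gt0 // invr_gt0.
pose w n := W * 2^-1 ^+ n; pose h n := H * 2^-1 ^+ n.
have w0 n : 0 < w n by rewrite mulr_gt0.
have h0 n : 0 < h n by rewrite mulr_gt0.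
have wS n : w n = 2 * w n.+1 by rewrite /w exprS; lra.
have hS n : h n = 2 * h n.+1 by rewrite /h exprS; lra.
pose ok n (c : R * R) := [/\ X <= c.1, c.1 + w n <= X + W, Y <= c.2, c.2 + h n <= Y + H
   & `|S X Y W H| * 4^-1 ^+ n <= `|S c.1 c.2 (w n) (h n)|].
have step n c : ok n c -> exists c', ok n.+1 c' /\
    [/\ c.1 <= c'.1, c'.1 + w n.+1 <= c.1 + w n, c.2 <= c'.2 & c'.2 + h n.+1 <= c.2 + h n].
  case: c => x y [/= h1 h2 h3 h4 h5].
  have h2' := h2; have h4' := h4; rewrite wS in h2'; rewrite hS in h4'.
  have hS5 := h5; rewrite wS hS Sadd // in hS5.
  have w1 := w0 n.+1; have k1 := h0 n.+1.
  have e4 : `|S X Y W H| * 4^-1 ^+ n = 4 * (`|S X Y W H| * 4^-1 ^+ n.+1) by rewrite exprS; lra.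
  rewrite e4 in hS5.
  set B := _ * 4^-1 ^+ n.+1 in hS5.
  have key : [|| B <= `|S x y (w n.+1) (h n.+1)|, B <= `|S (x + w n.+1) y (w n.+1) (h n.+1)|,
      B <= `|S x (y + h n.+1) (w n.+1) (h n.+1)|
    | B <= `|S (x + w n.+1) (y + h n.+1) (w n.+1) (h n.+1)|].
    apply: contraT; rewrite !negb_or -!ltNge => /and4P[b1 b2 b3 b4].
    set s1 := S _ _ _ _ in hS5 b1. set s2 := S _ _ _ _ in hS5 b2.
    set s3 := S _ _ _ _ in hS5 b3. set s4 := S _ _ _ _ in hS5 b4.
    have := ler_normD (s1 + s2 + s3) s4; have := ler_normD (s1 + s2) s3.
    have := ler_normD s1 s2; lra.
  have wE := wS n; have hE := hS n.
  case/or4P: key => key; [exists (x, y)|exists (x + w n.+1, y)|exists (x, y + h n.+1)|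
    exists (x + w n.+1, y + h n.+1)]; split; split => //=; clear - h1 h2 h3 h4 w1 k1 wE hE; lra.
have ok0 : ok 0%N (X, Y) by split => //=; rewrite ?/w ?/h ?expr0 ?mulr1.
(* [choice] asks for a total relation, so rectangles violating the invariant receive an arbitrary
   successor. *)
have /choice[f fP] : forall nc : nat * (R * R), exists c', ok nc.1 nc.2 -> ok nc.1.+1 c' /\
    [/\ nc.2.1 <= c'.1, c'.1 + w nc.1.+1 <= nc.2.1 + w nc.1, nc.2.2 <= c'.2
      & c'.2 + h nc.1.+1 <= nc.2.2 + h nc.1].
  move=> [n c]; have [okc|] := pselect (ok n c); last by exists c.
  by have [c' H'] := step n c okc; exists c'.
pose c := fix c n := if n is m.+1 then f (m, c m) else (X, Y).
have okc n : ok n (c n) by elim: n => //= n /(fP (n, c n))[].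
have cstep n := (fP (n, c n) (okc n)).2.
have x_le n m : (n <= m)%N -> (c n).1 <= (c m).1.
  move=> /subnK <-; elim: (m - n)%N => // k IH; rewrite addSn.
  by apply: le_trans IH _; have [] := cstep (k + n)%N.
have y_le n m : (n <= m)%N -> (c n).2 <= (c m).2.
  move=> /subnK <-; elim: (m - n)%N => // k IH; rewrite addSn.
  by apply: le_trans IH _; have [] := cstep (k + n)%N.
have xw_le n m : (n <= m)%N -> (c m).1 + w m <= (c n).1 + w n.
  move=> /subnK <-; elim: (m - n)%N => // k IH; rewrite addSn.
  by apply: le_trans _ IH; have [] := cstep (k + n)%N.
have yh_le n m : (n <= m)%N -> (c m).2 + h m <= (c n).2 + h n.
  move=> /subnK <-; elim: (m - n)%N => // k IH; rewrite addSn.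
  by apply: le_trans _ IH; have [] := cstep (k + n)%N.
have x_lt n m : (c m).1 <= (c n).1 + w n.
  have [nm|mn] := leqP n m; first by have := xw_le _ _ nm; have := w0 m; lra.
  by have := x_le _ _ (ltnW mn); have := w0 n; lra.
have y_lt n m : (c m).2 <= (c n).2 + h n.
  have [nm|mn] := leqP n m; first by have := yh_le _ _ nm; have := h0 m; lra.
  by have := y_le _ _ (ltnW mn); have := h0 n; lra.
pose p := sup (range (fun n => (c n).1)); pose q := sup (range (fun n => (c n).2)).
have pP n : (c n).1 <= p <= (c n).1 + w n.
  apply/andP; split.
    by apply: ub_le_sup; [exists (X + W) => _ [m _ <-]; have := x_lt 0%N m; rewrite /w expr0 mulr1|exists n].
  by apply: ge_sup; [exists (c n).1, n|move=> _ [m _ <-]].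
have qP n : (c n).2 <= q <= (c n).2 + h n.
  apply/andP; split.
    by apply: ub_le_sup; [exists (Y + H) => _ [m _ <-]; have := y_lt 0%N m; rewrite /h expr0 mulr1|exists n].
  by apply: ge_sup; [exists (c n).2, n|move=> _ [m _ <-]].
(* At depth [n] this tolerance allows [e * (W + H) ^+ 2 * 4^-1 ^+ n], which is half of the lower
   bound preserved by the bisection. *)
pose e := `|S X Y W H| / (2 * (W + H) ^+ 2).
have S0' : 0 < `|S X Y W H| by rewrite normr_gt0.
have WH0 : 0 < (W + H) ^+ 2 by rewrite exprn_gt0 // addr_gt0.
have e0 : 0 < e by rewrite divr_gt0 // mulr_gt0.
have := pP 0%N; have := qP 0%N; rewrite /= /w /h expr0 !mulr1 => pX qY.
have [d d0 dP] := Sloc p q qY pX e e0.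
have half_cvg : (fun n => (W + H) * 2^-1 ^+ n) @ \oo --> (0 : R).
  rewrite -[X in _ --> X](mulr0 (W + H)); apply: cvgMr.
  by apply: cvg_expr; rewrite ger0_norm; lra.
have [n nd] : exists n, (W + H) * 2^-1 ^+ n < d.
  have /cvgrPdist_lt/(_ d d0) [n _ /(_ n (leqnn n))] := half_cvg.
  by rewrite /= sub0r normrN => /ltr_normlP[_ ?]; exists n.
have [r1 r2 r3 r4 r5] := okc n.
have := dP (c n).1 (c n).2 (w n) (h n).
have wn := w0 n; have hn := h0 n.
have whE : w n + h n = (W + H) * 2^-1 ^+ n by rewrite /w /h mulrDl.
rewrite !(pP, qP) r1 r2 r3 r4 wn hn.
have -> : w n < d by lra.
have -> : h n < d by lra.
move=> /(_ isT isT isT isT isT isT isT isT); rewrite whE exprMn -exprM mulnC exprM.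
have -> : (2^-1 : R) ^+ 2 = 4^-1 by field.
have q0 : 0 < (4^-1 : R) ^+ n by rewrite exprn_gt0 // invr_gt0.
have -> : e * ((W + H) ^+ 2 * 4^-1 ^+ n) = `|S X Y W H| / 2 * 4^-1 ^+ n.
  rewrite /e; field; rewrite ?lt0r_neq0 //; exact: addr_gt0.
move=> /(le_trans r5); rewrite ler_pM2r //; lra.
Qed.

End RectangleFunction.

(** * Real integrals over intervals *)

Section RealIntegrable.
Context d (T : measurableType d) (R : realType) (m : {measure set T -> \bar R}).
Variable (D : set T).
Implicit Types f g : T -> R.

Lemma integrable_funB f g : m.-integrable D (EFin \o f) -> m.-integrable D (EFin \o g) ->
  measurable D -> m.-integrable D (EFin \o (fun x => f x - g x)).
Proof. by move=> fi gi mD; exact: (integrableB mD fi gi). Qed.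

Lemma integrable_funD f g : m.-integrable D (EFin \o f) -> m.-integrable D (EFin \o g) ->
  measurable D -> m.-integrable D (EFin \o (fun x => f x + g x)).
Proof. by move=> fi gi mD; exact: (integrableD mD fi gi). Qed.

Lemma integrable_funZ (k : R) f : m.-integrable D (EFin \o f) ->
  measurable D -> m.-integrable D (EFin \o (fun x => k * f x)).
Proof. by move=> fi mD; exact: (integrableZl mD k fi). Qed.

End RealIntegrable.

Section IntervalIntegrals.
Variable R : realType.
Local Notation mu := (@lebesgue_measure R).
Implicit Types (f : R -> R).

Lemma integrable_itv_within f (x y : R) :
  {within `[x, y], continuous f} -> mu.-integrable `[x, y] (EFin \o f).
Proof. by move=> cf; apply: continuous_compact_integrable => //; exact: segment_compact. Qed.

Lemma Rintegral_itv_split f (x y z : R) : x <= y -> y <= z ->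
  mu.-integrable `[x, z] (EFin \o f) ->
  \int[mu]_(t in `[x, z]) f t = \int[mu]_(t in `[x, y]) f t + \int[mu]_(t in `[y, z]) f t.
Proof.
move=> xy yz fi.
have := @Rintegral_itvB R f (BLeft x) (BRight z) y fi.
rewrite !bnd_simp => /(_ xy yz) H.
rewrite -[X in _ + X]Rintegral_itv_obnd_cbnd -?H ?subrKC //.
apply: integrableS fi => //.
by move=> t /=; rewrite !in_itv /= => /andP[/ltW yt ->]; rewrite (le_trans xy).
Qed.

Lemma Rintegral_itv_near_cst f (x y c e : R) : x <= y ->
  mu.-integrable `[x, y] (EFin \o f) ->
  (forall t, x <= t <= y -> `|f t - c| <= e) ->
  `|\int[mu]_(t in `[x, y]) f t - c * (y - x)| <= e * (y - x).
Proof.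
move=> xy fi fe.
have muE : fine (mu `[x, y]) = y - x.
  by rewrite lebesgue_measure_itv /= lte_fin; case: ltgtP xy => // ->; rewrite subrr.
have ci (k : R) : mu.-integrable `[x, y] (EFin \o (fun=> k)).
  by apply: integrable_itv_within => ?; exact: cvg_cst.
have <- : \int[mu]_(t in `[x, y]) c = c * (y - x) by rewrite Rintegral_cst // muE.
rewrite -RintegralB //; apply: le_trans (le_normr_Rintegral _ _) _ => //.
  exact: integrable_funB.
have <- : \int[mu]_(t in `[x, y]) e = e * (y - x) by rewrite Rintegral_cst // muE.
apply: le_Rintegral => //.
by have /integrable_abse := integrable_funB fi (ci c) (measurable_itv _).
Qed.

End IntervalIntegrals.

(** * Cauchy's theorem on rectangles, imaginary part only *)

Section Goursat.
Variable R : realType.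
Local Notation C := R[i].
Local Notation mu := (@lebesgue_measure R).
Implicit Types (F : C -> C).

Lemma complexBE (a b c d : R) : (a +i* b) - (c +i* d) = (a - c) +i* (b - d).
Proof. by []. Qed.

Lemma modulus_imag (a : R) : modulus (0 +i* a) = `|a|.
Proof. by rewrite modulusE /= expr0n /= add0r sqrtr_sqr. Qed.

(** [f] stands for [Re] or [Im], of which only the 1-Lipschitz bound matters. *)
Lemma cderivable_continuous_line F (f : C -> R) (x y : R) :
  (forall z w, `|f z - f w| <= modulus (z - w)) ->
  cderivable F (x +i* y) ->
  {for y, continuous (fun t : R => f (F (x +i* t)))} /\
  {for x, continuous (fun t : R => f (F (t +i* y)))}.
Proof.
move=> f1 /(@cderivable_continuous R) dF; split; apply/cvgrPdist_lt => e e0;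
  have [r r0 {}dF] := dF e e0; near=> t; rewrite distrC (le_lt_trans (f1 _ _)) //;
  apply: dF; rewrite complexBE ?subrr.
- by rewrite modulus_imag distrC; near: t; apply/nbhs_normP; exists r.
- by rewrite (modulus_real (t - x)) distrC; near: t; apply/nbhs_normP; exists r.
Unshelve. all: by end_near. Qed.

Lemma Re_lipschitz (z w : C) : `|Re z - Re w| <= modulus (z - w).
Proof. by rewrite -ReN -ReD normRe_le. Qed.

Lemma Im_lipschitz (z w : C) : `|Im z - Im w| <= modulus (z - w).
Proof. by rewrite -ImN -ImD normIm_le. Qed.

Variable F : C -> C.
Hypothesis dF : forall z, 0 < Re z -> cderivable F z.

Let u x y := Re (F (x +i* y)).
Let v x y := Im (F (x +i* y)).

Let u_int x a b : 0 < x -> mu.-integrable `[a, b] (EFin \o u x).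
Proof.
move=> x0; apply/integrable_itv_within/continuous_in_subspaceT => y _.
by have [] := cderivable_continuous_line Re_lipschitz (dF (z := x +i* y) x0).
Qed.

Let v_int y a b : 0 < a -> mu.-integrable `[a, b] (EFin \o v^~ y).
Proof.
move=> a0; apply/integrable_itv_within/continuous_in_subspaceT => x.
rewrite inE /= in_itv /= => /andP[ax _].
by have [] := cderivable_continuous_line Im_lipschitz (dF (z := x +i* y) (lt_le_trans a0 ax)).
Qed.

(** The imaginary part of the integral of [F] around the rectangle with lower left corner [x +i* y]
    and sides [w], [h]: it sees [u] on the vertical sides and [v] on the horizontal ones. *)
Let S x y w h :=
  (\int[mu]_(t in `[y, y + h]) u (x + w) t - \int[mu]_(t in `[y, y + h]) u x t) -
  (\int[mu]_(t in `[x, x + w]) v t (y + h) - \int[mu]_(t in `[x, x + w]) v t y).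

Let S_add x y w h : 0 < x -> 0 < w -> 0 < h ->
  S x y (2 * w) (2 * h) =
     S x y w h + S (x + w) y w h + S x (y + h) w h + S (x + w) (y + h) w h.
Proof.
move=> x0 w0 h0; rewrite /S.
have -> : x + 2 * w = x + w + w by lra.
have -> : y + 2 * h = y + h + h by lra.
have uS t : 0 < t -> \int[mu]_(s in `[y, y + h + h]) u t s =
   \int[mu]_(s in `[y, y + h]) u t s + \int[mu]_(s in `[y + h, y + h + h]) u t s.
  by move=> t0; apply: Rintegral_itv_split; rewrite ?lerDl ?(ltW h0) //; exact: u_int.
have vS t : \int[mu]_(s in `[x, x + w + w]) v s t =
   \int[mu]_(s in `[x, x + w]) v s t + \int[mu]_(s in `[x + w, x + w + w]) v s t.
  by apply: Rintegral_itv_split; rewrite ?lerDl ?(ltW w0) //; exact: v_int.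
rewrite !uS ?vS ?addr_gt0 //; ring.
Qed.

(** The Cauchy-Riemann relation in integrated form: up to the error of the affine approximation at
    [p +i* q], the horizontal increment of [u] is [Re d * w] and the vertical increment of [v] is
    [Re d * h], and both integrate to [Re d * w * h]. *)
Let S_loc p q (X : R) : 0 < X -> 0 < p -> forall e : R, 0 < e -> exists2 d : R, 0 < d &
  forall x y w h, 0 < w < d -> 0 < h < d -> x <= p <= x + w -> y <= q <= y + h ->
    X <= x -> `|S x y w h| <= e * (w + h) ^+ 2.
Proof.
move=> X0 p0 e e0.
have [d /(_ (e / 2))] := (cderivableP _ _).1 (dF (z := p +i* q) p0).
rewrite divr_gt0 // => /(_ isT)[r r0 H].
(* With both sides below [r / 2] every point of the rectangle lies within [r] of [p +i* q]. The
   tolerance [e / 2] is spent once at each end of an increment. *)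
exists (r / 2); first by rewrite divr_gt0.
move=> x y w h /andP[w0 wr] /andP[h0 hr] /andP[xp px] /andP[yq qy] Xx.
have loc s t : x <= s <= x + w -> y <= t <= y + h ->
    modulus (F (s +i* t) - F (p +i* q) - d * ((s - p) +i* (t - q))) <= e / 2 * (w + h).
  move=> /andP[s1 s2] /andP[t1 t2].
  have m1 : modulus ((s - p) +i* (t - q)) <= w + h.
    apply: le_trans (modulus_le _) _; rewrite /=; apply: lerD; rewrite ler_norml; lra.
  have := H ((s - p) +i* (t - q)).
  have -> : ((s - p) +i* (t - q)) + (p +i* q) = s +i* t by rewrite -complexBE subrK.
  move=> /(_ _)/le_trans; apply; first by apply: le_lt_trans m1 _; lra.
  by rewrite ler_pM2l // divr_gt0.
have uD t : y <= t <= y + h -> `|u (x + w) t - u x t - Re d * w| <= e * (w + h).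
  move=> yt; have w0' := ltW w0.
  have := le_trans (normRe_le _) (loc x t _ yt); have := le_trans (normRe_le _) (loc (x + w) t _ yt).
  rewrite !lexx !lerDl w0' /= => /(_ isT) + /(_ isT); rewrite !ReE /= -/(u _ _) -/(u _ _).
  rewrite !ler_norml => /andP[A1 A2] /andP[B1 B2]; lra.
have vD s : x <= s <= x + w -> `|v s (y + h) - v s y - Re d * h| <= e * (w + h).
  move=> xs; have h0' := ltW h0.
  have := le_trans (normIm_le _) (loc s y xs _); have := le_trans (normIm_le _) (loc s (y + h) xs _).
  rewrite !lexx !lerDl h0' /= => /(_ isT) + /(_ isT); rewrite !ReE /= -/(v _ _) -/(v _ _).
  rewrite !ler_norml => /andP[A1 A2] /andP[B1 B2]; lra.
have x0 : 0 < x := lt_le_trans X0 Xx.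
have xw0 : 0 < x + w by rewrite addr_gt0.
rewrite /S -!RintegralB //; try exact: u_int; try exact: v_int.
have iu := integrable_funB (u_int y (y + h) xw0) (u_int y (y + h) x0) (measurable_itv _).
have iv := integrable_funB (v_int (y + h) (x + w) x0) (v_int y (x + w) x0) (measurable_itv _).
have := Rintegral_itv_near_cst _ iu uD; have := Rintegral_itv_near_cst _ iv vD.
rewrite !lerDl (ltW w0) (ltW h0) => /(_ isT) + /(_ isT).
rewrite (addrC x) (addrC y) !addrK.
set I := \int[mu]_(t in _) _; set J := \int[mu]_(t in _) _.
rewrite !ler_norml => /andP[A1 A2] /andP[B1 B2].
apply/andP; split; nra.
Qed.

(** Periodicity cancels the two horizontal sides of the rectangle. *)
Lemma Re_circle_mean_const (t0 t1 y0 y1 : R) : 0 < t0 -> t0 < t1 -> y0 < y1 ->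
  (forall t, F (t +i* y0) = F (t +i* y1)) ->
  \int[mu]_(y in `[y0, y1]) Re (F (t0 +i* y)) = \int[mu]_(y in `[y0, y1]) Re (F (t1 +i* y)).
Proof.
move=> t00 t01 y01 Fper.
have : S t0 y0 (t1 - t0) (y1 - y0) = 0.
  apply: rectangle_function_eq0; rewrite ?subr_gt0 //.
  - by move=> x y w h w0 h0 xt _ _ _; apply: S_add => //; exact: lt_le_trans t00 xt.
  - move=> p q /andP[tp _] _ e e0.
    have [d d0 H] := @S_loc p q t0 t00 (lt_le_trans t00 tp) e e0.
    by exists d => // x y w h ? ? ? ? ? ? _ _; exact: H.
rewrite /S !subrKC.
have -> : \int[mu]_(t in `[t0, t1]) v t y1 = \int[mu]_(t in `[t0, t1]) v t y0.
  by apply: eq_Rintegral => t _; rewrite /v Fper.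
by move/eqP; rewrite subrr subr0 subr_eq0 => /eqP ->.
Qed.

End Goursat.

(** * Elementary bounds for the real and complex exponential *)

Section ElementaryBounds.
Variable R : realType.
Implicit Types x y : R.

Lemma normr_sin_le x : `|sin x| <= `|x|.
Proof.
have pos y : 0 < y -> `|sin y| <= `|y|.
  move=> y0; have [c _] := MVT y0 (fun x _ => is_derive_sin x)
    (continuous_subspaceT (@continuous_sin R)).
  by rewrite sin0 !subr0 => ->; rewrite normrM ler_piMl // cos_max.
have [x0|x0|->] := ltgtP x 0; last by rewrite sin0.
- by rewrite -(normrN x) -(normrN (sin x)) -sinN pos // oppr_gt0.
- exact: pos.
Qed.

Lemma one_sub_cosE x : 1 - cos x = 2 * sin (x / 2) ^+ 2.
Proof.
have {1}-> : x = (x / 2) *+ 2 by rewrite mulr2n; lra.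
by rewrite cos_mulr2n cos2sin2 mulr2n; ring.
Qed.

Lemma one_sub_cos_ge0 x : 0 <= 1 - cos x.
Proof. by rewrite subr_ge0 cos_le1. Qed.

Lemma one_sub_cos_le x : 1 - cos x <= x ^+ 2 / 2.
Proof.
rewrite one_sub_cosE -real_normK ?num_real //.
have := normr_sin_le (x / 2); have := normr_ge0 (sin (x / 2)).
set s := `|sin _|; have -> : `|x / 2| = `|x| / 2 by rewrite normrM [X in _ * X]ger0_norm // invr_ge0.
rewrite -[x ^+ 2]real_normK ?num_real //; set a := `|x|; nra.
Qed.

Lemma one_sub_cos_le1 x : 1 - cos x <= `|x|.
Proof.
rewrite one_sub_cosE -real_normK ?num_real //.
have := normr_sin_le (x / 2); have := normr_ge0 (sin (x / 2)); have := sin_max (x / 2).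
set s := `|sin _|; have -> : `|x / 2| = `|x| / 2 by rewrite normrM [X in _ * X]ger0_norm // invr_ge0.
set a := `|x|; nra.
Qed.

Lemma normr_sin_sub_le x : `|sin x - x| <= x ^+ 2.
Proof.
have pos y : 0 < y -> `|sin y - y| <= y ^+ 2.
  move=> y0.
  have dF z : z \in `]0, y[%R -> is_derive z 1 (fun t => sin t - t) (cos z - 1).
    by move=> _; apply: is_deriveB.
  have cF : {within `[0, y], continuous (fun t => sin t - t)}.
    by apply: continuous_subspaceT => z; apply: cvgB; [exact: continuous_sin|exact: cvg_id].
  have [c] := MVT y0 dF cF.
  rewrite in_itv /= => /andP[c0 cy]; rewrite sin0 !subr0 => ->.
  rewrite normrM (ger0_norm (ltW y0)) expr2 ler_wpM2r ?(ltW y0) //.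
  rewrite distrC (ger0_norm (one_sub_cos_ge0 _)).
  by apply: le_trans (one_sub_cos_le1 _) _; rewrite gtr0_norm // ltW.
have [x0|x0|->] := ltgtP x 0; last by rewrite sin0 subrr normr0 sqr_ge0.
- rewrite -sqrrN -normrN opprB addrC -[in sin x](opprK x) sinN opprK.
  by have := pos (- x); rewrite opprK oppr_gt0; apply.
- exact: pos.
Qed.

Lemma expR_sub1_le x : expR x - 1 <= x * expR x.
Proof.
have := expR_ge1Dx (- x); rewrite expRN.
have := expR_gt0 x; set E := expR x => E0 H.
have : (1 - x) * E <= E^-1 * E by rewrite ler_wpM2r // ltW.
by rewrite mulVf ?lt0r_neq0 //; lra.
Qed.

Lemma normr_expR_sub1_le x : `|expR x - 1| <= `|x| * expR `|x|.
Proof.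
have [x0|x0] := leP 0 x.
  rewrite ger0_norm; last by have := expR_ge1Dx x; lra.
  by rewrite ger0_norm // expR_sub1_le.
have h1 := expR_ge1Dx x; have h2 : 1 <= expR (- x) by rewrite leNgt expR_lt1; lra.
have := h1; have h3 : expR x < 1 by rewrite expR_lt1.
rewrite (ltr0_norm x0) ltr0_norm; last by lra.
have : (- x) * 1 <= - x * expR (- x) by rewrite ler_wpM2l //; lra.
lra.
Qed.

Lemma expR_sub_affine_le x : `|expR x - 1 - x| <= x ^+ 2 * expR `|x|.
Proof.
rewrite ger0_norm; last by have := expR_ge1Dx x; lra.
have h : expR x - 1 - x <= x * (expR x - 1) by have := expR_sub1_le x; lra.
apply: le_trans h _; apply: le_trans (ler_norm _) _.
rewrite normrM -[x ^+ 2]real_normK ?num_real // expr2 -mulrA.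
by rewrite ler_wpM2l // normr_expR_sub1_le.
Qed.

End ElementaryBounds.

Section ComplexExponential.
Variable R : realType.
Local Notation C := R[i].
Implicit Types z w : C.

Lemma Re_cexp z : Re (cexp z) = expR (Re z) * cos (Im z).
Proof. by rewrite /cexp ReM /= mul0r subr0. Qed.

Lemma Im_cexp z : Im (cexp z) = expR (Re z) * sin (Im z).
Proof. by rewrite /cexp ImM /= mul0r addr0. Qed.

Lemma cexpD z w : cexp (z + w) = cexp z * cexp w.
Proof.
by apply: complex_ext; rewrite !(ReE, Re_cexp, Im_cexp) expRD ?cosD ?sinD; ring.
Qed.

Lemma modulus_cexp z : modulus (cexp z) = expR (Re z).
Proof.
apply: (@pexpIrn _ 2) => //; rewrite ?nnegrE ?modulus_ge0 ?expR_ge0 //.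
rewrite sqr_modulus Re_cexp Im_cexp !exprMn -mulrDr cos2Dsin2 mulr1 //.
Qed.

(** A quadratic remainder whose constant is not optimised. It gives the derivative of [cexp] and the
    domination needed when the Laplace integral is differentiated. *)
Lemma cexp_sub_affine_le z :
  modulus (cexp z - 1 - z) <= 4 * modulus z ^+ 2 * expR (modulus z).
Proof.
apply: le_trans (modulus_le _) _; rewrite !(ReD, ImD, ReN, ImN) Re_cexp Im_cexp /= oppr0 addr0.
have := normRe_le z; have := normIm_le z.
move: (Re z) (Im z) => x y; set m := modulus z => ym xm.
have m0 : 0 <= m := le_trans (normr_ge0 _) xm.
have Em : 1 <= expR m by rewrite leNgt expR_lt1 -leNgt.
have Exm : expR x <= expR m by rewrite ler_expR (le_trans (ler_norm _)).
have Enm : expR `|x| <= expR m by rewrite ler_expR.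
have x2 : x ^+ 2 <= m ^+ 2 by rewrite -real_normK ?num_real // ler_pXn2r.
have y2 : y ^+ 2 <= m ^+ 2 by rewrite -real_normK ?num_real // ler_pXn2r.
have xy : `|x| * `|y| <= m ^+ 2 by rewrite expr2 ler_pM.
have H1 : `|expR x * cos y - 1 - x| <= m ^+ 2 * expR m + m ^+ 2 / 2 * expR m.
  have -> : expR x * cos y - 1 - x = (expR x - 1 - x) - expR x * (1 - cos y) by ring.
  apply: le_trans (ler_normB _ _) _; apply: lerD.
    by apply: le_trans (expR_sub_affine_le _) _; rewrite ler_pM // ?sqr_ge0 // expR_ge0.
  rewrite normrM (gtr0_norm (expR_gt0 x)) (ger0_norm (one_sub_cos_ge0 _)) mulrC.
  rewrite ler_pM ?expR_ge0 ?one_sub_cos_ge0 //.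
  by apply: le_trans (one_sub_cos_le _) _; lra.
have H2 : `|expR x * sin y - y| <= m ^+ 2 * expR m + m ^+ 2 * expR m.
  have -> : expR x * sin y - y = (expR x - 1) * sin y + (sin y - y) by ring.
  apply: le_trans (ler_normD _ _) _; apply: lerD.
    rewrite normrM.
    apply: (@le_trans _ _ ((`|x| * expR `|x|) * `|y|)).
      by rewrite ler_pM // ?normr_expR_sub1_le ?normr_sin_le.
    by rewrite mulrAC ler_pM // ?mulr_ge0 // ?expR_ge0.
  apply: le_trans (normr_sin_sub_le _) _; apply: le_trans y2 _.
  by rewrite ler_peMr // sqr_ge0.
have M0 : 0 <= m ^+ 2 * expR m by rewrite mulr_ge0 ?sqr_ge0 ?expR_ge0.
lra.
Qed.

Lemma cderivable_cexp z : cderivable (@cexp R) z.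
Proof.
apply/cderivableP; exists (cexp z) => e e0.
have E0 := expR_gt0 (Re z); have E1 := expR_gt0 (1 : R).
pose r := e / (4 * expR 1 * expR (Re z)).
have r0 : 0 < r by rewrite divr_gt0 // !mulr_gt0.
exists (Num.min 1 r); first by rewrite lt_min r0 ltr01.
move=> h; rewrite lt_min => /andP[h1 hr].
have -> : cexp (h + z) - cexp z - cexp z * h = cexp z * (cexp h - 1 - h).
  by rewrite cexpD; ring.
rewrite modulusM modulus_cexp.
apply: le_trans (ler_wpM2l (ltW E0) (cexp_sub_affine_le h)) _.
have := modulus_ge0 h; set m := modulus h in h1 hr * => m0.
have Em : expR m <= expR 1 by rewrite ler_expR ltW.
have -> : expR (Re z) * (4 * m ^+ 2 * expR m) = (4 * expR m * expR (Re z) * m) * m by ring.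
rewrite ler_wpM2r //.
apply: (@le_trans _ _ (4 * expR 1 * expR (Re z) * m)).
  by rewrite ler_wpM2r // ler_wpM2r ?(ltW E0) // ler_wpM2l.
have := ltW hr; rewrite /r ler_pdivlMr ?mulr_gt0 // mulrC //.
Qed.

End ComplexExponential.

(** * Circle means and the Poisson formula on the imaginary axis *)

Section DominatedConvergence.
Context d (T : measurableType d) (R : realType) (m : {measure set T -> \bar R}).

Lemma dominated_cvg_Rintegral (D : set T) (f_ : nat -> T -> R) (f g : T -> R) :
  measurable D -> (forall n, measurable_fun D (f_ n)) ->
  (forall x, D x -> f_ n x @[n --> \oo] --> f x) ->
  m.-integrable D (EFin \o g) ->
  (forall n x, D x -> `|f_ n x| <= g x) ->
  \int[m]_(x in D) f_ n x @[n --> \oo] --> \int[m]_(x in D) f x.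
Proof.
move=> mD mf fcvg gi fg.
have mfl : measurable_fun D f := measurable_fun_cvg mf fcvg.
have fle x : D x -> `|f x| <= g x.
  move=> Dx; have /cvg_norm H := fcvg x Dx.
  rewrite -(cvg_lim (@norm_hausdorff _ _) H); apply: limr_le; last by near=> n; exact: fg.
  by apply/cvg_ex; exists `|f x|.
have fi : m.-integrable D (EFin \o f).
  apply: le_integrable gi => //; first exact/measurable_EFinP.
  by move=> x Dx /=; rewrite lee_fin (le_trans (fle x Dx)) // ler_norm.
apply: fine_cvg; rewrite fineK; last exact: integrable_fin_num.
apply: (@dominated_cvg _ _ _ m D mD (fun n => EFin \o f_ n) (EFin \o f) (EFin \o g)) => //.
- by move=> n; exact/measurable_EFinP.
- by move=> x Dx; apply: cvg_EFin; [near=> n|exact: fcvg].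
Unshelve. all: by end_near. Qed.

End DominatedConvergence.

Section PoissonArc.
Variable R : realType.
Local Notation C := R[i].
Local Notation mu := (@lebesgue_measure R).
Variables (h : C -> C) (b K : R).
Hypotheses (b0 : 0 < b) (dh : forall z, - b < Re z -> cderivable h z)
  (hK : forall z, - b < Re z -> modulus (h z) <= K).

(** The Cayley map [(1 - E) / (1 + E)] sends the unit disc to the right half-plane, 0 to 1, and
    [exp (- 2 i th)] to [i tan th]. *)
Let G (E : C) := h ((1 - E) / (1 + E)).
Let E (r th : R) : C := (r * cos (2 * th)) +i* (- (r * sin (2 * th))).

Let Re_cayley (e : C) : Re ((1 - e) / (1 + e)) = (1 - modulus e ^+ 2) / modulus (1 + e) ^+ 2.
Proof. by rewrite ReM ReV ImV (sqr_modulus e) !ReE /=; set v := _^-1; ring. Qed.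

Let cayley_gtNb (e : C) : modulus e <= 1 -> - b < Re ((1 - e) / (1 + e)).
Proof.
move=> e1; apply: (@lt_le_trans _ _ 0); first by rewrite oppr_lt0.
rewrite Re_cayley divr_ge0 ?sqr_ge0 // subr_ge0 -(expr1n _ 2).
by rewrite ler_pXn2r ?nnegrE ?modulus_ge0.
Qed.

Let dG (e : C) : modulus e <= 1 -> 1 + e != 0 -> cderivable G e.
Proof.
move=> e1 e0; apply: (@cderivable_comp R (fun e => (1 - e) / (1 + e)) h).
  apply: cderivableM; first by apply: cderivableD; [exact: cderivable_cst|apply: cderivableN; exact: cderivable_id].
  by apply: cderivableV => //; apply: cderivableD; [exact: cderivable_cst|exact: cderivable_id].
exact/dh/cayley_gtNb.
Qed.

Let modulus_E r th : 0 <= r -> modulus (E r th) = r.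
Proof.
move=> r0; apply: (@pexpIrn _ 2) => //; rewrite ?nnegrE ?modulus_ge0 //.
by rewrite sqr_modulus /= sqrrN !exprMn -mulrDr cos2Dsin2 mulr1.
Qed.

Let E_neq r th : 0 <= r <= 1 -> - (pi / 2) < th < pi / 2 -> 1 + E r th != 0.
Proof.
move=> /andP[r0 r1] thpi; apply/eqP => /(congr1 (@complex.Re R)); rewrite ReD /=.
have c0 := cos_gt0_pihalf thpi.
have -> : 2 * th = th *+ 2 by rewrite mulr2n; lra.
have c2 := exprn_gt0 2 c0.
rewrite cos_mulr2n mulr2n; set c := cos th ^+ 2 in c2 *; nra.
Qed.

Let cexpE (t th : R) : cexp (- 2 * (t +i* th)) = E (expR (- 2 * t)) th.
Proof.
have reE : Re (- 2 * (t +i* th)) = - 2 * t by rewrite !ReE /=; lra.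
have imE : Im (- 2 * (t +i* th)) = - (2 * th) by rewrite !ReE /=; lra.
by apply: complex_ext; rewrite ?Re_cexp ?Im_cexp reE imE ?cosN ?sinN //= mulrN.
Qed.

(** In the coordinate [w = t + i th] the circle of radius [exp (- 2 t)] becomes a vertical segment
    of height [pi], to which the rectangle identity applies. *)
Let H (w : C) := G (cexp (- 2 * w)).

Let dH w : 0 < Re w -> cderivable H w.
Proof.
case: w => t th /= t0; rewrite /H.
have E1 : expR (- 2 * t) < 1 by rewrite expR_lt1; lra.
apply: (@cderivable_comp R (fun w => cexp (- 2 * w)) G).
  apply: (@cderivable_comp R (fun w => - 2 * w) (@cexp R)); last exact: cderivable_cexp.
  by apply: cderivableM; [exact: cderivable_cst|exact: cderivable_id].
rewrite cexpE; apply: dG; rewrite ?modulus_E ?expR_ge0 ?ltW //.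
apply/eqP => e1; have : modulus (E (expR (- 2 * t)) th) = 1.
  by move/eqP: e1; rewrite addrC addr_eq0 => /eqP ->; rewrite modulusN modulus1.
by rewrite modulus_E ?expR_ge0 // => e2; rewrite e2 ltxx in E1.
Qed.

Let HK w : 0 < Re w -> `|Re (H w)| <= K.
Proof.
case: w => t th /= t0; apply: le_trans (normRe_le _) _; rewrite /H cexpE; apply: hK.
by apply: cayley_gtNb; rewrite modulus_E ?expR_ge0 // expR_le1; lra.
Qed.

Local Notation arc := `]- (pi / 2), (pi / 2)[ (only parsing).

Let H_measurable t : 0 < t -> measurable_fun arc (fun th => Re (H (t +i* th))).
Proof.
move=> t0; apply: open_continuous_measurable_fun; first exact: interval_open.
move=> y _.
by have [] := cderivable_continuous_line (@Re_lipschitz R) (dH (w := t +i* y) t0).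
Qed.

(** Bounded convergence on the open arc: on the unit circle the Cayley map is singular only at -1,
    which corresponds to the two excluded end points. *)
Let arc_limit (t : nat -> R) (r c : R) : 0 <= r <= 1 -> (forall n, 0 < t n) ->
  expR (- 2 * t n) @[n --> \oo] --> r ->
  (forall n, \int[mu]_(th in arc) Re (H (t n +i* th)) = c) ->
  c = \int[mu]_(th in arc) Re (G (E r th)).
Proof.
move=> r01 t0 tr tc.
have : \int[mu]_(th in arc) Re (H (t n +i* th)) @[n --> \oo] --> \int[mu]_(th in arc) Re (G (E r th)).
  have Ki : mu.-integrable arc (EFin \o (fun=> K)).
    have Kc : mu.-integrable `[- (pi / 2), pi / 2] (EFin \o (fun=> K)).
      by apply: integrable_itv_within => ?; exact: cvg_cst.
    by apply: integrableS Kc => //; exact: subset_itvW.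
  apply: dominated_cvg_Rintegral Ki _ => //.
  - by move=> n; exact: H_measurable.
  - move=> th; rewrite /= in_itv /= => thpi.
    have /andP[r0 r1] := r01.
    have dGE : cderivable G (E r th) by apply: dG; [rewrite modulus_E|exact: E_neq].
    apply/cvgrPdist_lt => e e0.
    have [d d0 dP] := cderivable_continuous dGE e0.
    move/cvgrPdist_lt : tr => /(_ _ d0); apply: filterS => n tn.
    rewrite distrC -ReN -ReD; apply: le_lt_trans (normRe_le _) _.
    rewrite /H cexpE; apply: dP.
    have -> : E (expR (- 2 * t n)) th - E r th = (expR (- 2 * t n) - r)%:C * E 1 th.
      by apply: complex_ext; rewrite !ReE /=; ring.
    by rewrite modulusM modulus_real modulus_E // mulr1 distrC.
  - by move=> n th _; exact: (HK (w := t n +i* th) (t0 n)).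
under eq_cvg do rewrite tc.
by move=> /(cvg_lim (@norm_hausdorff _ _)) <-; rewrite lim_cst.
Qed.

(** The mean of [G] over a circle does not depend on the radius: radius 0 gives [h 1], radius 1
    gives the values of [h] on the imaginary axis. *)
Lemma poisson_arc : \int[mu]_(th in arc) Re (h (0 +i* tan th)) = pi * Re (h 1).
Proof.
have pi2 : - (pi / 2) < pi / 2 :> R by have := pi_gt0 R; lra.
have arcE t : 0 < t -> \int[mu]_(th in arc) Re (H (t +i* th)) =
    \int[mu]_(th in `[- (pi / 2), pi / 2]) Re (H (t +i* th)).
  move=> t0; rewrite /Rintegral; congr fine.
  apply/esym/integral_itv_bndoo/measurable_EFinP.
  exact: H_measurable.
have per t : H (t +i* (- (pi / 2))) = H (t +i* (pi / 2)).
  rewrite /H !cexpE /E.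
  have -> : 2 * - (pi / 2) = - pi :> R by lra.
  have -> : 2 * (pi / 2) = pi :> R by lra.
  by rewrite cosN sinN sinpi oppr0.
have mean t s : 0 < t -> t < s -> \int[mu]_(th in arc) Re (H (t +i* th)) =
    \int[mu]_(th in arc) Re (H (s +i* th)).
  move=> t0 ts; rewrite (arcE _ t0) (arcE _ (lt_trans t0 ts)).
  exact: (Re_circle_mean_const dH).
pose c := \int[mu]_(th in arc) Re (H (1 +i* th)).
have meanc t : 0 < t -> \int[mu]_(th in arc) Re (H (t +i* th)) = c.
  move=> t0; have [t1|t1|->//] := ltgtP t 1; first exact: mean.
  by rewrite /c (mean 1 t).
have c0 : c = \int[mu]_(th in arc) Re (G (E 0 th)).
  (* Large abscissas shrink the circles to the centre; below, the abscissas [n.+1%:R^-1] push them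
     to the unit circle. *)
  apply: (@arc_limit (fun n => n.+1%:R)); rewrite ?lexx ?ler01 //.
  - under eq_cvg do rewrite mulrC expRM_natl.
    have z1 : `|expR (- 2) : R| < 1 by rewrite ger0_norm ?expR_ge0 // expR_lt1; lra.
    by have := cvg_expr z1; rewrite -cvg_shiftS.
  - by move=> n; exact: meanc.
have c1 : c = \int[mu]_(th in arc) Re (G (E 1 th)).
  apply: (@arc_limit (fun n => n.+1%:R^-1)); rewrite ?lexx ?ler01 //.
  - rewrite [X in _ --> X](_ : 1 = expR (- 2 * 0)); last by rewrite mulr0 expR0.
    apply: (@cvg_comp _ _ _ (fun n => - 2 * n.+1%:R^-1) (@expR R)); last exact: continuous_expR.
    by apply: (@cvgMr _ _ _ _ harmonic); exact: cvg_harmonic.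
  - by move=> n; exact: meanc.
transitivity c.
  rewrite c1; apply: eq_Rintegral => th; rewrite inE /= in_itv /= => thpi.
  congr (Re (h _)); have E1 : 1 + E 1 th != 0 by apply: E_neq; rewrite ?lexx ?ler01.
  apply: (mulIf E1); rewrite divfK //.
  have ct : cos th != 0 by rewrite lt0r_neq0 // cos_gt0_pihalf.
  have -> : E 1 th = (cos th ^+ 2 *+ 2 - 1) +i* (- (cos th * sin th *+ 2)).
    by rewrite /E !mul1r (_ : 2 * th = th *+ 2) ?cos_mulr2n ?sin_mulr2n // mulr2n; lra.
  apply: complex_ext; rewrite !ReE /= /tan; first by rewrite cos2sin2 !mulr2n; field.
  by rewrite !mulr2n; field.
rewrite c0.
have -> : pi * Re (h 1) = \int[mu]_(th in arc) Re (h 1).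
  rewrite Rintegral_cst // mulrC; congr (_ * _).
  have muE : fine (mu `](- (pi / 2)), (pi / 2)[) = pi.
    by rewrite lebesgue_measure_itv /= lte_fin pi2 /=; lra.
  exact: esym muE.
apply: eq_Rintegral => th _; congr (Re (h _)).
have -> : E 0 th = 0 by rewrite /E !mul0r oppr0.
by rewrite subr0 addr0 divr1.
Unshelve. all: by end_near. Qed.

End PoissonArc.

(** * The Poisson formula on vertical lines *)

Section PoissonLine.
Variable R : realType.
Local Notation C := R[i].
Local Notation mu := (@lebesgue_measure R).
Implicit Types (f : R -> R).

(** The factor [1 / pi] is left out, so for positive [c] the total mass over the line is [pi]. *)
Definition poisson_kernel (c u : R) : R := c / (c ^+ 2 + u ^+ 2).

Section Kernel.
Variables (c y : R).
Hypothesis c0 : 0 < c.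

Lemma poisson_kernel_gt0 u : 0 < poisson_kernel c u.
Proof. by rewrite divr_gt0 // ltr_wpDr ?sqr_ge0 ?exprn_gt0. Qed.

Lemma poisson_kernel_ge0 u : 0 <= poisson_kernel c u.
Proof. exact/ltW/poisson_kernel_gt0. Qed.

Lemma continuous_poisson_kernel : continuous (fun u => poisson_kernel c (u - y)).
Proof.
move=> u; rewrite /poisson_kernel; apply: cvgM; first exact: cvg_cst.
apply: cvgV; first by rewrite lt0r_neq0 // ltr_wpDr ?sqr_ge0 ?exprn_gt0.
apply: cvgD; first exact: cvg_cst.
by apply: cvgM; apply: cvgB; do ?[exact: cvg_cst|exact: cvg_id].
Qed.

Lemma measurable_poisson_kernel : measurable_fun setT (fun u : R => poisson_kernel c (u - y)).
Proof. exact: continuous_measurable_fun continuous_poisson_kernel. Qed.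

Let F u := atan ((u - y) / c).

Let dF (u : R) : is_derive u 1 F (poisson_kernel c (u - y)).
Proof.
have da : is_derive u 1 (fun u : R => (u - y) / c) c^-1.
  by apply: is_derive_eq; rewrite scaler0 add0r subr0 scaler1.
have -> : poisson_kernel c (u - y) = (1 + ((u - y) / c) ^+ 2)^-1 * c^-1.
  rewrite /poisson_kernel; field; rewrite lt0r_neq0 //=.
  by rewrite lt0r_neq0 // ltr_wpDr ?sqr_ge0 ?exprn_gt0.
exact: (@is_derive1_comp _ atan (fun u => (u - y) / c)).
Qed.

Let F_lt : {homo F : u v / u < v}.
Proof. by move=> u v uv; apply: lt_atan; rewrite ltr_pM2r ?invr_gt0 // ltrD2r. Qed.

Let FK u : y + c * tan (F u) = u.
Proof. by rewrite /F atanK mulrC divfK ?subrKC // lt0r_neq0. Qed.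

Local Notation arc := `]- (pi / 2), (pi / 2)[ (only parsing).

Let F_arc u : - (pi / 2) < F u < pi / 2.
Proof. by rewrite atan_gtNpi2 atan_ltpi2. Qed.

(** The substitution [u = y + c * tan th] is singular at both ends of the arc, so it is carried out
    for [u] in [[- n, n]] and extended by monotone convergence on both sides. *)
Lemma ge0_integral_arc_line f : continuous f -> (forall u, 0 <= f u) ->
  (\int[mu]_(th in arc) (f (y + c * tan th))%:E =
   \int[mu]_u (f u * poisson_kernel c (u - y))%:E)%E.
Proof.
move=> cf f0; pose G th := f (y + c * tan th).
have cG : {in arc, continuous G}.
  move=> th; rewrite inE /= in_itv /= => /cos_gt0_pihalf/lt0r_neq0 cth.
  apply: (@cvg_comp _ _ _ (fun th => y + c * tan th) f); last exact: cf.
  apply: cvgD; first exact: cvg_cst.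
  apply: cvgM; first exact: cvg_cst.
  exact: continuous_tan.
have dE : F^`() = (fun u => poisson_kernel c (u - y)).
  by apply/funext => u; rewrite derive1E; have [] := dF u.
have sub n : (\int[mu]_(th in `[(F (- n%:R))%R, (F n%:R)%R]) (G th)%:E =
    \int[mu]_(u in `[(- n%:R)%R, n%:R%R]) (f u * poisson_kernel c (u - y))%:E)%E.
  rewrite integration_by_substitution_increasing.
  - by apply: eq_integral => u _; rewrite dE /G /= [X in (f X * _)%:E](FK u).
  - by rewrite ge0_cp // ler0n.
  - by move=> u v _ _; exact: F_lt.
  - by rewrite dE => u _; exact: continuous_poisson_kernel.
  - rewrite dE; apply/cvg_ex; exists (poisson_kernel c (- n%:R - y)).
    exact/cvg_at_right_filter/continuous_poisson_kernel.
  - rewrite dE; apply/cvg_ex; exists (poisson_kernel c (n%:R - y)).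
    exact/cvg_at_left_filter/continuous_poisson_kernel.
  - have cF : continuous F.
      by move=> u; apply/differentiable_continuous/derivable1_diffP; have [] := dF u.
    split; [by move=> u _; have [] := dF u|exact/cvg_at_right_filter/cF|
      exact/cvg_at_left_filter/cF].
  - apply: continuous_in_subspaceT => th; rewrite inE /= in_itv /= => /andP[th1 th2].
    apply: cG; rewrite inE /= in_itv /=; apply/andP; split.
      by apply: lt_le_trans th1; have /andP[] := F_arc (- n%:R).
    by apply: le_lt_trans th2 _; have /andP[] := F_arc n%:R.
have mG : measurable_fun arc (EFin \o G).
  by apply/measurable_EFinP; apply: open_continuous_measurable_fun cG; exact: interval_open.
have mf : measurable_fun setT (fun u => (f u * poisson_kernel c (u - y))%:E).
  apply/measurable_EFinP; apply: continuous_measurable_fun => u.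
  by apply: cvgM; [exact: cf|exact: continuous_poisson_kernel].
have nat_bound (u : R) : exists n : nat, - n%:R <= u <= n%:R.
  exists (Num.Def.archi_bound `|u|); have := archi_boundP (normr_ge0 u).
  by rewrite -ler_norml; exact: ltW.
have A1 : (\int[mu]_(th in `[(F (- n%:R))%R, (F n%:R)%R]) (G th)%:E @[n --> \oo] -->
    \int[mu]_(th in arc) (G th)%:E)%E.
  have -> : arc = \bigcup_n `[F (- n%:R), F n%:R].
    apply/seteqP; split => th /=.
      rewrite in_itv /= => tha; have [n /andP[n1 n2]] := nat_bound (y + c * tan th).
      have thE : th = F (y + c * tan th).
        rewrite /F (addrC y) addrK mulrC mulKf ?lt0r_neq0 // tanK //.
      have Fle : {homo F : u v / u <= v} by apply: ltW_homo; exact: F_lt.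
      by exists n => //=; rewrite in_itv /= thE !Fle.
    move=> [n _]; rewrite /= !in_itv /= => /andP[th1 th2]; apply/andP; split.
      by apply: lt_le_trans th1; have /andP[] := F_arc (- n%:R).
    by apply: le_lt_trans th2 _; have /andP[] := F_arc n%:R.
  apply: ge0_nondecreasing_set_cvg_integral.
  - have Fle : {homo F : u v / u <= v} by apply: ltW_homo; exact: F_lt.
    move=> n m nm; apply/subsetPset/subset_itv; rewrite bnd_simp Fle // ?lerN2 ler_nat //.
  - by [].
  - move=> n; apply: measurable_funS mG => // th.
    rewrite /= !in_itv /= => /andP[th1 th2]; apply/andP; split.
      by apply: lt_le_trans th1; have /andP[] := F_arc (- n%:R).
    by apply: le_lt_trans th2 _; have /andP[] := F_arc n%:R.
  - by move=> n th _; rewrite lee_fin f0.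
have A2 : (\int[mu]_(u in `[(- n%:R)%R, n%:R%R]) (f u * poisson_kernel c (u - y))%:E @[n --> \oo] -->
    \int[mu]_u (f u * poisson_kernel c (u - y))%:E)%E.
  have TE : setT = \bigcup_n `[- n%:R, n%:R] :> set R.
    apply/seteqP; split => u // _; have [n nu] := nat_bound u.
    by exists n => //=; rewrite in_itv.
  rewrite TE; apply: ge0_nondecreasing_set_cvg_integral.
  - by move=> n m nm; apply/subsetPset/subset_itv; rewrite bnd_simp ?lerN2 ler_nat.
  - by [].
  - by move=> n; apply: measurable_funS mf.
  - by move=> n u _; rewrite lee_fin mulr_ge0 // poisson_kernel_ge0.
move: A1; under eq_fun do rewrite sub.
move=> /(cvg_unique (@ereal_hausdorff _)); apply; exact: A2.
Qed.

Lemma integral_poisson_kernel : (\int[mu]_u (poisson_kernel c (u - y))%:E = pi%:E)%E.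
Proof.
have := @ge0_integral_arc_line (fun=> 1) (@cst_continuous _ _ (1 : R)) (fun=> ler01).
under [X in _ = X -> _]eq_integral do rewrite mul1r.
move=> <-; rewrite integral_cst //= mul1e.
have pi2 : - (pi / 2) < pi / 2 :> R by have := pi_gt0 R; lra.
have : mu `](- (pi / 2)), (pi / 2)[ = (pi : R)%:E.
  by rewrite lebesgue_measure_itv /= lte_fin pi2 -EFinD; congr EFin; lra.
exact.
Qed.

Lemma integrable_poisson_kernel : mu.-integrable setT (EFin \o (fun u => poisson_kernel c (u - y))).
Proof.
apply/integrableP; split.
  by apply/measurable_EFinP; exact: measurable_poisson_kernel.
under eq_integral do rewrite /= ger0_norm ?poisson_kernel_ge0 //.
by rewrite integral_poisson_kernel ltry.
Qed.

Lemma integrable_mul_poisson_kernel f (K : R) :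
  measurable_fun setT f -> (forall u, `|f u| <= K) ->
  mu.-integrable setT (EFin \o (fun u => f u * poisson_kernel c (u - y))).
Proof.
move=> mf fK.
apply: (le_integrable _ _ _ (integrable_funZ K integrable_poisson_kernel _)) => //.
  by apply/measurable_EFinP; apply: (measurable_funM mf measurable_poisson_kernel).
move=> u _ /=; rewrite lee_fin !normrM ler_wpM2r //.
by apply: le_trans (fK u) _; exact: ler_norm.
Qed.

(** Adding [K] makes [f] nonnegative, and the constant contributes [K * pi] to both integrals. *)
Lemma Rintegral_arc_line f (K : R) : continuous f -> (forall u, `|f u| <= K) ->
  \int[mu]_(th in arc) f (y + c * tan th) = \int[mu]_u (f u * poisson_kernel c (u - y)).
Proof.
move=> cf fK.
have f0 u : 0 <= f u + K by have := fK u; rewrite ler_norml => /andP[]; lra.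
have cfK : continuous (fun u => f u + K) by move=> u; apply: cvgD; [exact: cf|exact: cvg_cst].
have E := ge0_integral_arc_line cfK f0.
have mf : measurable_fun setT f := continuous_measurable_fun cf.
have iK : mu.-integrable setT (EFin \o (fun u => K * poisson_kernel c (u - y))).
  by apply: integrable_funZ => //; exact: integrable_poisson_kernel.
have if_ := integrable_mul_poisson_kernel mf fK.
have muarc : mu arc = (pi : R)%:E.
  have pi2 : - (pi / 2) < pi / 2 :> R by have := pi_gt0 R; lra.
  have : mu `](- (pi / 2)), (pi / 2)[ = (pi : R)%:E.
    by rewrite lebesgue_measure_itv /= lte_fin pi2 -EFinD; congr EFin; lra.
  exact.
have mft : measurable_fun arc (fun th => f (y + c * tan th)).
  apply: open_continuous_measurable_fun; first exact: interval_open.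
  move=> th; rewrite inE /= in_itv /= => /cos_gt0_pihalf/lt0r_neq0 cth.
  apply: (@cvg_comp _ _ _ (fun th => y + c * tan th) f); last exact: cf.
  apply: cvgD; first exact: cvg_cst.
  by apply: cvgM; [exact: cvg_cst|exact: continuous_tan].
have ic (k : R) : mu.-integrable arc (EFin \o (fun=> k)).
  apply/integrableP; split; first exact/measurable_EFinP/measurable_cst.
  by rewrite /= integral_cst //= -/arc muarc -EFinM ltry.
have ift : mu.-integrable arc (EFin \o (fun th => f (y + c * tan th))).
  apply: le_integrable (ic K) => //; first exact/measurable_EFinP.
  by move=> th _ /=; rewrite lee_fin (le_trans (fK _)) // ler_norm.
have := congr1 fine E; rewrite -!/(Rintegral _ _ _).
have -> : \int[mu]_u ((f u + K) * poisson_kernel c (u - y)) =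
    \int[mu]_u (f u * poisson_kernel c (u - y)) + K * pi.
  under eq_Rintegral do rewrite mulrDl.
  rewrite RintegralD // RintegralZl //; last exact: integrable_poisson_kernel.
  by rewrite [in X in _ + K * X]/Rintegral integral_poisson_kernel.
rewrite RintegralD //.
have -> : \int[mu]_(th in arc) K = K * pi.
  rewrite Rintegral_cst //; congr (_ * _); exact: (congr1 fine muarc).
by move/addIr.
Qed.

End Kernel.

(** The affine map [s -> a + i Im z + c s] with [c = Re z - a] sends 1 to [z] and the imaginary axis
    to the line [Re = a]. The gap [a - b] becomes the margin that [poisson_arc] asks for. *)
Lemma poisson_line (h : C -> C) (b K a : R) (z : C) :
  (forall w, b < Re w -> cderivable h w) ->
  (forall w, b < Re w -> modulus (h w) <= K) -> b < a -> a < Re z ->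
  \int[mu]_u (Re (h (a +i* u)) * poisson_kernel (Re z - a) (u - Im z)) = pi * Re (h z).
Proof.
move=> dh hK ba az; pose c := Re z - a; have c0 : 0 < c by rewrite subr_gt0.
pose g (s : C) := h ((a +i* Im z) + c%:C * s).
have gE s : Re ((a +i* Im z) + c%:C * s) = a + c * Re s by rewrite !ReE /=; ring.
have ins s : - ((a - b) / c) < Re s -> b < Re ((a +i* Im z) + c%:C * s).
  by rewrite gE -mulNr ltr_pdivrMr //; lra.
have b'0 : 0 < (a - b) / c by rewrite divr_gt0 // subr_gt0.
have := @poisson_arc R g _ K b'0 _ (fun s sb => hK _ (ins s sb)).
have -> : g 1 = h z.
  rewrite /g; congr h; apply: complex_ext; rewrite !ReE /= /c; ring.
move=> <-; last first.
  move=> s sb; apply: (@cderivable_comp R (fun s => (a +i* Im z) + c%:C * s) h); last exact/dh/ins.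
  apply: cderivableD; first exact: cderivable_cst.
  by apply: cderivableM; [exact: cderivable_cst|exact: cderivable_id].
have cf : continuous (fun u => Re (h (a +i* u))).
  by move=> u; have [] := cderivable_continuous_line (@Re_lipschitz R) (dh (a +i* u) ba).
have fK u : `|Re (h (a +i* u))| <= K by apply: le_trans (normRe_le _) _; exact: hK.
rewrite -(Rintegral_arc_line (Im z) c0 cf fK); apply: eq_Rintegral => th _.
by congr (Re (h _)); apply: complex_ext; rewrite !ReE /=; ring.
Qed.

End PoissonLine.

(** * The Schwarz-Pick inequality *)

Section PickBounded.
Variable R : realType.
Local Notation C := R[i].
Local Notation mu := (@lebesgue_measure R).
Variables (h : C -> C) (b K a : R).
Hypotheses (dh : forall z, b < Re z -> cderivable h z)
  (hK : forall z, b < Re z -> modulus (h z) <= K) (ba : b < a).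

(** On the line [Re s = a] the factors [z^*c + s - 2 a] and [w^*c + s - 2 a] are the conjugates of
    [z - s] and [w - s], yet they are holomorphic in [s]. This lets the Poisson formula integrate
    [h] against a kernel times a conjugated kernel. *)
Let g (c z w : C) (s : C) := c * h s * (z^*c + s - (2 * a)%:C) / (w^*c + s - (2 * a)%:C).

(** The denominator of [g] vanishes at the reflection of [w] in the line [Re = a]; stopping halfway
    keeps that zero at a positive distance to the left. *)
Let b' (w : C) := Num.max b (a - (Re w - a) / 2).

Let b'a w : a < Re w -> b' w < a.
Proof. by move=> aw; rewrite gt_max ba /=; lra. Qed.

Let den_ge w s : a < Re w -> b' w < Re s -> (Re w - a) / 2 <= Re (w^*c + s - (2 * a)%:C).
Proof. by move=> aw; rewrite gt_max => /andP[_ bs]; rewrite !ReE /=; lra. Qed.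

Let den_neq0 w s : a < Re w -> b' w < Re s -> w^*c + s - (2 * a)%:C != 0.
Proof.
move=> aw bs; apply/Re_gt0_neq0/lt_le_trans/(den_ge aw bs).
by rewrite divr_gt0 ?subr_gt0.
Qed.

Let dg c z w s : a < Re w -> b' w < Re s -> cderivable (g c z w) s.
Proof.
move=> aw bs; have bs' : b < Re s by move: bs; rewrite gt_max => /andP[].
have dlin k : cderivable (fun s => k + s - (2 * a)%:C) s.
  apply: cderivableD; last exact: cderivable_cst.
  by apply: cderivableD; [exact: cderivable_cst|exact: cderivable_id].
apply: cderivableM; last by apply: cderivableV; [exact: den_neq0|exact: dlin].
apply: cderivableM; last exact: dlin.
by apply: cderivableM; [exact: cderivable_cst|exact: dh].
Qed.

Let Kg (c z w : C) := modulus c * K * (1 + modulus (z^*c - w^*c) * (2 / (Re w - a))).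

Let g_le c z w s : a < Re w -> b' w < Re s -> modulus (g c z w s) <= Kg c z w.
Proof.
move=> aw bs; have bs' : b < Re s by move: bs; rewrite gt_max => /andP[].
have D0 := den_neq0 aw bs; have Dge := den_ge aw bs.
have -> : g c z w s = c * h s * (1 + (z^*c - w^*c) / (w^*c + s - (2 * a)%:C)).
  rewrite /g (_ : z^*c + s - (2 * a)%:C = (z^*c - w^*c) + (w^*c + s - (2 * a)%:C)); last by ring.
  by rewrite -mulrA mulrDl divff // addrC.
have wa0 : 0 < Re w - a by rewrite subr_gt0.
rewrite !modulusM; apply: ler_pM; rewrite ?mulr_ge0 ?modulus_ge0 //.
  by rewrite ler_wpM2l ?modulus_ge0 ?hK.
apply: le_trans (modulusD _ _) _; rewrite modulus1 lerD2l modulusM modulusV.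
rewrite ler_wpM2l ?modulus_ge0 //.
rewrite -[2 / _]invrK lef_pV2 ?posrE; last 2 first.
- by rewrite modulus_gt0.
- by rewrite invr_gt0 divr_gt0.
by rewrite invf_div; exact: le_trans Dge (Re_le _).
Qed.

Let k (z : C) (u : R) : C := (z - (a +i* u))^-1.

Let kernelE (z : C) (u : R) : a < Re z ->
  poisson_kernel (Re z - a) (u - Im z) = (Re z - a) * modulus (k z u) ^+ 2.
Proof.
move=> az; rewrite /poisson_kernel /k modulusV exprVn sqr_modulus !ReE /=.
by congr (_ / _); ring.
Qed.

(** The Poisson kernel at [z] is [Re z - a] times [modulus (k z u) ^+ 2], and [g c z w z] carries
    the factor [2 * (Re z - a)], so the distance to the line cancels. *)
Let poisson_g c z w : a < Re z -> a < Re w ->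
  mu.-integrable setT (EFin \o (fun u => Re (g c z w (a +i* u)) * modulus (k z u) ^+ 2)) /\
  \int[mu]_u (Re (g c z w (a +i* u)) * modulus (k z u) ^+ 2) =
  2 * pi * Re (c * h z / (z + w^*c - (2 * a)%:C)).
Proof.
move=> az aw; have za0 : 0 < Re z - a by rewrite subr_gt0.
have kE u : modulus (k z u) ^+ 2 = (Re z - a)^-1 * poisson_kernel (Re z - a) (u - Im z).
  by rewrite kernelE // mulKf // lt0r_neq0.
have cg : continuous (fun u => Re (g c z w (a +i* u))).
  move=> u; have [] := cderivable_continuous_line (@Re_lipschitz R) (@dg c z w (a +i* u) aw (b'a aw)) => //.
have gK u : `|Re (g c z w (a +i* u))| <= Kg c z w.
  by apply: le_trans (normRe_le _) _; apply: g_le => //; exact: b'a.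
have gi := integrable_mul_poisson_kernel (Im z) za0 (continuous_measurable_fun cg) gK.
have E u : Re (g c z w (a +i* u)) * modulus (k z u) ^+ 2 =
    (Re z - a)^-1 * (Re (g c z w (a +i* u)) * poisson_kernel (Re z - a) (u - Im z)).
  by rewrite kE mulrCA.
split.
  under eq_fun do rewrite E.
  exact: integrable_funZ gi _.
under eq_Rintegral do rewrite E.
rewrite RintegralZl //.
have zb : b' w < Re z := lt_trans (b'a aw) az.
have := @poisson_line R (g c z w) (b' w) (Kg c z w) a z (fun s bs => @dg c z w s aw bs)
  (fun s bs => @g_le c z w s aw bs) (b'a aw) az.
move=> ->.
have -> : g c z w z = (2 * (Re z - a))%:C * (c * h z / (z + w^*c - (2 * a)%:C)).
  have zE : z^*c + z - (2 * a)%:C = (2 * (Re z - a))%:C.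
    by apply: complex_ext; rewrite !ReE /=; ring.
  by rewrite /g zE (addrC w^*c); set i := (_)^-1; ring.
by rewrite ReZ; field; rewrite lt0r_neq0.
Qed.

Hypothesis h_ge0 : forall z, b < Re z -> 0 <= Re (h z).

(** The integral over the line of [Re h * |t k_z - T k_w|^2] is nonnegative, and [poisson_g]
    evaluates its four terms. This is the positivity of the two-point Pick matrix. *)
Let form_ge0 z w (t : R) (T : C) : a < Re z -> a < Re w ->
  0 <= t ^+ 2 * (Re (h z) / (Re z - a)) + modulus T ^+ 2 * (Re (h w) / (Re w - a))
    - 2 * t * Re (T^*c * ((h z + (h w)^*c) / (z + w^*c - (2 * a)%:C))).
Proof.
move=> az aw.
have [i1 e1] := poisson_g (t ^+ 2)%:C az az.
have [i2 e2] := poisson_g (modulus T ^+ 2)%:C aw aw.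
have [i3 e3] := poisson_g (- (t%:C * T^*c)) az aw.
have [i4 e4] := poisson_g (- (t%:C * T)) aw az.
have i12 := integrable_funD i1 i2 measurableT.
have i34 := integrable_funD i3 i4 measurableT.
have pos : 0 <= \int[mu]_u ((Re (g (t ^+ 2)%:C z z (a +i* u)) * modulus (k z u) ^+ 2 +
   Re (g (modulus T ^+ 2)%:C w w (a +i* u)) * modulus (k w u) ^+ 2) +
   (Re (g (- (t%:C * T^*c)) z w (a +i* u)) * modulus (k z u) ^+ 2 +
   Re (g (- (t%:C * T)) w z (a +i* u)) * modulus (k w u) ^+ 2)).
  apply: Rintegral_ge0 => u _.
  have za : z - (a +i* u) != 0 by apply: Re_gt0_neq0; rewrite !ReE /= subr_gt0.
  have wa : w - (a +i* u) != 0 by apply: Re_gt0_neq0; rewrite !ReE /= subr_gt0.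
  have cz : z^*c + (a +i* u) - (2 * a)%:C = (z - (a +i* u))^*c.
    by apply: complex_ext; rewrite !ReE /=; ring.
  have cw : w^*c + (a +i* u) - (2 * a)%:C = (w - (a +i* u))^*c.
    by apply: complex_ext; rewrite !ReE /=; ring.
  have kk (v : C) : v != 0 -> (modulus v^-1 ^+ 2)%:C * v^*c = v^-1.
    by move=> v0; rewrite [RHS]conj_invr modulusV exprVn.
  have kc (v : C) : (v^*c)^-1 = (v^-1)^*c.
    apply: complex_ext; rewrite ?ReV ?ImV ?modulus_conj !ReE ?ReV ?ImV //; ring.
  have gk c (z' w' : C) : z' - (a +i* u) != 0 -> 
      z'^*c + (a +i* u) - (2 * a)%:C = (z' - (a +i* u))^*c ->
      w'^*c + (a +i* u) - (2 * a)%:C = (w' - (a +i* u))^*c ->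
      Re (g c z' w' (a +i* u)) * modulus (k z' u) ^+ 2 =
      Re (c * h (a +i* u) * (k z' u * (k w' u)^*c)).
    move=> z0 ez ew; rewrite /g ez ew /k kc.
    rewrite -[X in _ * (X * _)](kk _ z0) [RHS](_ : _ = Re ((modulus (z' - (a +i* u))^-1 ^+ 2)%:C *
       (c * h (a +i* u) * (z' - (a +i* u))^*c * ((w' - (a +i* u))^-1)^*c))); last by congr Re; ring.
    by rewrite [RHS]ReM /= mul0r subr0 mulrC.
  rewrite (gk (t ^+ 2)%:C z z za cz cz) (gk (modulus T ^+ 2)%:C w w wa cw cw).
  rewrite (gk (- (t%:C * T^*c)) z w za cz cw) (gk (- (t%:C * T)) w z wa cw cz).
  have := h_ge0 (z := a +i* u) ba; rewrite sqr_modulus.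
  move: (h _) (k z u) (k w u) => [r r'] [k1 k2] [l1 l2] /= r0; rewrite !ReE.
  move: (Re T) (Im T) => T1 T2 /=.
  rewrite [leRHS](_ : _ = r * ((t * k1 - (T1 * l1 - T2 * l2)) ^+ 2 + (t * k2 - (T1 * l2 + T2 * l1)) ^+ 2)).
    by rewrite mulr_ge0 // addr_ge0 // sqr_ge0.
  ring.
rewrite RintegralD // RintegralD // RintegralD // e1 e2 e3 e4 in pos.
have za0 : 0 < Re z - a by rewrite subr_gt0.
have wa0 : 0 < Re w - a by rewrite subr_gt0.
have sym (v : C) r : v + v^*c - (2 * r)%:C = (2 * (Re v - r))%:C.
  by apply: complex_ext; rewrite !ReE /=; ring.
have real_div (r x : R) (v : C) : Re (r%:C * v / x%:C) = r * Re v / x.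
  by rewrite -mulrA ReM /= mul0r subr0 mulrC -fmorphV /= ReM /= mulr0 subr0; ring.
have pi0 := pi_gt0 R.
rewrite !sym !real_div in pos.
have conjE : Re (- (t%:C * T) * h w / (w + z^*c - (2 * a)%:C)) =
    Re (- (t%:C * T^*c) * (h w)^*c / (z + w^*c - (2 * a)%:C)).
  rewrite -[LHS]Re_conj; congr Re.
  have JM (x y : C) : (x * y)^*c = x^*c * y^*c by apply: complex_ext; rewrite !ReE; ring.
  have JV (x : C) : (x^-1)^*c = (x^*c)^-1.
    by apply: complex_ext; rewrite ?ReV ?ImV ?modulus_conj !ReE ?ReV ?ImV //; ring.
  rewrite JM JV; congr (_ * _^-1).
    by apply: complex_ext; rewrite !ReE /=; ring.
  by apply: complex_ext; rewrite !ReE /=; ring.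
rewrite conjE in pos.
have lin : Re (- (t%:C * T^*c) * h z / (z + w^*c - (2 * a)%:C)) +
   Re (- (t%:C * T^*c) * (h w)^*c / (z + w^*c - (2 * a)%:C)) =
   - t * Re (T^*c * ((h z + (h w)^*c) / (z + w^*c - (2 * a)%:C))).
  rewrite -ReD [X in Re X](_ : _ = (- t)%:C * (T^*c * ((h z + (h w)^*c) / (z + w^*c - (2 * a)%:C)))).
    by rewrite ReZ.
  by rewrite rmorphN; ring.
rewrite -(pmulr_rge0 _ pi0); apply: le_trans pos _.
rewrite -[X in _ + X]mulrDr lin le_eqVlt; apply/orP; left; apply/eqP.
by field; rewrite !lt0r_neq0.
Qed.

(** The determinant condition for the Pick matrix. Taking [T] to be the off-diagonal entry makes the
    cross term [2 * t * m] with [m = |T|^2], so only a real quadratic in [t] remains. *)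
Lemma pick_bounded z w : a < Re z -> a < Re w ->
  modulus (h z + (h w)^*c) ^+ 2 * (Re z - a) * (Re w - a) <=
  Re (h z) * Re (h w) * modulus (z + w^*c - (2 * a)%:C) ^+ 2.
Proof.
move=> az aw; have za0 : 0 < Re z - a by rewrite subr_gt0.
have wa0 : 0 < Re w - a by rewrite subr_gt0.
pose T := (h z + (h w)^*c) / (z + w^*c - (2 * a)%:C).
have D0 : z + w^*c - (2 * a)%:C != 0 by apply: Re_gt0_neq0; rewrite !ReE /=; lra.
pose A := Re (h z) / (Re z - a); pose B := Re (h w) / (Re w - a); pose m := modulus T ^+ 2.
have A0 : 0 <= A by rewrite divr_ge0 ?h_ge0 ?(lt_trans ba) // ltW.
have B0 : 0 <= B by rewrite divr_ge0 ?h_ge0 ?(lt_trans ba) // ltW.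
have m0 : 0 <= m by rewrite sqr_ge0.
have form t : 0 <= t ^+ 2 * A + m * B - 2 * t * m.
  have := form_ge0 t T az aw; rewrite -/T -/A -/B -/m.
  by rewrite (_ : Re (T^*c * T) = m) // /m sqr_modulus !ReE; ring.
have mAB : m <= A * B.
  have [A1|A1] := ltP 0 A.
    (* [m / A] minimises the quadratic in [t]. *)
    have := form (m / A); have -> : (m / A) ^+ 2 * A + m * B - 2 * (m / A) * m = m / A * (A * B - m).
      by field; rewrite lt0r_neq0.
    move=> mA; case: (eqVneq m 0) => [->|mn]; first by rewrite mulr_ge0.
    move: mA.
    by rewrite pmulr_rge0 ?subr_ge0 // divr_gt0 // lt0r mn.
  have A2 : A = 0 by apply/eqP; rewrite eq_le A0 A1.
  (* When [A = 0] the form is affine in [t], and [t = B + 1] makes it [- m * (B + 2)], so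
     [m = 0]. *)
  have := form (B + 1); rewrite A2 mulr0 mul0r add0r; nra.
have -> : h z + (h w)^*c = T * (z + w^*c - (2 * a)%:C) by rewrite /T divfK.
rewrite modulusM exprMn -/m.
have -> : Re (h z) = A * (Re z - a) by rewrite /A divfK // lt0r_neq0.
have -> : Re (h w) = B * (Re w - a) by rewrite /B divfK // lt0r_neq0.
have D1 : 0 <= modulus (z + w^*c - (2 * a)%:C) ^+ 2 by rewrite sqr_ge0.
rewrite [leLHS](_ : _ = m * (modulus (z + w^*c - (2 * a)%:C) ^+ 2 * (Re z - a) * (Re w - a))); last ring.
rewrite [leRHS](_ : _ = A * B * (modulus (z + w^*c - (2 * a)%:C) ^+ 2 * (Re z - a) * (Re w - a))); last ring.
apply: ler_wpM2r => //; exact: mulr_ge0 (mulr_ge0 D1 (ltW za0)) (ltW wa0).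
Qed.

End PickBounded.

Lemma nontangential_nat (R : realType) : nontangential (fun n => (n.+1%:R)%:C : R[i]).
Proof.
split=> [n| |]; first by rewrite /half_plane /= ltr0n.
- apply/cvgryPge => a; near=> n.
  apply: (@le_trans _ _ n%:R); last by rewrite /= ler_nat.
  by near: n; have /cvgryPge := @cvgr_idn R; apply.
- by exists 0 => _ [n _ <-]; rewrite normr0 mul0r.
Unshelve. all: by end_near. Qed.

Section PickSelfmap.
Variable R : realType.
Local Notation C := R[i].
Variable psi : C -> C.
Hypotheses (dpsi : forall z, 0 < Re z -> cderivable psi z)
  (psi_ge0 : forall z, 0 < Re z -> 0 <= Re (psi z)).

(** The inverse of [psi + e] is bounded by [e^-1]. Inversion preserves nonnegative real parts and
    the Pick inequality, since both sides acquire the same factor [|p z|^-2 |p w|^-2]. *)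
Let pick_shift z w (e : R) : 0 < e -> e < Re z -> e < Re w ->
  ((Re (psi z) + Re (psi w) + (e + e)) * (Re (psi z) + Re (psi w) + (e + e)) +
     (Im (psi z) - Im (psi w)) * (Im (psi z) - Im (psi w))) * (Re z - e) * (Re w - e) <=
  (Re (psi z) + e) * (Re (psi w) + e) *
  ((Re z + Re w - (e + e)) * (Re z + Re w - (e + e)) + (Im z - Im w) * (Im z - Im w)).
Proof.
move=> e0 ez ew; have z0 := lt_trans e0 ez; have w0 := lt_trans e0 ew.
pose p (z : C) := psi z + e%:C.
have Rep v : 0 < Re v -> e <= Re (p v) by move=> v0; rewrite ReD /= lerDr psi_ge0.
have p0 v : 0 < Re v -> p v != 0 by move=> v0; apply/Re_gt0_neq0/(lt_le_trans e0)/Rep.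
have dh v : 0 < Re v -> cderivable (fun v => (p v)^-1) v.
  move=> v0; apply: cderivableV; first exact: p0.
  by apply: cderivableD; [exact: dpsi|exact: cderivable_cst].
have hK v : 0 < Re v -> modulus (p v)^-1 <= e^-1.
  move=> v0; rewrite modulusV lef_pV2 ?posrE ?modulus_gt0 ?p0 //.
  by apply: le_trans (Re_le _); exact: Rep.
have h0 v : 0 < Re v -> 0 <= Re (p v)^-1.
  by move=> v0; rewrite ReV divr_ge0 ?sqr_ge0 // (le_trans (ltW e0)) ?Rep.
have := pick_bounded dh hK e0 h0 ez ew.
have Pz : 0 < modulus (p z) ^+ 2 by rewrite exprn_gt0 // modulus_gt0 p0.
have Pw : 0 < modulus (p w) ^+ 2 by rewrite exprn_gt0 // modulus_gt0 p0.
have -> : (p z)^-1 + ((p w)^-1)^*c = (p z + (p w)^*c) * ((p z)^-1 * ((p w)^-1)^*c).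
  have pp (v : C) : v != 0 -> v^*c * (v^-1)^*c = 1.
    move=> v0; rewrite -[1](_ : 1^*c = 1); last by apply: complex_ext; rewrite !ReE /= ?oppr0.
    rewrite -[in RHS](divff v0); apply: complex_ext; rewrite !ReE; ring.
  rewrite mulrDl mulrA divff ?p0 // mul1r mulrCA pp ?p0 // mulr1 addrC //.
rewrite !modulusM modulus_conj !modulusV !ReV !exprMn !exprVn.
rewrite [leLHS](_ : _ = modulus (p z + (p w)^*c) ^+ 2 * (Re z - e) * (Re w - e) *
   (modulus (p z) ^- 2 * modulus (p w) ^- 2)); last by ring.
rewrite [leRHS](_ : _ = Re (p z) * Re (p w) * modulus (z + w^*c - (2 * e)%:C) ^+ 2 *
   (modulus (p z) ^- 2 * modulus (p w) ^- 2)); last by ring.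
rewrite ler_pM2r ?mulr_gt0 ?invr_gt0 // !sqr_modulus !ReE /=.
by move=> H; apply: le_trans (le_trans _ H) _; rewrite le_eqVlt; apply/orP; left; apply/eqP; ring.
Qed.

(** Let [e] tend to 0 in [pick_shift]. Maps with [Re psi = 0] somewhere are included because Julia's
    argument uses [phi - beta z]. *)
Lemma pick_selfmap z w : 0 < Re z -> 0 < Re w ->
  modulus (psi z + (psi w)^*c) ^+ 2 * Re z * Re w <=
  Re (psi z) * Re (psi w) * modulus (z + w^*c) ^+ 2.
Proof.
move=> z0 w0.
have E x y : modulus (x + y^*c) ^+ 2 =
   (Re x + Re y) * (Re x + Re y) + (Im x - Im y) * (Im x - Im y).
  by rewrite sqr_modulus !ReE !expr2.
rewrite !E; move: (Re (psi z)) (Re (psi w)) (Im (psi z)) (Im (psi w)) (@pick_shift z w) => A B D E'.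
move: (Re z) (Re w) z0 w0 (Im z) (Im w) => x x' x0 x'0 y y' H.
have c0 (k : R) : cst k e @[e --> (0 : R)^'+] --> k by exact: cvg_cst.
have ci : (e : R) @[e --> (0 : R)^'+] --> (0 : R) by apply: cvg_at_right_filter; exact: cvg_id.
have H1 : ((A + B + (e + e)) * (A + B + (e + e)) + (D - E') * (D - E')) * (x - e) * (x' - e)
    @[e --> (0 : R)^'+] --> ((A + B) * (A + B) + (D - E') * (D - E')) * x * x'.
  have c1 : A + B + (e + e) @[e --> (0 : R)^'+] --> A + B.
    by rewrite -[X in _ --> X]addr0 -[X in _ --> _ + X]addr0; apply: cvgD; [exact: c0|exact: cvgD].
  have c2 k : k - e @[e --> (0 : R)^'+] --> k by rewrite -[X in _ --> X]subr0; apply: cvgB; [exact: c0|].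
  by apply: cvgM; [apply: cvgM; [apply: cvgD; [exact: cvgM|exact: c0]|exact: c2]|exact: c2].
have H2 : (A + e) * (B + e) * ((x + x' - (e + e)) * (x + x' - (e + e)) + (y - y') * (y - y'))
    @[e --> (0 : R)^'+] --> A * B * ((x + x') * (x + x') + (y - y') * (y - y')).
  have c1 : x + x' - (e + e) @[e --> (0 : R)^'+] --> x + x'.
    by rewrite -[X in _ --> X]subr0 -[X in _ --> _ - X]addr0; apply: cvgB; [exact: c0|exact: cvgD].
  have c2 k : k + e @[e --> (0 : R)^'+] --> k by rewrite -[X in _ --> X]addr0; apply: cvgD; [exact: c0|].
  by apply: cvgM; [apply: cvgM; exact: c2|apply: cvgD; [exact: cvgM|exact: c0]].
apply: (ler_cvg_to H1 H2); near=> e.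
by apply: H; near: e; [exact: nbhs_right_gt|exact: nbhs_right_lt|exact: nbhs_right_lt].
Unshelve. all: by end_near. Qed.

End PickSelfmap.

(** * Julia's lemma and the existence of the angular derivative *)

Section Julia.
Variable R : realType.
Local Notation C := R[i].
Variable phi : C -> C.
Hypotheses (dphi : forall z, 0 < Re z -> cderivable phi z)
  (phi_gt0 : forall z, 0 < Re z -> 0 < Re (phi z)).

Let s (n : nat) : C := (n.+1%:R)%:C.

Let s_nontangential := @nontangential_nat R.

Lemma angular_derivative_ratio (l : R) (z : nat -> C) : l != 0 -> angular_derivative phi l%:C ->
  nontangential z -> (phi (z n) / z n : C^o) @[n --> \oo] --> ((l^-1)%:C : C^o).
Proof.
move=> l0 [_ H] /H {}H.
have l0' : l%:C != 0 :> C by rewrite (inj_eq (@complexI R)).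
have -> : (fun n => phi (z n) / z n) = (fun n => (z n / phi (z n))^-1).
  by apply/funext => n; rewrite invf_div.
rewrite fmorphV; exact: (@cvgV C).
Qed.

Lemma cvg_complex_Re (T : Type) (A : set_system T) (FA : Filter A) (f : T -> C) (l : C) :
  (f x : C^o) @[x --> A] --> (l : C^o) -> Re (f x) @[x --> A] --> Re l.
Proof.
move=> /cvg_complexP H; apply/cvgrPdist_le => e /H; apply: filterS => x.
by apply: le_trans; rewrite distrC -ReN -ReD normRe_le.
Qed.

Lemma cvg_complex_Im (T : Type) (A : set_system T) (FA : Filter A) (f : T -> C) (l : C) :
  (f x : C^o) @[x --> A] --> (l : C^o) -> Im (f x) @[x --> A] --> Im l.
Proof.
move=> /cvg_complexP H; apply/cvgrPdist_le => e /H; apply: filterS => x.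
by apply: le_trans; rewrite distrC -ImN -ImD normIm_le.
Qed.

(** The Pick inequality between [z] and the point [n.+1], divided by the cube of [n.+1], tends to
    [l^-2 * Re z <= l^-1 * Re (phi z)]. *)
Lemma julia_ge (l : R) : 0 < l -> angular_derivative phi l%:C ->
  forall z, 0 < Re z -> Re z / l <= Re (phi z).
Proof.
move=> l0 ad z z0.
have r := angular_derivative_ratio (lt0r_neq0 l0) ad s_nontangential.
have rp : Re (phi (s n) / s n) @[n --> \oo] --> l^-1 by exact: (cvg_complex_Re _ r).
have ri : Im (phi (s n) / s n) @[n --> \oo] --> 0 by exact: (cvg_complex_Im _ r).
pose t n : R := n.+1%:R^-1; have tc : t n @[n --> \oo] --> 0 by exact: cvg_harmonic.
pose p n := Re (phi (s n) / s n); pose q n := Im (phi (s n) / s n).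
have H n : ((Re (phi z) * t n + p n) * (Re (phi z) * t n + p n) +
     (Im (phi z) * t n - q n) * (Im (phi z) * t n - q n)) * Re z <=
    Re (phi z) * p n * ((Re z * t n + 1) * (Re z * t n + 1) + (Im z * t n) * (Im z * t n)).
  have sn0 : 0 < n.+1%:R :> R by rewrite ltr0n.
  have := pick_selfmap dphi (fun z z0 => ltW (phi_gt0 z0)) z0 (sn0 : 0 < Re (s n)).
  have -> : phi (s n) = s n * (phi (s n) / s n) by rewrite mulrC divfK // (inj_eq (@complexI R)) lt0r_neq0.
  rewrite -[_ / _](@complex_ext R (p n +i* q n)) // !sqr_modulus /s !(ReZ, ImZ, ReD, ImD, Re_conj, Im_conj) /=.
  rewrite /t; move: (n.+1%:R) sn0 => N N0 P.
  have N3 : 0 < N ^+ 3 by rewrite exprn_gt0.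
  rewrite -(ler_pM2r N3).
  by apply: le_trans (le_trans _ P) _; rewrite le_eqVlt; apply/orP; left; apply/eqP; field;
    rewrite lt0r_neq0.
have c0 (k : R) : cst k n @[n --> \oo] --> k by exact: cvg_cst.
have ct (k : R) : k * t n @[n --> \oo] --> 0 by rewrite -[X in _ --> X](mulr0 k); apply: cvgM; [exact: c0|].
have A1 : ((Re (phi z) * t n + p n) * (Re (phi z) * t n + p n) +
     (Im (phi z) * t n - q n) * (Im (phi z) * t n - q n)) * Re z @[n --> \oo] -->
     ((0 + l^-1) * (0 + l^-1) + (0 - 0) * (0 - 0)) * Re z.
  apply: cvgM; last exact: c0.
  apply: cvgD; first by apply: cvgM; apply: cvgD; [exact: ct|exact: rp|exact: ct|exact: rp].
  by apply: cvgM; apply: cvgB; [exact: ct|exact: ri|exact: ct|exact: ri].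
have A2 : Re (phi z) * p n * ((Re z * t n + 1) * (Re z * t n + 1) + (Im z * t n) * (Im z * t n))
    @[n --> \oo] --> Re (phi z) * l^-1 * ((0 + 1) * (0 + 1) + 0 * 0).
  apply: cvgM; first by apply: cvgM; [exact: c0|exact: rp].
  apply: cvgD; last by apply: cvgM; exact: ct.
  by apply: cvgM; (apply: cvgD; [exact: ct|exact: c0]).
have : ((0 + l^-1) * (0 + l^-1) + (0 - 0) * (0 - 0)) * Re z <=
    Re (phi z) * l^-1 * ((0 + 1) * (0 + 1) + 0 * 0).
  by apply: (ler_cvg_to A1 A2); exact: nearW.
rewrite !(add0r, oppr0, mul0r, addr0, mulr1) mulrAC ler_pM2r ?invr_gt0 //.
by rewrite mulrC.
Qed.

(** With [beta] the infimum of [Re (phi z) / Re z], the map [psi = phi - beta z] still has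
    nonnegative real part, and [Re (psi w) / Re w] can be made arbitrarily small by a choice of [w].
    The Pick inequality against such a [w] forces [psi = o(Re z)] non-tangentially, so the angular
    derivative is [beta^-1]. *)
Lemma julia_angular_derivative (c : R) : 0 < c ->
  (forall z, 0 < Re z -> c * Re z <= Re (phi z)) ->
  exists2 l, 0 < l & angular_derivative phi l%:C.
Proof.
move=> c0 cphi; pose A := [set Re (phi z) / Re z | z in [set z : C | 0 < Re z]].
have cA x : A x -> c <= x by move=> [z /= z0 <-]; rewrite ler_pdivlMr // cphi.
have infA : has_inf A.
  split; first by exists (Re (phi 1) / 1); exists 1 => //=; exact: ltr01.
  by exists c => x /cA.
pose beta := inf A.
have cb : c <= beta by apply: lb_le_inf; [exact: infA.1|].
have b0 : 0 < beta := lt_le_trans c0 cb.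
pose psi z := phi z - beta%:C * z.
have Repsi z : Re (psi z) = Re (phi z) - beta * Re z by rewrite ReD ReN ReZ.
have psi_ge0 z : 0 < Re z -> 0 <= Re (psi z).
  move=> z0; rewrite Repsi subr_ge0 -ler_pdivlMr //.
  by apply: inf_lbound; [exact: infA.2|exists z].
have dpsi z : 0 < Re z -> cderivable psi z.
  move=> z0; apply: cderivableD; first exact: dphi.
  by apply: cderivableN; apply: cderivableM; [exact: cderivable_cst|exact: cderivable_id].
have key (z : nat -> C) : nontangential z -> forall eta : R, 0 < eta ->
    \forall n \near \oo, modulus (psi (z n)) <= eta * Re (z n).
  move=> [zH zoo [K Kz]] eta eta0.
  have Kz' n : `|Im (z n)| <= Num.max 1 K * Re (z n).
    rewrite -ler_pdivrMr; last exact: zH.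
    by rewrite le_max Kz ?orbT //; exists n.
  pose K1 := Num.max 1 K; have K10 : 1 <= K1 by rewrite le_max lexx.
  pose M := (2 + K1) ^+ 2; have M0 : 0 < M by rewrite exprn_gt0 //; lra.
  (* [M * x ^+ 2] bounds [|z n + conj w|^2] once [x = Re (z n)] exceeds [|w|]. If [Q] exceeded
     [eta * x], the Pick inequality would give [Q <= 4 * e * M * x = eta * x / 2]. *)
  pose e := eta / (8 * M); have e0 : 0 < e by rewrite divr_gt0 // mulr_gt0.
  have [_ [w /= w0 <-] we] := inf_adherent e0 infA.
  have Rew : Re (psi w) < e * Re w by rewrite Repsi ltrBlDl -mulrDl -ltr_pdivrMr.
  pose B := modulus (psi w); have B0 : 0 <= B := modulus_ge0 _.
  near=> n.
  have x0 : 0 < Re (z n) by exact: zH.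
  have xw : modulus w <= Re (z n) by near: n; move/cvgryPge : zoo; apply.
  have xB : 2 * B / eta <= Re (z n) by near: n; move/cvgryPge : zoo; apply.
  have P := pick_selfmap dpsi psi_ge0 x0 w0.
  set Q := modulus (psi (z n)); set x := Re (z n) in x0 xw xB P *.
  rewrite leNgt; apply/negP => Qx.
  have {}xB : 2 * B <= eta * x by move: xB; rewrite ler_pdivrMr // (mulrC x).
  have zw : modulus (z n + w^*c) ^+ 2 <= M * x ^+ 2.
    rewrite /M -exprMn ler_pXn2r ?nnegrE ?modulus_ge0 //; last by rewrite mulr_ge0 ?(ltW x0) //; lra.
    apply: le_trans (modulusD _ _) _; rewrite modulus_conj.
    have := modulus_le (z n); rewrite (ger0_norm (ltW x0)) -/x; have := Kz' n; rewrite -/K1 -/x; lra.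
  have P2 : modulus (psi (z n) + (psi w)^*c) ^+ 2 * x * Re w <= Q * (e * Re w) * (M * x ^+ 2).
    have P1 : Re (psi (z n)) * Re (psi w) <= Q * (e * Re w).
      by apply: ler_pM; rewrite ?psi_ge0 ?(ltW Rew) ?Re_le.
    apply: le_trans P _; apply: ler_pM => //; last exact: sqr_ge0.
    by apply: mulr_ge0; apply: psi_ge0.
  have Q0 : 0 <= Q := modulus_ge0 _.
  have tri : Q - B <= modulus (psi (z n) + (psi w)^*c).
    have := modulusD (psi (z n) + (psi w)^*c) (- (psi w)^*c).
    by rewrite addrK modulusN modulus_conj -/B -/Q; lra.
  have T2 : (Q / 2) ^+ 2 <= modulus (psi (z n) + (psi w)^*c) ^+ 2.
    by rewrite ler_pXn2r ?nnegrE ?modulus_ge0 ?divr_ge0 //; lra.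
  have P3 : (Q / 2) ^+ 2 * x * Re w <= Q * (e * Re w) * (M * x ^+ 2).
    by apply: le_trans P2; rewrite !ler_wpM2r // ltW.
  have Qpos : 0 < Q by apply: le_lt_trans Qx; rewrite mulr_ge0 // ltW.
  have eM : e * M = eta / 8 by rewrite /e; field; rewrite lt0r_neq0.
  have : Q * (x * Re w * Q) <= x * Re w * Q * (eta * x / 2).
    have -> : x * Re w * Q * (eta * x / 2) = 4 * (Q * (e * Re w) * (M * x ^+ 2)).
      have -> : eta = 8 * (e * M) by rewrite eM; lra.
      by field.
    have -> : Q * (x * Re w * Q) = 4 * ((Q / 2) ^+ 2 * x * Re w) by field.
    by rewrite ler_pM2l.
  rewrite mulrC ler_pM2l ?mulr_gt0 //; have := mulr_gt0 eta0 x0; lra.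
exists beta^-1; first by rewrite invr_gt0.
split=> [z [zH zoo _]|z nt].
  apply/cvgryPge => a; near=> n.
  apply: le_trans (Re_le _); apply: le_trans (cphi _ _); last exact: zH.
  rewrite -ler_pdivrMl // mulrC; near: n; move/cvgryPge : zoo; apply.
have zH n : 0 < Re (z n) by case: nt => zH _ _; exact: zH.
have z_neq0 n : z n != 0 by apply: Re_gt0_neq0.
have cvgb : (phi (z n) / z n : C^o) @[n --> \oo] --> (beta%:C : C^o).
  apply/cvg_complexP => eta eta0; have := key z nt eta eta0; apply: filterS => n H.
  have -> : phi (z n) / z n - beta%:C = psi (z n) / z n.
    by rewrite /psi mulrBl mulfK.
  rewrite modulusM modulusV ler_pdivrMr ?modulus_gt0 //.
  by apply: le_trans H _; rewrite ler_pM2l // Re_le.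
have bn0 : beta%:C != 0 :> C by rewrite (inj_eq (@complexI R)) lt0r_neq0.
have -> : (fun n => z n / phi (z n)) = (fun n => (phi (z n) / z n)^-1).
  by apply/funext => n; rewrite invf_div.
rewrite fmorphV; exact: (@cvgV C).
Unshelve. all: by end_near. Qed.

End Julia.

(** * Bounded factors and Fubini's theorem on the plane *)

Section MulBounded.
Context d (T : measurableType d) (R : realType) (m : {measure set T -> \bar R}).

Lemma integrable_mul_bounded (D : set T) (f b : T -> R) (K : R) : measurable D ->
  m.-integrable D (EFin \o f) -> measurable_fun D b -> (forall x, D x -> `|b x| <= K) ->
  m.-integrable D (EFin \o (fun x => f x * b x)).
Proof.
move=> mD fi mb bK.
have mf : measurable_fun D f by apply/measurable_EFinP; exact: measurable_int fi.
apply: le_integrable (integrable_funZ K (f := fun x => `|f x|) _ mD) => //.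
- by apply/measurable_EFinP; exact: measurable_funM.
- move=> x Dx /=; rewrite lee_fin !normrM normr_id mulrC ler_wpM2r //.
  by apply: le_trans (bK x Dx) _; exact: ler_norm.
- exact: integrable_abse fi.
Qed.

Lemma integrable_measurable (D : set T) (f : T -> R) :
  m.-integrable D (EFin \o f) -> measurable_fun D f.
Proof. by move=> fi; apply/measurable_EFinP; exact: measurable_int fi. Qed.

Lemma ge0_integrable (D : set T) (f : T -> R) : measurable D ->
  measurable_fun D f -> (forall x, D x -> 0 <= f x) ->
  (\int[m]_(x in D) (f x)%:E < +oo)%E -> m.-integrable D (EFin \o f).
Proof.
move=> mD mf f0 foo; apply/integrableP; split; first exact/measurable_EFinP.
rewrite (eq_integral (fun x => (f x)%:E)) // => x; rewrite inE => Dx /=.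
by rewrite ger0_norm // f0.
Qed.

Lemma measurable_invr_gt0 (D : set T) (f : T -> R) : measurable D -> measurable_fun D f ->
  (forall x, D x -> 0 < f x) -> measurable_fun D (fun x => (f x)^-1).
Proof.
move=> mD mf f0; have H : measurable_fun D (fun x => expR (- ln (f x))).
  apply: (@measurableT_comp _ _ _ _ _ _ (@expR R)); first exact: measurable_expR.
  apply: measurableT_comp; first exact: oppr_measurable.
  by apply: (@measurableT_comp _ _ _ _ _ _ (@ln R)); first exact: measurable_ln.
apply: eq_measurable_fun H => x; rewrite inE => Dx.
by rewrite expRN lnK // posrE f0.
Qed.

Lemma EFin_Rintegral (D : set T) (f : T -> R) : measurable D -> m.-integrable D (EFin \o f) ->
  ((\int[m]_(x in D) f x)%:E = \int[m]_(x in D) (f x)%:E)%E.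
Proof. by move=> mD fi; rewrite /Rintegral fineK //; exact: integrable_fin_num. Qed.

End MulBounded.

Section LebesgueFubini.
Variable R : realType.
Local Notation mu := (@lebesgue_measure R).
Implicit Types (f g : R -> R).

Lemma lebesgue_tonelli (F : R * R -> \bar R) : measurable_fun setT F -> (forall p, 0 <= F p)%E ->
  (\int[mu]_x \int[mu]_y F (x, y) = \int[mu]_y \int[mu]_x F (x, y))%E.
Proof. move=> mF F0; exact: fubini_tonelli. Qed.

Lemma measurable_fstR f : measurable_fun setT f -> measurable_fun setT (fun p : R * R => f p.1).
Proof. by move=> mf; apply: measurableT_comp mf _; exact: measurable_fst. Qed.

Lemma measurable_sndR f : measurable_fun setT f -> measurable_fun setT (fun p : R * R => f p.2).
Proof. by move=> mf; apply: measurableT_comp mf _; exact: measurable_snd. Qed.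

Lemma measurable_subR f : measurable_fun setT f -> measurable_fun setT (fun p : R * R => f (p.1 - p.2)).
Proof.
move=> mf; apply: measurableT_comp mf _; apply: measurable_funB.
  exact: measurable_fst.
exact: measurable_snd.
Qed.

Lemma measurable_mulR f : measurable_fun setT f -> measurable_fun setT (fun p : R * R => f (p.1 * p.2)).
Proof.
move=> mf; apply: measurableT_comp mf _; apply: measurable_funM.
  exact: measurable_fst.
exact: measurable_snd.
Qed.

Lemma measurable_section1 (B : R * R -> R) x : measurable_fun setT B ->
  measurable_fun setT (fun y => B (x, y)).
Proof. exact: measurable_fun_pair2. Qed.

Lemma measurable_section2 (B : R * R -> R) y : measurable_fun setT B ->
  measurable_fun setT (fun x => B (x, y)).
Proof. exact: measurable_fun_pair1. Qed.

Lemma integrable_tensor f g :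
  mu.-integrable setT (EFin \o f) -> mu.-integrable setT (EFin \o g) ->
  (mu \x mu)%E.-integrable setT (EFin \o (fun p => f p.1 * g p.2)).
Proof.
move=> fi gi.
have mf := integrable_measurable fi; have mg := integrable_measurable gi.
apply/integrable12ltyP.
  by apply/measurable_EFinP; apply: measurable_funM; [exact: measurable_fstR|exact: measurable_sndR].
have gfin : (\int[mu]_y `|(g y)%:E|)%E \is a fin_num.
  exact: integrable_fin_num (integrable_abse gi).
pose c := fine (\int[mu]_y `|(g y)%:E|)%E.
have E : (\int[mu]_x \int[mu]_y `|(f x * g y)%:E| = \int[mu]_x (c%:E * `|(f x)%:E|))%E.
  congr (integral mu setT _); apply/funext => x; rewrite /c fineK // muleC.
  rewrite -[X in _ = (X * _)%E]/((`|f x|)%:E) -integralZl //; last exact: integrable_abse gi.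
  by congr (integral mu setT _); apply/funext => y; rewrite /= normrM EFinM.
have : (\int[mu]_x \int[mu]_y `|(f x * g y)%:E| < +oo)%E; last exact.
rewrite E integralZl //; last exact: integrable_abse fi.
apply: lte_mul_pinfty => //; last by have /integrableP[] := fi.
by rewrite lee_fin fine_ge0 // integral_ge0.
Qed.

Lemma Rfubini_bounded (f g : R -> R) (B : R * R -> R) (K : R) :
  mu.-integrable setT (EFin \o f) -> mu.-integrable setT (EFin \o g) ->
  measurable_fun setT B -> (forall p, `|B p| <= K) ->
  \int[mu]_x (f x * \int[mu]_y (g y * B (x, y))) =
  \int[mu]_y (g y * \int[mu]_x (f x * B (x, y))).
Proof.
move=> fi gi mB BK.
pose F (p : R * R) := f p.1 * g p.2 * B p.
have Fi : (mu \x mu)%E.-integrable setT (EFin \o F).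
  by apply: (integrable_mul_bounded (K := K)) => //; exact: integrable_tensor.
have sec1 x : mu.-integrable setT (EFin \o (fun y => g y * B (x, y))).
  by apply: (integrable_mul_bounded (K := K)) => //; exact: measurable_section1.
have sec2 y : mu.-integrable setT (EFin \o (fun x => f x * B (x, y))).
  by apply: (integrable_mul_bounded (K := K)) => //; exact: measurable_section2.
transitivity (fine (\int[mu]_x \int[mu]_y (F (x, y))%:E)%E).
  rewrite [LHS]/Rintegral; congr fine; apply: eq_integral => x _.
  rewrite EFinM EFin_Rintegral //.
  rewrite -integralZl //; last exact: sec1.
  congr (integral mu setT _); apply/funext => y.
  by rewrite -EFinM mulrA.
transitivity (fine (\int[mu]_y \int[mu]_x (F (x, y))%:E)%E).
  by congr fine; exact: Fubini Fi.
rewrite [RHS]/Rintegral; congr fine; apply: eq_integral => y _.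
rewrite EFinM EFin_Rintegral //.
rewrite -integralZl //; last exact: sec2.
congr (integral mu setT _); apply/funext => x.
by rewrite -EFinM /F mulrCA mulrA.
Qed.

(** Tonelli gives measurable sections for nonnegative integrands, so the positive and negative parts
    are treated separately. *)
Lemma measurable_Rintegral_section (g : R -> R) (B : R * R -> R) (K : R) :
  mu.-integrable setT (EFin \o g) -> measurable_fun setT B -> (forall p, `|B p| <= K) ->
  measurable_fun setT (fun x => \int[mu]_y (g y * B (x, y))).
Proof.
move=> gi mB BK; apply/measurable_EFinP.
have mF : measurable_fun setT (fun p : R * R => g p.2 * B p).
  by apply: measurable_funM mB; apply: measurable_sndR; exact: integrable_measurable gi.
have sec1 x : mu.-integrable setT (EFin \o (fun y => g y * B (x, y))).
  by apply: (integrable_mul_bounded (K := K)) => //; exact: measurable_section1.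
rewrite (_ : _ \o _ = (fun x => \int[mu]_y (g y * B (x, y))%:E)%E); last first.
  by apply/funext => x /=; rewrite EFin_Rintegral.
rewrite (_ : (fun x => _) = (fun x => \int[mu]_y ((fun p => (g p.2 * B p)%:E)^\+ (x, y)) -
   \int[mu]_y ((fun p => (g p.2 * B p)%:E)^\- (x, y)))%E); last first.
  by apply/funext => x; rewrite [LHS]integralE funepos.unlock funeneg.unlock.
have mF' : measurable_fun setT (fun p : R * R => (g p.2 * B p)%:E) by exact/measurable_EFinP.
apply: emeasurable_funB.
  exact: (@measurable_fun_fubini_tonelli_F _ _ _ _ _ mu _ (measurable_funepos mF')).
exact: (@measurable_fun_fubini_tonelli_F _ _ _ _ _ mu _ (measurable_funeneg mF')).
Qed.

End LebesgueFubini.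

(** * The two-sided exponential kernel as an approximate identity *)

Section LaplaceKernel.
Variable R : realType.
Local Notation mu := (@lebesgue_measure R).
Implicit Types (s t u : R).

(** For positive [s], the probability density whose Fourier transform is
    [y -> s * poisson_kernel s y]. It concentrates at 0 as [s] grows, while the transform increases
    to 1. *)
Definition laplace_kernel s u : R := s / 2 * expR (- (s * `|u|)).

Lemma laplace_kernel_ge0 s u : 0 < s -> 0 <= laplace_kernel s u.
Proof. by move=> s0; rewrite mulr_ge0 ?expR_ge0 // divr_ge0 // ltW. Qed.

Lemma laplace_kernelN s u : laplace_kernel s (- u) = laplace_kernel s u.
Proof. by rewrite /laplace_kernel normrN. Qed.

Lemma laplace_kernelC s u t : laplace_kernel s (u - t) = laplace_kernel s (t - u).
Proof. by rewrite -laplace_kernelN opprB. Qed.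

Lemma continuous_laplace_kernel s t : continuous (fun u => laplace_kernel s (u - t)).
Proof.
move=> u; apply: cvgM; first exact: cvg_cst.
apply: (@cvg_comp _ _ _ (fun u => - (s * `|u - t|)) (@expR R)); last exact: continuous_expR.
apply: cvgN; apply: cvgM; first exact: cvg_cst.
by apply: cvg_norm; apply: cvgB; [exact: cvg_id|exact: cvg_cst].
Qed.

Lemma measurable_laplace_kernel s : measurable_fun setT (laplace_kernel s).
Proof.
apply: continuous_measurable_fun.
have -> : laplace_kernel s = (fun u => laplace_kernel s (u - 0)).
  by apply/funext => u; rewrite subr0.
exact: continuous_laplace_kernel.
Qed.

Lemma measurable_laplace_kernel_sub s :
  measurable_fun setT (fun p : R * R => laplace_kernel s (p.1 - p.2)).
Proof. by apply: measurable_subR; exact: measurable_laplace_kernel. Qed.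

Let half s t : 0 < s -> (\int[mu]_(u in `[t, +oo[) (laplace_kernel s (u - t))%:E = (2^-1)%:E)%E.
Proof.
move=> s0; pose F u := - 2^-1 * expR (- (s * (u - t))).
have dF (u : R) : is_derive u 1 F (s / 2 * expR (- (s * (u - t)))).
  have d1 : is_derive u 1 (fun u : R => - (s * (u - t))) (- s).
    by apply: is_derive_eq; rewrite /GRing.scale /=; ring.
  have d2 := @is_derive1_comp R (@expR R) (fun u => - (s * (u - t))) u _ _ (is_derive_expR _) d1.
  have -> : s / 2 * expR (- (s * (u - t))) = - 2^-1 *: (expR (- (s * (u - t))) * - s) + expR (- (s * (u - t))) *: 0.
    by rewrite scaler0 addr0 /GRing.scale /=; lra.
  exact: (@is_deriveM _ _ (fun=> - 2^-1) (expR \o (fun u => - (s * (u - t))))).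
rewrite (@ge0_continuous_FTC2y R _ F t 0).
- by rewrite sub0e /F subrr mulr0 oppr0 expR0 mulr1 -EFinN opprK.
- by move=> x _; exact: laplace_kernel_ge0.
- by apply: continuous_subspaceT; exact: continuous_laplace_kernel.
- rewrite -[X in _ --> X](mulr0 (- 2^-1)); apply: cvgM; first exact: cvg_cst.
  apply: (@cvg_comp _ _ _ (fun u => s * (u - t)) (fun x => expR (- x)) _ +oo); last exact: cvgr_expR.
  apply/cvgryPge => A; near=> u.
  rewrite -ler_pdivrMl // lerBrDr.
  by near: u; exact: nbhs_pinfty_ge (num_real _).
- by move=> x _; have [] := dF x.
- apply: cvg_at_right_filter; apply/differentiable_continuous/derivable1_diffP.
  by have [] := dF t.
- move=> x; rewrite in_itv /= andbT => tx; rewrite derive1E.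
  have [_ ->] := dF x.
  by rewrite /laplace_kernel ger0_norm // subr_ge0 ltW.
Unshelve. all: by end_near. Qed.

Lemma integral_laplace_kernel s t : 0 < s -> (\int[mu]_u (laplace_kernel s (u - t))%:E = 1)%E.
Proof.
move=> s0.
have mk D : measurable_fun D (fun u => (laplace_kernel s (u - t))%:E).
  apply/measurable_EFinP; apply: measurable_funTS.
  by apply: continuous_measurable_fun; exact: continuous_laplace_kernel.
have -> : setT = `]-oo, - (- t)] `|` `](- (- t)), +oo[ :> set R.
  by rewrite -set_itvNyy; apply: itv_bndbnd_setU; rewrite bnd_simp.
rewrite ge0_integral_setU //; last 2 first.
- by move=> x _; rewrite lee_fin laplace_kernel_ge0.
- apply/disj_setPS => x [] /=; rewrite !in_itv /= andbT => h1 h2.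
  by have := le_lt_trans h1 h2; rewrite ltxx.
rewrite ge0_integration_by_substitutionNy; last 2 first.
- by apply: continuous_subspaceT; exact: continuous_laplace_kernel.
- by move=> x _; exact: laplace_kernel_ge0.
rewrite integral_itv_obnd_cbnd // opprK half //.
have -> : (\int[mu]_(x in `[(- t)%R, +oo[) (((fun u => laplace_kernel s (u - t)) \o -%R) x)%:E = (2^-1)%:E)%E.
  rewrite -(half (- t) s0); apply: eq_integral => u _ /=.
  by congr (_%:E); rewrite -laplace_kernelN; congr laplace_kernel; ring.
  by rewrite -EFinD; congr EFin; lra.
exact: mk.
Qed.

Lemma integral_laplace_kernel_sub s t : 0 < s -> (\int[mu]_u (laplace_kernel s (t - u))%:E = 1)%E.
Proof.
move=> s0; rewrite -(integral_laplace_kernel t s0); apply: eq_integral => u _.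
by rewrite laplace_kernelC.
Qed.

(** Half of the exponent pays for [expR (- (s * d / 2))]; the other half is again a kernel, of
    parameter [s / 2] and mass 1. *)
Lemma laplace_kernel_tail s d u : 0 < s -> d <= `|u| ->
  laplace_kernel s u <= 2 * expR (- (s * d / 2)) * laplace_kernel (s / 2) u.
Proof.
move=> s0 du; rewrite /laplace_kernel.
have -> : expR (- (s * `|u|)) = expR (- (s * `|u| / 2)) * expR (- (s / 2 * `|u|)).
  by rewrite -expRD; congr expR; lra.
have -> : 2 * expR (- (s * d / 2)) * (s / 2 / 2 * expR (- (s / 2 * `|u|))) =
   s / 2 * (expR (- (s * d / 2)) * expR (- (s / 2 * `|u|))) by field.
rewrite ler_pM2l ?divr_gt0 // ler_pM2r ?expR_gt0 // ler_expR lerN2 ler_pM2r //.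
by rewrite ler_pM2l.
Qed.

Let pmeas (v : R -> R) s : measurable_fun setT v ->
  measurable_fun setT (fun p : R * R => (v p.1 * laplace_kernel s (p.1 - p.2))%:E).
Proof.
move=> mv; apply/measurable_EFinP; apply: measurable_funM; first exact: measurable_fstR.
exact: measurable_laplace_kernel_sub.
Qed.

Let pmeas2 (v : R -> R) s : measurable_fun setT v ->
  measurable_fun setT (fun p : R * R => (v p.2 * laplace_kernel s (p.1 - p.2))%:E).
Proof.
move=> mv; apply/measurable_EFinP; apply: measurable_funM; first exact: measurable_sndR.
exact: measurable_laplace_kernel_sub.
Qed.

Lemma integral_laplace_kernel_fst (v : R -> R) s : 0 < s -> measurable_fun setT v ->
  (forall t, 0 <= v t) ->
  (\int[mu \x mu]_p (v p.1 * laplace_kernel s (p.1 - p.2))%:E = \int[mu]_t (v t)%:E)%E.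
Proof.
move=> s0 mv v0; rewrite fubini_tonelli1; last 2 first.
- exact: pmeas.
- by move=> p; rewrite lee_fin mulr_ge0 // laplace_kernel_ge0.
congr (integral mu setT _); apply/funext => t; rewrite /fubini_F /=.
under eq_integral do rewrite EFinM.
rewrite ge0_integralZl //.
- by rewrite integral_laplace_kernel_sub // mule1.
- apply/measurable_EFinP.
  apply: (measurable_section1 (B := fun p => laplace_kernel s (p.1 - p.2)) t).
  exact: measurable_laplace_kernel_sub.
- by move=> u _; rewrite lee_fin laplace_kernel_ge0.
- by rewrite lee_fin.
Qed.

Lemma integral_laplace_kernel_snd (v : R -> R) s : 0 < s -> measurable_fun setT v ->
  (forall t, 0 <= v t) ->
  (\int[mu \x mu]_p (v p.2 * laplace_kernel s (p.1 - p.2))%:E = \int[mu]_t (v t)%:E)%E.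
Proof.
move=> s0 mv v0; rewrite fubini_tonelli2; last 2 first.
- exact: pmeas2.
- by move=> p; rewrite lee_fin mulr_ge0 // laplace_kernel_ge0.
congr (integral mu setT _); apply/funext => t; rewrite /fubini_G /=.
under eq_integral do rewrite EFinM.
rewrite ge0_integralZl //.
- by rewrite integral_laplace_kernel // mule1.
- apply/measurable_EFinP; apply: continuous_measurable_fun.
  exact: continuous_laplace_kernel.
- by move=> u _; rewrite lee_fin laplace_kernel_ge0.
- by rewrite lee_fin.
Qed.

(** The L1 distance from [q] to its translates, averaged over the translation with weight
    [laplace_kernel s]. *)
Definition laplace_gap s (q : R -> R) : \bar R :=
  (\int[mu \x mu]_p (`|q p.1 - q p.2| * laplace_kernel s (p.1 - p.2))%:E)%E.

Let gap_meas s (q : R -> R) : measurable_fun setT q ->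
  measurable_fun setT (fun p : R * R => (`|q p.1 - q p.2| * laplace_kernel s (p.1 - p.2))%:E).
Proof.
move=> mq; apply/measurable_EFinP; apply: measurable_funM; last first.
  exact: measurable_laplace_kernel_sub.
by apply: measurableT_comp => //; apply: measurable_funB; [exact: measurable_fstR|exact: measurable_sndR].
Qed.

(** The kernel has mass 1 in each variable, so replacing [q] by [r] costs their L1 distance once per
    variable. *)
Lemma laplace_gap_triangle s (q r : R -> R) : 0 < s -> measurable_fun setT q ->
  measurable_fun setT r ->
  (laplace_gap s q <= laplace_gap s r + 2%:E * \int[mu]_t (`|q t - r t|)%:E)%E.
Proof.
move=> s0 mq mr.
have mqr : measurable_fun setT (fun t => `|q t - r t|).
  by apply: measurableT_comp => //; exact: measurable_funB.
rewrite mule_natl mule2n -{1}(integral_laplace_kernel_fst s0 mqr) // -(integral_laplace_kernel_snd s0 mqr) //.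
have k0 (p : R * R) := laplace_kernel_ge0 (p.1 - p.2) s0.
rewrite -ge0_integralD //; last 4 first.
- by move=> p _; rewrite lee_fin mulr_ge0.
- exact: (pmeas s mqr).
- by move=> p _; rewrite lee_fin mulr_ge0.
- exact: (pmeas2 s mqr).
rewrite -ge0_integralD //; last 4 first.
- by move=> p _; rewrite lee_fin mulr_ge0.
- exact: gap_meas.
- by move=> p _; rewrite -EFinD lee_fin addr_ge0 // mulr_ge0.
- by apply: emeasurable_funD; [exact: (pmeas s mqr)|exact: (pmeas2 s mqr)].
apply: ge0_le_integral => //.
- by move=> p _; rewrite lee_fin mulr_ge0.
- exact: gap_meas.
- apply: emeasurable_funD; first exact: gap_meas.
  by apply: emeasurable_funD; [exact: (pmeas s mqr)|exact: (pmeas2 s mqr)].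
- move=> p _; rewrite -!EFinD lee_fin -!mulrDl ler_wpM2r //.
  have -> : q p.1 - q p.2 = (r p.1 - r p.2) + ((q p.1 - r p.1) - (q p.2 - r p.2)) by ring.
  by apply: le_trans (ler_normD _ _) _; rewrite lerD2l; exact: ler_normB.
Qed.

(** The integrand vanishes unless one of the variables lies in [D], and it is symmetric, whence the
    factor 2. *)
Lemma laplace_gap_supported s (r : R -> R) (D : set R) : 0 < s -> measurable_fun setT r ->
  measurable D -> (forall t, ~ D t -> r t = 0) ->
  (laplace_gap s r <= 2%:E * \int[mu]_(t in D) \int[mu]_u (`|r t - r u| * laplace_kernel s (t - u))%:E)%E.
Proof.
move=> s0 mr mD rD.
have k0 (p : R * R) := laplace_kernel_ge0 (p.1 - p.2) s0.
pose F (p : R * R) : \bar R := (`|r p.1 - r p.2| * laplace_kernel s (p.1 - p.2))%:E.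
have mF : measurable_fun setT F := gap_meas s mr.
have F0 p : (0 <= F p)%E by rewrite lee_fin mulr_ge0.
have mi : measurable_fun setT (\1_D : R -> R) by exact: measurable_indic.
pose F1 (p : R * R) := ((\1_D p.1)%:E * F p)%E.
pose F2 (p : R * R) := ((\1_D p.2)%:E * F p)%E.
have i0 t : 0 <= \1_D t :> R by [].
have F10 p : (0 <= F1 p)%E by rewrite mule_ge0 // lee_fin.
have F20 p : (0 <= F2 p)%E by rewrite mule_ge0 // lee_fin.
have mF1 : measurable_fun setT F1.
  by apply: emeasurable_funM mF; apply/measurable_EFinP; exact: measurable_fstR.
have mF2 : measurable_fun setT F2.
  by apply: emeasurable_funM mF; apply/measurable_EFinP; exact: measurable_sndR.
have E1 : (\int[mu \x mu]_p F1 p = \int[mu]_(t in D) \int[mu]_u F (t, u))%E.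
  etransitivity; first by apply: fubini_tonelli1; [exact: mF1|exact: F10].
  rewrite [RHS]integral_mkcond.
  congr (integral mu setT _); apply/funext => t; rewrite /fubini_F /F1 /= patchE indicE.
  case: (boolP (t \in D)) => tD; last by rewrite integral0_eq // => u _; rewrite mul0e.
  by apply: eq_integral => u _; rewrite mul1e.
have E2 : (\int[mu \x mu]_p F2 p = \int[mu]_(t in D) \int[mu]_u F (t, u))%E.
  etransitivity; first by apply: fubini_tonelli2; [exact: mF2|exact: F20].
  rewrite [RHS]integral_mkcond.
  congr (integral mu setT _); apply/funext => t; rewrite /fubini_G /F2 /= patchE indicE.
  case: (boolP (t \in D)) => tD; last by rewrite integral0_eq // => u _; rewrite mul0e.
  apply: eq_integral => u _; rewrite mul1e /F /=.
  by rewrite distrC laplace_kernelC.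
rewrite mule_natl mule2n -{1}E1 -E2 -ge0_integralD //.
apply: ge0_le_integral => //.
- by move=> p _; exact: F0.
- exact: emeasurable_funD mF1 mF2.
- move=> p _; rewrite /F1 /F2 !indicE.
  case: (boolP (p.1 \in D)) => p1; case: (boolP (p.2 \in D)) => p2; rewrite ?mul1e ?mul0e ?adde0 ?add0e //.
    by rewrite -[X in (X <= _)%E]adde0 leeD2l.
  move: p1 p2; rewrite !notin_setE => /rD p1 /rD p2.
  by rewrite -/(F p) /F p1 p2 subrr normr0 mul0r.
Qed.

(** Within distance [d] of [t] the oscillation is at most [e]; beyond, it is at most [2 * M] against
    a kernel tail of mass at most [2 * expR (- (s * d / 2))]. *)
Lemma laplace_oscillation_le (r : R -> R) (M e d t s : R) : 0 < s -> measurable_fun setT r ->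
  (forall u, `|r u| <= M) -> 0 <= e -> (forall u, `|t - u| < d -> `|r t - r u| <= e) ->
  (\int[mu]_u (`|r t - r u| * laplace_kernel s (t - u))%:E <= (e + 4 * M * expR (- (s * d / 2)))%:E)%E.
Proof.
move=> s0 mr rM e0 re.
have M0 : 0 <= M := le_trans (normr_ge0 _) (rM 0).
have s20 : 0 < s / 2 by rewrite divr_gt0.
have mk s' : measurable_fun setT (fun u => laplace_kernel s' (t - u)).
  apply: (measurable_section1 (B := fun p => laplace_kernel s' (p.1 - p.2)) t).
  exact: measurable_laplace_kernel_sub.
pose c := 2 * M * (2 * expR (- (s * d / 2))).
have c0 : 0 <= c by rewrite !mulr_ge0 // expR_ge0.
have -> : 4 * M * expR (- (s * d / 2)) = c by rewrite /c; ring.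
have -> : ((e + c)%:E = \int[mu]_u (e * laplace_kernel s (t - u) + c * laplace_kernel (s / 2) (t - u))%:E)%E.
  under eq_integral do rewrite EFinD (EFinM e) (EFinM c).
  have me s' k : measurable_fun setT (fun u => (k%:E * (laplace_kernel s' (t - u))%:E)%E).
    by apply: emeasurable_funM; [exact: measurable_cst|apply/measurable_EFinP; exact: mk].
  have pe s' (u : R) : 0 < s' -> (0 <= (laplace_kernel s' (t - u))%:E)%E.
    by move=> s'0; rewrite lee_fin laplace_kernel_ge0.
  have mEk s' : measurable_fun setT (fun u => (laplace_kernel s' (t - u))%:E).
    by apply/measurable_EFinP; exact: mk.
  rewrite ge0_integralD //; do ?[exact: me | by move=> u _; apply: mule_ge0 => //; exact: pe].
  rewrite !ge0_integralZl //; do ?[exact: mEk | by move=> u _; exact: pe | by rewrite lee_fin].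
  by rewrite !integral_laplace_kernel_sub // !mule1.
apply: ge0_le_integral => //.
- by move=> u _; rewrite lee_fin mulr_ge0 // laplace_kernel_ge0.
- apply/measurable_EFinP; apply: measurable_funM; last exact: mk.
  by apply: measurableT_comp => //; apply: measurable_funB.
- by apply/measurable_EFinP; apply: measurable_funD; apply: measurable_funM => //; exact: mk.
- move=> u _; rewrite lee_fin.
  have k1 := laplace_kernel_ge0 (t - u) s0; have k2 := laplace_kernel_ge0 (t - u) s20.
  have [tu|tu] := ltP `|t - u| d.
    apply: (@le_trans _ _ (e * laplace_kernel s (t - u))); last by rewrite lerDl mulr_ge0.
    by rewrite ler_wpM2r // re.
  apply: (@le_trans _ _ (c * laplace_kernel (s / 2) (t - u))); last by rewrite lerDr mulr_ge0.
  rewrite /c -(mulrA (2 * M)); apply: ler_pM => //.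
    by apply: le_trans (ler_normB _ _) _; have := rM t; have := rM u; lra.
  exact: laplace_kernel_tail.
Qed.

End LaplaceKernel.

(** * The averaged L1 gap of an integrable function tends to 0 *)

Section LaplaceGap.
Variable R : realType.
Local Notation mu := (@lebesgue_measure R).

Lemma ereal_cvg0 (u : nat -> \bar R) : (forall n, 0 <= u n)%E ->
  (forall e : R, 0 < e -> \forall n \near \oo, (u n <= e%:E)%E) -> u n @[n --> \oo] --> 0%E.
Proof.
move=> u0 H.
have fin (e : R) n : (u n <= e%:E)%E -> u n \is a fin_num.
  by move=> ue; rewrite ge0_fin_numE // (le_lt_trans ue) // ltry.
apply: cvg_EFin; first by apply: filterS (H 1 ltr01) => n; exact: fin.
apply/cvgrPdist_le => e e0; apply: filterS (H e e0) => n ue /=.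
rewrite sub0r normrN ger0_norm ?fine_ge0 // -lee_fin fineK //; exact: fin ue.
Qed.

Lemma cvg_expR_natN (a : R) : 0 < a -> expR (- (n.+1%:R * a)) @[n --> \oo] --> 0.
Proof.
move=> a0; under eq_cvg do rewrite -mulrN expRM_natl.
have z1 : `|expR (- a)| < 1 by rewrite ger0_norm ?expR_ge0 // expR_lt1 oppr_lt0.
by have := cvg_expr z1; rewrite -cvg_shiftS.
Qed.

Lemma cvg_near_nat_itv (t : R) : \forall n \near \oo, - n%:R < t < n%:R.
Proof.
near=> n; rewrite -ltr_norml.
by near: n; exact: nbhs_infty_gtr.
Unshelve. all: by end_near. Qed.

Lemma L1_truncation_cvg0 (q : R -> R) : mu.-integrable setT (EFin \o q) ->
  \int[mu]_t `|q t - q t * \1_(`]- n%:R, n%:R[) t| @[n --> \oo] --> 0.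
Proof.
move=> qi; have mq := integrable_measurable qi.
have <- : \int[mu]_t (cst 0 t) = 0 :> R by rewrite Rintegral_cst // mul0r.
apply: (@dominated_cvg_Rintegral _ _ _ mu setT _ _ (fun t => `|q t|)) => //.
- move=> n; apply: measurableT_comp => //; apply: measurable_funB => //.
  by apply: measurable_funM => //; exact: measurable_indic.
- move=> t _; apply: cvg_near_cst; apply: filterS (cvg_near_nat_itv t) => n tn.
  by rewrite indicE mem_set /= ?in_itv //= mulr1 subrr normr0.
- exact: integrable_abse qi.
- move=> n t _; rewrite normr_id indicE; case: (_ \in _); rewrite ?mulr1 ?mulr0 ?subrr ?subr0 //.
  by rewrite normr0.
Qed.

(** The approximant is cut off by an indicator because [q - g] is controlled only on the bounded
    interval. Truncation and approximation each cost [e / 2]. *)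
Lemma L1_continuous_approx (q : R -> R) (e : R) : mu.-integrable setT (EFin \o q) -> 0 < e ->
  exists N : nat, exists2 g : R -> R, continuous g &
    (\int[mu]_t (`|q t - g t * \1_(`]- N%:R, N%:R[) t|)%:E <= e%:E)%E.
Proof.
move=> qi e0; have mq := integrable_measurable qi.
have e20 : 0 < e / 2 by rewrite divr_gt0.
have /cvgrPdist_lt /(_ _ e20) [N _ /(_ N (leqnn N))] := L1_truncation_cvg0 qi.
rewrite /= sub0r normrN ger0_norm; last exact: Rintegral_ge0.
set I : set R := `]- N%:R, N%:R[ => qN.
have mI : measurable I by exact: measurable_itv.
have muI : (mu I < +oo)%E.
  by rewrite /I lebesgue_measure_itv /=; case: ifP => _; rewrite ?ltry // -EFinB ltry.
have qI : mu.-integrable I (EFin \o q) by apply: integrableS qi.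
have [g [gc gi /fine_cvgP[gfin gcvg]]] := approximation_continuous_integrable mI muI qI.
move/cvgrPdist_lt : gcvg => /(_ _ e20) gcvg.
have [k [kfin kle]] : exists k, (\int[mu]_(z in I) `|(q z - g k z)%:E|)%E \is a fin_num /\
   `|0 - fine (\int[mu]_(z in I) `|(q z - g k z)%:E|)%E| < e / 2.
  by have [k _ /(_ k (leqnn k))[]] := filterI gfin gcvg; exists k.
exists N, (g k) => //.
have mi : measurable_fun setT (\1_I : R -> R) by exact: measurable_indic.
have mg : measurable_fun setT (g k) := continuous_measurable_fun (gc k).
have mqI : measurable_fun setT (fun t => `|q t - q t * \1_I t|).
  by apply: measurableT_comp => //; apply: measurable_funB => //; exact: measurable_funM.
have mqg : measurable_fun setT (fun t => \1_I t * `|q t - g k t|).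
  apply: measurable_funM => //; apply: measurableT_comp => //; exact: measurable_funB.
apply: (@le_trans _ _ (\int[mu]_t ((`|q t - q t * \1_I t|)%:E + (\1_I t * `|q t - g k t|)%:E))%E).
  apply: ge0_le_integral => //.
  - apply/measurable_EFinP; apply: measurableT_comp => //; apply: measurable_funB => //.
    exact: measurable_funM.
  - by apply: emeasurable_funD; exact/measurable_EFinP.
  - move=> t _; rewrite -EFinD lee_fin indicE; case: (t \in I); rewrite ?mulr1 ?mulr0 ?mul1r ?mul0r ?subrr ?subr0 ?addr0 ?normr0 ?add0r //.
rewrite ge0_integralD //; do ?[by move=> t _; rewrite lee_fin ?mulr_ge0|exact/measurable_EFinP].
have -> : (e%:E = (e / 2)%:E + (e / 2)%:E)%E by rewrite -EFinD; congr EFin; lra.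
apply: leeD.
  rewrite -EFin_Rintegral ?lee_fin ?ltW //.
  have qqI : mu.-integrable setT (EFin \o (fun t => q t - q t * \1_I t)).
    apply: (integrable_funB qi _ measurableT).
    apply: (integrable_mul_bounded (K := 1)) => // t _; rewrite indicE.
    by case: (_ \in _); rewrite ?normr1 ?normr0.
  exact: integrable_abse qqI.
have -> : (\int[mu]_t (\1_I t * `|q t - g k t|)%:E = \int[mu]_(z in I) `|(q z - g k z)%:E|)%E.
  rewrite [RHS]integral_mkcond; apply: eq_integral => t _; rewrite patchE indicE.
  by case: (t \in I); rewrite ?mul1r ?mul0r.
rewrite -(fineK kfin) lee_fin; move: kle; rewrite sub0r normrN ger0_norm ?fine_ge0 ?integral_ge0 //.
exact: ltW.
Qed.

Lemma laplace_gap_ge0 (s : R) (q : R -> R) : 0 < s -> (0 <= laplace_gap s q)%E.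
Proof.
by move=> s0; apply: integral_ge0 => p _; rewrite lee_fin mulr_ge0 // laplace_kernel_ge0.
Qed.

(** The interval is open, so [r] is continuous at each of its points and the jumps at the ends are
    not met. Domination by [2 * M] on a set of finite measure then gives the limit of the outer
    integral. *)
Lemma laplace_gap_compact_cvg0 (g : R -> R) (N : nat) : continuous g ->
  laplace_gap n.+1%:R (fun t => g t * \1_(`]- N%:R, N%:R[) t) @[n --> \oo] --> 0%E.
Proof.
move=> gc; set I : set R := `]- N%:R, N%:R[; set r := fun t => g t * \1_I t.
have mI : measurable I by exact: measurable_itv.
have muI : (mu I < +oo)%E.
  by rewrite /I lebesgue_measure_itv /=; case: ifP => _; rewrite ?ltry // -EFinB ltry.
have mr : measurable_fun setT r.
  by apply: measurable_funM; [exact: continuous_measurable_fun|exact: measurable_indic].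
have n0 n : 0 < n.+1%:R :> R by rewrite ltr0n.
have [M rM] : exists M, forall t, `|r t| <= M.
  have /compact_bounded [M0 [_ HM]] : compact (g @` `[- N%:R, N%:R]).
    apply: continuous_compact; first exact: continuous_subspaceT.
    exact: segment_compact.
  exists (`|M0| + 1) => t; rewrite /r indicE; case: (boolP (t \in I)) => tI.
    rewrite mulr1; apply: HM; first by rewrite (le_lt_trans (ler_norm _)) // ltrDl.
    exists t => //; move: tI; rewrite inE /I /= !in_itv /= => /andP[/ltW -> /ltW ->] //.
  by rewrite mulr0 normr0 addr_ge0.
have M0 : 0 <= M := le_trans (normr_ge0 _) (rM 0).
pose psi n t := (\int[mu]_u (`|r t - r u| * laplace_kernel n.+1%:R (t - u))%:E)%E.
have psi0 n t : (0 <= psi n t)%E.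
  by apply: integral_ge0 => u _; rewrite lee_fin mulr_ge0 // laplace_kernel_ge0.
have psi_cvg t : I t -> psi n t @[n --> \oo] --> 0%E.
  move=> tI; apply: ereal_cvg0 => // e e0.
  have e20 : 0 < e / 2 by rewrite divr_gt0.
  have [d d0 dP] : exists2 d, 0 < d & forall u, `|t - u| < d -> `|r t - r u| <= e / 2.
    have [d1 /= d10 d1P] : nbhs t I by apply: open_nbhs_nbhs; split => //; exact: interval_open.
    have [d2 /= d20 d2P] := (cvgrPdist_lt _ _).1 (gc t) _ e20.
    exists (Num.min d1 d2); first by rewrite lt_min d10.
    move=> u; rewrite lt_min => /andP[u1 u2].
    by rewrite /r !indicE !mem_set ?mulr1 //; [exact/ltW/d2P|exact: d1P].
  have c0 : 0 < 4 * M + 1 by lra.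
  have d20 : 0 < d / 2 by rewrite divr_gt0.
  have e40 : 0 < e / 2 / (4 * M + 1) by rewrite divr_gt0.
  have /cvgrPdist_lt /(_ _ e40) := cvg_expR_natN d20.
  apply: filterS => n; rewrite sub0r normrN ger0_norm ?expR_ge0 // ltr_pdivlMr // => nd.
  apply: le_trans (laplace_oscillation_le (n0 n) mr rM (ltW e20) dP) _.
  rewrite lee_fin -mulrA.
  have := expR_ge0 (- (n.+1%:R * (d / 2))); move: nd; rewrite mulrA.
  by set E := expR _; nra.
have psi_le n t : (psi n t <= (2 * M)%:E)%E.
  have H u : `|t - u| < 1 -> `|r t - r u| <= 2 * M.
    by move=> _; apply: le_trans (ler_normB _ _) _; have := rM t; have := rM u; lra.
  apply: (@le_trans _ _ (\int[mu]_u ((2 * M)%:E * (laplace_kernel n.+1%:R (t - u))%:E))%E).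
    have mk : measurable_fun setT (fun u : R => laplace_kernel n.+1%:R (t - u)).
      apply: (measurable_section1 (B := fun p => laplace_kernel n.+1%:R (p.1 - p.2)) t).
      exact: measurable_laplace_kernel_sub.
    apply: ge0_le_integral => //.
    - by move=> u _; rewrite lee_fin mulr_ge0 // laplace_kernel_ge0.
    - apply/measurable_EFinP; apply: measurable_funM; last exact: mk.
      by apply: measurableT_comp => //; apply: measurable_funB.
    - by apply: emeasurable_funM; [exact: measurable_cst|apply/measurable_EFinP; exact: mk].
    - move=> u _; rewrite -EFinM lee_fin ler_wpM2r ?laplace_kernel_ge0 //.
      by apply: le_trans (ler_normB _ _) _; have := rM t; have := rM u; lra.
  rewrite integralZl //; first by rewrite integral_laplace_kernel_sub // mule1.
  apply: ge0_integrable => //.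
  - apply: (measurable_section1 (B := fun p => laplace_kernel n.+1%:R (p.1 - p.2)) t).
    exact: measurable_laplace_kernel_sub.
  - by move=> u _; exact: laplace_kernel_ge0.
  - by rewrite integral_laplace_kernel_sub // ltry.
have mpsi n : measurable_fun I (psi n).
  apply: measurable_funTS.
  have mF : measurable_fun setT (fun p : R * R => (`|r p.1 - r p.2| * laplace_kernel n.+1%:R (p.1 - p.2))%:E).
    apply/measurable_EFinP; apply: measurable_funM; last exact: measurable_laplace_kernel_sub.
    by apply: measurableT_comp => //; apply: measurable_funB; [exact: measurable_fstR|exact: measurable_sndR].
  apply: (@measurable_fun_fubini_tonelli_F _ _ _ _ _ mu _ mF).
  by move=> p; rewrite lee_fin mulr_ge0 // laplace_kernel_ge0.
have int_cvg : (\int[mu]_(t in I) psi n t)%E @[n --> \oo] --> 0%E.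
  have -> : 0%E = (\int[mu]_(t in I) (cst 0%E t))%E :> \bar R by rewrite integral0.
  apply: (@dominated_cvg _ _ _ mu I mI psi (cst 0%E) (cst (2 * M)%:E)) => //.
  - apply/integrableP; split; first exact: measurable_cst.
    by rewrite integral_cst //= ger0_norm ?mulr_ge0 // -ge0_fin_numE ?mule_ge0 ?lee_fin ?mulr_ge0 // fin_numM // ge0_fin_numE.
  - by move=> n t _; rewrite gee0_abs.
have int2 : (2%:E * \int[mu]_(t in I) psi n t)%E @[n --> \oo] --> 0%E.
  by rewrite -[X in _ --> X](mule0 2%:E); apply: cvgeZl.
apply: (squeeze_cvge _ (cvg_cst 0%E) int2).
apply: nearW => n; rewrite laplace_gap_ge0 //=.
apply: laplace_gap_supported => // t tI.
by rewrite /r indicE memNset // mulr0.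
Qed.

Lemma laplace_gap_cvg0 (q : R -> R) : mu.-integrable setT (EFin \o q) ->
  laplace_gap n.+1%:R q @[n --> \oo] --> 0%E.
Proof.
move=> qi; apply: ereal_cvg0 => [n|e e0]; first by apply: laplace_gap_ge0.
have e40 : 0 < e / 4 by rewrite divr_gt0.
have [N [g gc gq]] := L1_continuous_approx qi e40.
have /fine_cvgP[rfin rcvg] := laplace_gap_compact_cvg0 N gc.
have e20 : 0 < e / 2 by rewrite divr_gt0.
move/cvgrPdist_lt : rcvg => /(_ _ e20) rcvg.
apply: filterS2 rfin rcvg => n nfin; rewrite sub0r normrN => nlt.
have n0 : 0 < n.+1%:R :> R by rewrite ltr0n.
have mr : measurable_fun setT (fun t => g t * \1_(`]- N%:R, N%:R[) t).
  by apply: measurable_funM; [exact: continuous_measurable_fun|exact: measurable_indic].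
apply: le_trans (laplace_gap_triangle n0 (integrable_measurable qi) mr) _.
have -> : (e%:E = (e / 2)%:E + 2%:E * (e / 4)%:E)%E by rewrite -EFinM -EFinD; congr EFin; lra.
apply: leeD; last by rewrite lee_pmul2l.
by rewrite -(fineK nfin) lee_fin; exact: le_trans (ler_norm _) (ltW nlt).
Qed.

End LaplaceGap.

(** * Plancherel's theorem for real functions, by Abel means *)

Section PlancherelReal.
Variable R : realType.
Local Notation C := R[i].
Local Notation mu := (@lebesgue_measure R).

(** The Poisson formula on the imaginary axis for [z -> exp (- |x| z)], evaluated at [s]; the sign
    of the exponent keeps this function bounded on [Re z > -1]. *)
Lemma integral_cos_poisson_kernel (s x : R) : 0 < s ->
  \int[mu]_u (poisson_kernel s u * cos (u * x)) = pi * expR (- (s * `|x|)).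
Proof.
move=> s0; pose h (z : C) := cexp ((- `|x|)%:C * z).
have dh w : -1 < Re w -> cderivable h w.
  move=> _; apply: (@cderivable_comp R (fun w => (- `|x|)%:C * w) (@cexp R)); last exact: cderivable_cexp.
  by apply: cderivableM; [exact: cderivable_cst|exact: cderivable_id].
have hK w : -1 < Re w -> modulus (h w) <= expR `|x|.
  move=> w1; rewrite modulus_cexp ReZ ler_expR.
  by have := normr_ge0 x; nra.
have N0 : (-1 : R) < 0 by rewrite oppr_lt0.
have := @poisson_line R h (-1) (expR `|x|) 0 (s%:C) dh hK N0 s0.
rewrite /h Re_cexp ReZ ImZ /= mulr0 cos0 mulr1 subr0 mulNr mulrC (mulrC s) => <-.
apply: eq_Rintegral => u _; rewrite !(mul0r, subr0, addr0, mulr0) expR0 mul1r.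
rewrite mulrC; congr (_ * _); rewrite mulNr cosN mulrC.
by have [x0|x0] := leP 0 x; [rewrite ger0_norm|rewrite ltr0_norm // mulNr cosN].
Qed.

(** The factor [s * poisson_kernel s y = 1 / (1 + (y / s)^2)] increases to 1 with [s], so the limit
    holds by monotone convergence in the extended reals. *)
Lemma cvg_integral_poisson_kernel (power : R -> R) : measurable_fun setT power ->
  (forall y, 0 <= power y) ->
  (\int[mu]_y (power y * (n.+1%:R * poisson_kernel n.+1%:R y))%:E @[n --> \oo] -->
   \int[mu]_y (power y)%:E)%E.
Proof.
move=> mpower p0; pose f n y := power y * (n.+1%:R * poisson_kernel n.+1%:R y).
have s0 n : 0 < n.+1%:R :> R by rewrite ltr0n.
have kE n y : n.+1%:R * poisson_kernel n.+1%:R y = 1 / (1 + y ^+ 2 * (n.+1%:R^-1) ^+ 2).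
  rewrite /poisson_kernel; have := s0 n; move: n.+1%:R => s s1; field.
  rewrite lt0r_neq0 //= !lt0r_neq0 ?ltr_wpDr ?sqr_ge0 ?exprn_gt0 //.
have mf n : measurable_fun setT (f n).
  apply: measurable_funM => //; apply: measurable_funM => //.
  have := measurable_poisson_kernel 0 (s0 n).
  by under eq_fun do rewrite subr0.
have f0 n y : 0 <= f n y.
  by apply: mulr_ge0 => //; apply: mulr_ge0; [exact: ltW|exact: poisson_kernel_ge0].
have fnd y : {homo f^~ y : n m / (n <= m)%N >-> n <= m}.
  move=> n m nm; rewrite /f !kE ler_wpM2l // !div1r lef_pV2 ?posrE ?(ltr_wpDr (mulr_ge0 (sqr_ge0 _) (sqr_ge0 _))) //.
  rewrite lerD2l ler_wpM2l ?sqr_ge0 // ler_pXn2r ?nnegrE ?invr_ge0 ?(ltW (s0 _)) //.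
  by rewrite lef_pV2 ?posrE // ler_nat ltnS.
have fcvg y : f n y @[n --> \oo] --> power y.
  rewrite (_ : f^~ y = (fun n => power y * (1 / (1 + y ^+ 2 * (n.+1%:R^-1) ^+ 2)))); last first.
    by apply/funext => n; rewrite /f kE.
  have H0 : y ^+ 2 * (n.+1%:R^-1) ^+ 2 @[n --> \oo] --> 0.
    rewrite -[X in _ --> X](mulr0 (y ^+ 2)); apply: cvgM; first exact: cvg_cst.
    rewrite -[X in _ --> X](mulr0 0); under eq_cvg do rewrite expr2.
    by apply: cvgM; exact: cvg_harmonic.
  rewrite -[X in _ --> X]mulr1; apply: cvgM; first exact: cvg_cst.
  rewrite -[X in _ --> X](_ : 1 / (1 + 0) = 1); last by rewrite addr0 divr1.
  apply: cvgM; first exact: cvg_cst.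
  by apply: cvgV; [rewrite addr0|apply: cvgD => //; exact: cvg_cst].
have limE : (\int[mu]_y (power y)%:E = \int[mu]_y limn (fun n => (f n y)%:E))%E.
  apply: eq_integral => y _; apply/esym/cvg_lim => //.
  by apply: cvg_EFin; [exact: nearW|exact: fcvg].
rewrite limE.
have mfE n : measurable_fun setT (fun y => (f n y)%:E) by apply/measurable_EFinP.
exact: (@cvg_monotone_convergence _ _ _ mu setT measurableT (fun n y => (f n y)%:E)
  mfE (fun n y _ => f0 n y)
  (fun y _ n m nm => fnd y n m nm)).
Qed.

Section Transform.
Variable g : R -> R.
Hypothesis gi : mu.-integrable setT (EFin \o g).

Definition cos_transform (y : R) : R := \int[mu]_t (g t * cos (y * t)).
Definition sin_transform (y : R) : R := \int[mu]_t (g t * sin (y * t)).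

Let mg : measurable_fun setT g := integrable_measurable gi.

Let mcos : measurable_fun setT (fun p : R * R => cos (p.1 * p.2)).
Proof. by apply: measurable_mulR; apply: continuous_measurable_fun; exact: continuous_cos. Qed.

Let msin : measurable_fun setT (fun p : R * R => sin (p.1 * p.2)).
Proof. by apply: measurable_mulR; apply: continuous_measurable_fun; exact: continuous_sin. Qed.

Let gcos y : mu.-integrable setT (EFin \o (fun t => g t * cos (y * t))).
Proof.
apply: (integrable_mul_bounded (K := 1)) => //; first exact: (measurable_section1 y mcos).
by move=> t _; exact: cos_max.
Qed.

Let gsin y : mu.-integrable setT (EFin \o (fun t => g t * sin (y * t))).
Proof.
apply: (integrable_mul_bounded (K := 1)) => //; first exact: (measurable_section1 y msin).
by move=> t _; exact: sin_max.
Qed.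

Lemma measurable_cos_transform : measurable_fun setT cos_transform.
Proof. by apply: (measurable_Rintegral_section (K := 1) gi mcos) => p; exact: cos_max. Qed.

Lemma measurable_sin_transform : measurable_fun setT sin_transform.
Proof. by apply: (measurable_Rintegral_section (K := 1) gi msin) => p; exact: sin_max. Qed.

Let N := \int[mu]_t `|g t|.

Let N0 : 0 <= N.
Proof. exact: Rintegral_ge0. Qed.

Let transform_le (f : R -> R) (K : R) : measurable_fun setT f -> (forall t, `|f t| <= K) ->
  `|\int[mu]_t (g t * f t)| <= K * N.
Proof.
move=> mf fK.
have fi : mu.-integrable setT (EFin \o (fun t => g t * f t)).
  by apply: (integrable_mul_bounded (K := K)).
apply: le_trans (le_normr_Rintegral _ fi) _ => //.
have ai : mu.-integrable setT (EFin \o (fun t => `|g t|)) by exact: integrable_abse gi.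
rewrite -RintegralZl //; apply: le_Rintegral => //.
- exact: integrable_abse fi.
- exact: integrable_funZ.
- by move=> t _; rewrite normrM mulrC ler_wpM2r.
Qed.

Let c_le y : `|cos_transform y| <= N.
Proof.
rewrite -[N]mul1r; apply: transform_le; [exact: (measurable_section1 y mcos)|by move=> t; exact: cos_max].
Qed.

Let s_le y : `|sin_transform y| <= N.
Proof.
rewrite -[N]mul1r; apply: transform_le; [exact: (measurable_section1 y msin)|by move=> t; exact: sin_max].
Qed.

Let power y := cos_transform y ^+ 2 + sin_transform y ^+ 2.

Let mpower : measurable_fun setT power.
Proof.
by apply: measurable_funD; apply: measurable_funX;
  [exact: measurable_cos_transform|exact: measurable_sin_transform].
Qed.

Let power_le y : `|power y| <= 2 * N ^+ 2.
Proof.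
rewrite ger0_norm ?addr_ge0 ?sqr_ge0 //.
rewrite /power -[cos_transform y ^+ 2]real_normK ?num_real //.
rewrite -[sin_transform y ^+ 2]real_normK ?num_real // mulrDl mul1r.
by apply: lerD; rewrite ler_pXn2r ?nnegrE ?c_le ?s_le.
Qed.

(** The real part of [exp (i y t)] times the Fourier transform of [g] at [y]. *)
Let cross y t := cos_transform y * cos (y * t) + sin_transform y * sin (y * t).

Let crossE y t : \int[mu]_u (g u * cos (y * (t - u))) = cross y t.
Proof.
rewrite /cross /cos_transform /sin_transform.
transitivity (\int[mu]_u (cos (y * t) * (g u * cos (y * u)) + sin (y * t) * (g u * sin (y * u)))).
  by apply: eq_Rintegral => u _; rewrite mulrBr cosB; ring.
rewrite RintegralD //; last 2 first.
- exact: integrable_funZ.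
- exact: integrable_funZ.
by rewrite !RintegralZl // mulrC (mulrC (sin _)).
Qed.

Let powerE y : power y = \int[mu]_t (g t * cross y t).
Proof.
rewrite /power /cross.
transitivity (\int[mu]_t (cos_transform y * (g t * cos (y * t)) + sin_transform y * (g t * sin (y * t)))); last first.
  by apply: eq_Rintegral => t _; ring.
rewrite RintegralD //; last 2 first.
- exact: integrable_funZ.
- exact: integrable_funZ.
by rewrite !RintegralZl // !expr2.
Qed.

(** By Fubini the integral over [y] is done first: the Poisson average of [cos (y * (t - u))] is
    [pi * expR (- (s * |t - u|))], that is [2 * pi / s] times the Laplace kernel. *)
Lemma abel_plancherel (s : R) : 0 < s ->
  \int[mu]_y (power y * (s * poisson_kernel s y)) =
  2 * pi * \int[mu]_t (g t * \int[mu]_u (g u * laplace_kernel s (t - u))).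
Proof.
move=> s0.
have Pi : mu.-integrable setT (EFin \o poisson_kernel s).
  have := integrable_poisson_kernel 0 s0.
  by rewrite (_ : (fun u => poisson_kernel s (u - 0)) = poisson_kernel s) //; apply/funext => u; rewrite subr0.
have mcross : measurable_fun setT (fun p : R * R => cross p.1 p.2).
  apply: measurable_funD; apply: measurable_funM => //.
    by apply: measurable_fstR; exact: measurable_cos_transform.
  by apply: measurable_fstR; exact: measurable_sin_transform.
have cross_le (p : R * R) : `|cross p.1 p.2| <= N + N.
  apply: le_trans (ler_normD _ _) _; rewrite !normrM; apply: lerD.
    by rewrite -[leRHS]mulr1 ler_pM ?cos_max.
  by rewrite -[leRHS]mulr1 ler_pM ?sin_max.
have inner t : \int[mu]_y (poisson_kernel s y * cross y t) =
    \int[mu]_u (g u * (pi * expR (- (s * `|t - u|)))).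
  transitivity (\int[mu]_y (poisson_kernel s y * \int[mu]_u (g u * cos (y * (t - u))))).
    by apply: eq_Rintegral => y _; rewrite crossE.
  have mB : measurable_fun setT (fun p : R * R => cos (p.1 * (t - p.2))).
    apply: (@measurableT_comp _ _ _ _ _ _ (@cos R)).
      by apply: continuous_measurable_fun; exact: continuous_cos.
    apply: measurable_funM; first exact: measurable_fst.
    by apply: measurable_funB => //; exact: measurable_snd.
  rewrite (Rfubini_bounded Pi gi mB (fun p => cos_max _)).
  by apply: eq_Rintegral => u _; rewrite -integral_cos_poisson_kernel.
transitivity (s * \int[mu]_y (poisson_kernel s y * \int[mu]_t (g t * cross y t))).
  rewrite -RintegralZl //.
    by apply: eq_Rintegral => y _; rewrite -powerE; ring.
  under eq_fun do rewrite -powerE.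
  by apply: (integrable_mul_bounded (K := 2 * N ^+ 2)) => // y _; exact: power_le.
rewrite (Rfubini_bounded Pi gi mcross cross_le).
have k_le t : `|laplace_kernel s t| <= s / 2.
  rewrite ger0_norm ?laplace_kernel_ge0 // /laplace_kernel ler_piMr ?divr_ge0 ?(ltW s0) //.
  by rewrite expR_le1 oppr_le0 mulr_ge0 // ltW.
have mk t := measurable_section1 t (measurable_laplace_kernel_sub s).
pose J t := \int[mu]_u (g u * laplace_kernel s (t - u)).
have innerE t : \int[mu]_y (poisson_kernel s y * cross y t) = 2 * pi / s * J t.
  rewrite inner /J -RintegralZl //.
    by apply: eq_Rintegral => u _; rewrite /laplace_kernel; field; rewrite lt0r_neq0.
  apply: (integrable_mul_bounded (K := s / 2)) => //; exact: mk.
have Ji : mu.-integrable setT (EFin \o (fun t => g t * J t)).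
  apply: (integrable_mul_bounded (K := s / 2 * N)) => //.
    by apply: (measurable_Rintegral_section (K := s / 2) gi (measurable_laplace_kernel_sub s)).
  by move=> t _; apply: transform_le => //; exact: mk.
transitivity (s * \int[mu]_t (2 * pi / s * (g t * J t))).
  congr (_ * _); apply: eq_Rintegral => t _; rewrite /= innerE; ring.
rewrite RintegralZl //; field; rewrite lt0r_neq0 //.
Qed.

Hypothesis g2i : mu.-integrable setT (EFin \o (fun t => g t ^+ 2)).

Let E := \int[mu]_t g t ^+ 2.

Let sgap s := \int[(mu \x mu)%E]_p ((g p.1 - g p.2) ^+ 2 * laplace_kernel s (p.1 - p.2)).

(** Polarisation [2ab = a^2 + b^2 - (a - b)^2], where both squares integrate to [E] because the
    kernel has mass 1 in each variable. *)
Let quadratic_gap (s : R) : 0 < s ->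
  \int[mu]_t (g t * \int[mu]_u (g u * laplace_kernel s (t - u))) = E - sgap s / 2.
Proof.
move=> s0.
have mk := measurable_laplace_kernel_sub s.
have k0 (p : R * R) := laplace_kernel_ge0 (p.1 - p.2) s0.
have k_le (p : R * R) : `|laplace_kernel s (p.1 - p.2)| <= s / 2.
  rewrite ger0_norm ?laplace_kernel_ge0 // /laplace_kernel ler_piMr ?divr_ge0 ?(ltW s0) //.
  by rewrite expR_le1 oppr_le0 mulr_ge0 // ltW.
have mg2 : measurable_fun setT (fun t => g t ^+ 2) by exact: measurable_funX.
have g2oo : (\int[mu]_t (g t ^+ 2)%:E < +oo)%E.
  have /integrableP[_] := g2i; apply: le_lt_trans; rewrite le_eqVlt; apply/orP; left; apply/eqP.
  by apply: eq_integral => t _; rewrite /= ger0_norm // sqr_ge0.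
have i1 : (mu \x mu)%E.-integrable setT (EFin \o (fun p => g p.1 ^+ 2 * laplace_kernel s (p.1 - p.2))).
  apply: ge0_integrable => //.
  - by apply: measurable_funM mk; exact: (measurable_fstR mg2).
  - by move=> p _; rewrite mulr_ge0 // sqr_ge0.
  - by rewrite (integral_laplace_kernel_fst s0 mg2) // => t; exact: sqr_ge0.
have i2 : (mu \x mu)%E.-integrable setT (EFin \o (fun p => g p.2 ^+ 2 * laplace_kernel s (p.1 - p.2))).
  apply: ge0_integrable => //.
  - by apply: measurable_funM mk; exact: (measurable_sndR mg2).
  - by move=> p _; rewrite mulr_ge0 // sqr_ge0.
  - by rewrite (integral_laplace_kernel_snd s0 mg2) // => t; exact: sqr_ge0.
have i3 : (mu \x mu)%E.-integrable setT (EFin \o (fun p => g p.1 * g p.2 * laplace_kernel s (p.1 - p.2))).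
  by apply: (integrable_mul_bounded (K := s / 2)) => //; exact: integrable_tensor.
have e1 : \int[(mu \x mu)%E]_p (g p.1 ^+ 2 * laplace_kernel s (p.1 - p.2)) = E.
  by rewrite /Rintegral (integral_laplace_kernel_fst s0 mg2) // => t; exact: sqr_ge0.
have e2 : \int[(mu \x mu)%E]_p (g p.2 ^+ 2 * laplace_kernel s (p.1 - p.2)) = E.
  by rewrite /Rintegral (integral_laplace_kernel_snd s0 mg2) // => t; exact: sqr_ge0.
have e3 : \int[mu]_t (g t * \int[mu]_u (g u * laplace_kernel s (t - u))) =
    \int[(mu \x mu)%E]_p (g p.1 * g p.2 * laplace_kernel s (p.1 - p.2)).
  rewrite [RHS]/Rintegral -(integral12_prod_meas1 i3) /Rintegral; congr fine.
  apply: eq_integral => t _; rewrite /fubini_F /=.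
  have gk : mu.-integrable setT (EFin \o (fun u => g u * laplace_kernel s (t - u))).
    apply: (integrable_mul_bounded (K := s / 2)) => //; first exact: (measurable_section1 t mk).
    by move=> u _; exact: (k_le (t, u)).
  rewrite EFinM EFin_Rintegral // -integralZl //.
  by congr (integral mu setT _); apply/funext => u; rewrite -EFinM mulrA.
have -> : sgap s = E + E - 2 * \int[(mu \x mu)%E]_p (g p.1 * g p.2 * laplace_kernel s (p.1 - p.2)).
  rewrite -{1}e1 -e2 -RintegralD // -RintegralZl // -RintegralB //.
  - by apply: eq_Rintegral => p _; ring.
  - exact: integrable_funD.
  - exact: integrable_funZ.
by rewrite e3; field.
Qed.

Let sgap_ge0 s : 0 < s -> 0 <= sgap s.
Proof.
by move=> s0; apply: Rintegral_ge0 => p _; rewrite mulr_ge0 ?sqr_ge0 // laplace_kernel_ge0.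
Qed.

(* With q = g |g|, the square of the difference is controlled by the L1 gap of q. *)
Let sqr_sub_le (a b : R) : (a - b) ^+ 2 <= 2 * `|a * `|a| - b * `|b| |.
Proof.
have h1 := ler_norm (a * `|a| - b * `|b|); have h2 := ler_norm (- (a * `|a| - b * `|b|)).
rewrite normrN in h2; have h3 := normr_ge0 (a * `|a| - b * `|b|).
set x := `|a * _ - _| in h1 h2 h3 *.
have [a0|a0] := leP 0 a; have [b0|b0] := leP 0 b; move: h1 h2;
  rewrite ?(ger0_norm a0) ?(ger0_norm b0) ?(ltr0_norm a0) ?(ltr0_norm b0) => h1 h2.
- have [ab|ab] := leP b a.
    have := mulr_ge0 (_ : 0 <= a - b) b0; rewrite subr_ge0 => /(_ ab); nra.
  have := mulr_ge0 (_ : 0 <= b - a) a0; rewrite subr_ge0 => /(_ (ltW ab)); nra.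
- have := sqr_ge0 (a + b); nra.
- have := sqr_ge0 (a + b); nra.
- have [ab|ab] := leP b a.
    have := mulr_ge0 (_ : 0 <= a - b) (_ : 0 <= - a); rewrite subr_ge0 oppr_ge0 => /(_ ab (ltW a0)); nra.
  have := mulr_ge0 (_ : 0 <= b - a) (_ : 0 <= - b); rewrite subr_ge0 oppr_ge0 => /(_ (ltW ab) (ltW b0)); nra.
Qed.

Let sgap_cvg0 : sgap n.+1%:R @[n --> \oo] --> 0.
Proof.
pose q t := g t * `|g t|.
have mq : measurable_fun setT q by apply: measurable_funM => //; exact: measurableT_comp.
have qi : mu.-integrable setT (EFin \o q).
  apply: le_integrable g2i => //; first exact/measurable_EFinP.
  by move=> t _ /=; rewrite lee_fin normrM normr_id normrX expr2.
have /fine_cvgP[qfin qcvg] := laplace_gap_cvg0 qi.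
have q2 : 2 * fine (laplace_gap n.+1%:R q) @[n --> \oo] --> 0.
  by rewrite -[X in _ --> X](mulr0 2); apply: cvgM => //; exact: cvg_cst.
apply: (squeeze_cvgr _ (cvg_cst 0) q2); apply: filterS qfin => n nfin.
have s0 : 0 < n.+1%:R :> R by rewrite ltr0n.
rewrite sgap_ge0 //= -lee_fin (EFinM 2) (fineK nfin).
have m1 : measurable_fun setT (fun p : R * R => (g p.1 - g p.2) ^+ 2 * laplace_kernel n.+1%:R (p.1 - p.2)).
  apply: measurable_funM; last exact: measurable_laplace_kernel_sub.
  by apply: measurable_funX; apply: measurable_funB; [exact: measurable_fstR|exact: measurable_sndR].
have m2 : measurable_fun setT (fun p : R * R => `|q p.1 - q p.2| * laplace_kernel n.+1%:R (p.1 - p.2)).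
  apply: measurable_funM; last exact: measurable_laplace_kernel_sub.
  by apply: measurableT_comp => //; apply: measurable_funB; [exact: measurable_fstR|exact: measurable_sndR].
have H : (\int[mu \x mu]_p ((g p.1 - g p.2) ^+ 2 * laplace_kernel n.+1%:R (p.1 - p.2))%:E <=
    2%:E * laplace_gap n.+1%:R q)%E.
  rewrite /laplace_gap -ge0_integralZl ?lee_fin //; last 2 first.
  - exact/measurable_EFinP.
  - by move=> p _; rewrite lee_fin mulr_ge0 // laplace_kernel_ge0.
  apply: ge0_le_integral => //.
  - by move=> p _; rewrite lee_fin mulr_ge0 ?sqr_ge0 // laplace_kernel_ge0.
  - exact/measurable_EFinP.
  - by apply: emeasurable_funM; [exact: measurable_cst|exact/measurable_EFinP].
  - move=> p _; rewrite -EFinM lee_fin [leRHS]mulrA.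
    by apply: ler_wpM2r; [exact: laplace_kernel_ge0|exact: sqr_sub_le].
rewrite /sgap /Rintegral fineK //.
rewrite ge0_fin_numE.
  apply: le_lt_trans H _; apply: lte_mul_pinfty => //.
  by rewrite -ge0_fin_numE // laplace_gap_ge0.
by apply: integral_ge0 => p _; rewrite lee_fin mulr_ge0 ?sqr_ge0 // laplace_kernel_ge0.
Qed.

(** The Abel means have two limits: the integral of the power by monotone convergence, and
    [2 * pi * E] because the quadratic gap vanishes in the limit. *)
Lemma plancherel_real :
  (\int[mu]_y (cos_transform y ^+ 2 + sin_transform y ^+ 2)%:E = (2 * pi * E)%:E)%E.
Proof.
have p0 y : 0 <= power y by rewrite addr_ge0 // sqr_ge0.
have s0 n : 0 < n.+1%:R :> R by rewrite ltr0n.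
pose f n y := power y * (n.+1%:R * poisson_kernel n.+1%:R y).
have fi n : mu.-integrable setT (EFin \o f n).
  rewrite (_ : f n = (fun y => n.+1%:R * (power y * poisson_kernel n.+1%:R (y - 0)))); last first.
    by apply/funext => y; rewrite subr0 /f mulrCA.
  apply: integrable_funZ => //.
  by apply: (integrable_mul_poisson_kernel 0 (s0 n) mpower power_le).
apply: (cvg_unique _ (cvg_integral_poisson_kernel mpower p0)); first exact: ereal_hausdorff.
have E1 n : (\int[mu]_y (f n y)%:E = (2 * pi * (E - sgap n.+1%:R / 2))%:E)%E.
  by rewrite -EFin_Rintegral // abel_plancherel // quadratic_gap.
rewrite /=; under eq_fun do rewrite E1.
apply: cvg_EFin; first exact: nearW.
rewrite /comp /=; apply: cvgM; first exact: cvg_cst.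
rewrite -[X in _ --> X]subr0 -[X in _ --> _ - X](mul0r 2^-1).
by apply: cvgB; [exact: cvg_cst|apply: cvgM; [exact: sgap_cvg0|exact: cvg_cst]].
Qed.

End Transform.
End PlancherelReal.

(** * The Laplace transform: integrability, boundedness, holomorphy *)

Section LaplaceTransform.
Variable R : realType.
Local Notation C := R[i].
Local Notation mu := (@lebesgue_measure R).
Local Notation D := (`]0, +oo[%classic : set R).

Let mD : measurable D.
Proof. exact: measurable_itv. Qed.

Lemma measurable_rayM (g h : R -> R) : measurable_fun D g -> measurable_fun D h ->
  measurable_fun D (fun t => g t * h t).
Proof. exact: measurable_funM. Qed.

Lemma measurable_rayX (g : R -> R) n : measurable_fun D g -> measurable_fun D (fun t => g t ^+ n).
Proof. exact: measurable_funX. Qed.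

Lemma integrable_ray_le (g G : R -> R) : measurable_fun D g -> mu.-integrable D (EFin \o G) ->
  (forall t, 0 < t -> `|g t| <= G t) -> mu.-integrable D (EFin \o g).
Proof.
move=> mg Gi gG; apply: le_integrable Gi => //; first exact/measurable_EFinP.
move=> t; rewrite /= in_itv /= andbT => t0; rewrite lee_fin.
by apply: le_trans (gG _ t0) _; exact: ler_norm.
Qed.

Lemma eq_integrable_ray (g h : R -> R) : (forall t, 0 < t -> g t = h t) ->
  mu.-integrable D (EFin \o g) -> mu.-integrable D (EFin \o h).
Proof.
move=> gh; apply: eq_integrable => // t; rewrite inE /= in_itv /= andbT => t0.
by rewrite /comp gh.
Qed.

Definition cmeasurable (g : R -> C) :=
  measurable_fun D (fun t => Re (g t)) /\ measurable_fun D (fun t => Im (g t)).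

Definition cintegrable (g : R -> C) :=
  mu.-integrable D (EFin \o (fun t => Re (g t))) /\
  mu.-integrable D (EFin \o (fun t => Im (g t))).

Lemma cmeasurableM g h : cmeasurable g -> cmeasurable h -> cmeasurable (fun t => g t * h t).
Proof.
move=> [g1 g2] [h1 h2]; split.
  rewrite (_ : (fun _ => _) = fun t => Re (g t) * Re (h t) - Im (g t) * Im (h t)); last first.
    by apply/funext => t; rewrite ReM.
  by apply: measurable_funB; exact: measurable_funM.
rewrite (_ : (fun _ => _) = fun t => Re (g t) * Im (h t) + Im (g t) * Re (h t)); last first.
  by apply/funext => t; rewrite ImM.
by apply: measurable_funD; exact: measurable_funM.
Qed.

Lemma cmeasurable_real (g : R -> R) : measurable_fun D g -> cmeasurable (fun t => (g t)%:C).
Proof. by move=> mg; split => //=; exact: measurable_cst. Qed.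

Lemma measurable_modulus g : cmeasurable g -> measurable_fun D (fun t => modulus (g t)).
Proof.
move=> [g1 g2].
rewrite (_ : (fun _ => _) = fun t => Num.sqrt (Re (g t) ^+ 2 + Im (g t) ^+ 2)); last first.
  by apply/funext => t; rewrite modulusE.
apply: (@measurableT_comp _ _ _ _ _ _ (@Num.sqrt R)).
  exact: continuous_measurable_fun (@sqrt_continuous R).
by apply: measurable_funD; exact: measurable_funX.
Qed.

Lemma continuous_measurable_itv (g : R -> R) : continuous g -> measurable_fun D g.
Proof. by move=> cg; apply: measurable_funTS; exact: continuous_measurable_fun. Qed.

Lemma continuous_scale (k : R) (g : R -> R) : continuous g -> continuous (fun t : R => g (t * k)).
Proof.
move=> cg t; apply: (@continuous_comp _ _ _ (fun t : R => t * k) g); last exact: cg.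
by apply: cvgM; [exact: cvg_id|exact: cvg_cst].
Qed.

Lemma measurable_expR_scale (k : R) : measurable_fun D (fun t => expR (t * k)).
Proof. apply: continuous_measurable_itv; apply: continuous_scale; exact: continuous_expR. Qed.

Lemma measurable_expRN (d : R) : measurable_fun D (fun t => expR (- (d * t))).
Proof.
have -> : (fun t => expR (- (d * t))) = (fun t => expR (t * - d)); last exact: measurable_expR_scale.
by apply/funext => t; rewrite mulrN mulrC.
Qed.

Lemma cmeasurable_cexp z : cmeasurable (fun t => cexp (- (t%:C * z))).
Proof.
split.
  rewrite (_ : (fun _ => _) = fun t => expR (t * - Re z) * cos (t * - Im z)); last first.
    by apply/funext => t; rewrite Re_cexp !ReE /= !mul0r subr0 addr0 !mulrN.
  apply: measurable_funM; first exact: measurable_expR_scale.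
  by apply: continuous_measurable_itv; apply: continuous_scale; exact: continuous_cos.
rewrite (_ : (fun _ => _) = fun t => expR (t * - Re z) * sin (t * - Im z)); last first.
  by apply/funext => t; rewrite Im_cexp !ReE /= !mul0r subr0 addr0 !mulrN.
apply: measurable_funM; first exact: measurable_expR_scale.
by apply: continuous_measurable_itv; apply: continuous_scale; exact: continuous_sin.
Qed.

Lemma cintegrable_le g (G : R -> R) : cmeasurable g ->
  mu.-integrable D (EFin \o G) -> (forall t, 0 < t -> modulus (g t) <= G t) -> cintegrable g.
Proof.
move=> [g1 g2] Gi gG; split; apply: (integrable_ray_le _ Gi) => // t t0.
  exact: le_trans (normRe_le _) (gG _ t0).
exact: le_trans (normIm_le _) (gG _ t0).
Qed.

(** The factor 2 comes from estimating real and imaginary parts separately; the size of the constant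
    is immaterial to boundedness and holomorphy. *)
Lemma modulus_cintegral_le g (G : R -> R) : cintegrable g ->
  mu.-integrable D (EFin \o G) -> (forall t, 0 < t -> modulus (g t) <= G t) ->
  modulus (cintegral D g) <= 2 * \int[mu]_(t in D) G t.
Proof.
move=> [g1 g2] Gi gG; apply: le_trans (modulus_le _) _; rewrite mulr2n mulrDl mul1r /=.
apply: lerD.
  apply: le_trans (le_normr_Rintegral _ g1) _ => //.
  apply: le_Rintegral => //; first exact: integrable_abse g1.
  move=> t; rewrite /= in_itv /= andbT => t0.
  by apply: le_trans (normRe_le _) _; exact: gG.
apply: le_trans (le_normr_Rintegral _ g2) _ => //.
apply: le_Rintegral => //; first exact: integrable_abse g2.
move=> t; rewrite /= in_itv /= andbT => t0.
by apply: le_trans (normIm_le _) _; exact: gG.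
Qed.

Lemma cintegrableB g h : cintegrable g -> cintegrable h -> cintegrable (fun t => g t - h t).
Proof.
move=> [g1 g2] [h1 h2]; split.
  by apply: eq_integrable_ray (integrable_funB g1 h1 mD) => t _; rewrite !ReE.
by apply: eq_integrable_ray (integrable_funB g2 h2 mD) => t _; rewrite !ReE.
Qed.

Lemma cintegrableZ c g : cintegrable g -> cintegrable (fun t => c * g t).
Proof.
move=> [g1 g2]; split.
  apply: eq_integrable_ray (integrable_funB (integrable_funZ (Re c) g1 mD) (integrable_funZ (Im c) g2 mD) mD).
  by move=> t _; rewrite !ReE.
apply: eq_integrable_ray (integrable_funD (integrable_funZ (Re c) g2 mD) (integrable_funZ (Im c) g1 mD) mD).
by move=> t _; rewrite !ReE.
Qed.

Lemma cintegralB g h : cintegrable g -> cintegrable h ->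
  cintegral D g - cintegral D h = cintegral D (fun t => g t - h t).
Proof.
move=> [g1 g2] [h1 h2]; apply: complex_ext; rewrite !ReE /=.
  by rewrite -RintegralB //; apply: eq_Rintegral => t _; rewrite !ReE.
by rewrite -RintegralB //; apply: eq_Rintegral => t _; rewrite !ReE.
Qed.

Lemma cintegralZ c g : cintegrable g ->
  c * cintegral D g = cintegral D (fun t => c * g t).
Proof.
move=> [g1 g2]; apply: complex_ext; rewrite !ReE /=.
  rewrite -!RintegralZl // -RintegralB //; [|exact: integrable_funZ..].
  by apply: eq_Rintegral => t _; rewrite !ReE.
rewrite -!RintegralZl // -RintegralD //; [|exact: integrable_funZ..].
by apply: eq_Rintegral => t _; rewrite !ReE.
Qed.

Lemma integrable_expR (d : R) : 0 < d -> mu.-integrable D (EFin \o (fun t => expR (- (d * t)))).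
Proof.
move=> d0; have ki : mu.-integrable setT (EFin \o laplace_kernel d).
  apply: ge0_integrable => //.
  - exact: measurable_laplace_kernel.
  - by move=> t _; exact: laplace_kernel_ge0.
  - suff -> : (\int[mu]_t (laplace_kernel d t)%:E = 1)%E by exact: ltry.
    rewrite -[RHS](integral_laplace_kernel 0 d0).
    by congr (integral mu setT _); apply/funext => u; rewrite subr0.
have kD : mu.-integrable D (EFin \o laplace_kernel d) by apply: (@integrableS _ _ _ mu setT D) ki.
have := integrable_funZ (2 / d) kD mD.
apply: eq_integrable_ray => t t0.
by rewrite /laplace_kernel (gtr0_norm t0); field; exact: lt0r_neq0.
Qed.

(** From [2 t <= 1 + t ^+ 2]: a bound on [t ^+ 2 * E] yields one on [t * E], the factor met in the
    derivative. *)
Let absorb_le (t E E2 E4 c : R) : 0 < t -> 0 < E -> t ^+ 2 * E <= c * E2 -> c * E2 <= c * E4 ->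
  E <= E4 -> t * E <= (1 + c) * E4.
Proof.
move=> t0 E0 h h1 h2; have : 0 <= (t - 1) ^+ 2 * E by rewrite mulr_ge0 ?sqr_ge0 // ltW.
by have := sqr_ge0 t; nra.
Qed.

Variable f : R -> C.
Hypothesis mf : cmeasurable f.
Hypothesis fE : forall d, 0 < d ->
  (\int[mu]_(t in D) (modulus (f t) ^+ 2 * expR (- (d * t)))%:E < +oo)%E.

Let mmod := measurable_modulus mf.

Let mexp := measurable_expRN.

Lemma laplace_energy_integrable d : 0 < d ->
  mu.-integrable D (EFin \o (fun t => modulus (f t) ^+ 2 * expR (- (d * t)))).
Proof.
move=> d0; apply: ge0_integrable => //; last exact: fE.
- by apply: measurable_rayM => //; exact: measurable_rayX.
- by move=> t _; rewrite mulr_ge0 ?expR_ge0 // sqr_ge0.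
Qed.

Lemma laplace_modulus_integrable d : 0 < d ->
  mu.-integrable D (EFin \o (fun t => modulus (f t) * expR (- (d * t)))).
Proof.
move=> d0.
have := integrable_funD (laplace_energy_integrable d0) (integrable_expR d0) mD.
move=> H; apply: (integrable_ray_le _ H); first exact: measurable_rayM.
move=> t _; rewrite ger0_norm ?mulr_ge0 ?expR_ge0 ?modulus_ge0 //.
rewrite -[X in _ + X]mul1r -mulrDl ler_wpM2r ?expR_ge0 //.
by have := sqr_ge0 (modulus (f t) - 1); have := sqr_ge0 (modulus (f t)); nra.
Qed.

Lemma modulus_laplace_kernel (t : R) z w : modulus (cexp (- (t%:C * z)) * w) = modulus w * expR (- (Re z * t)).
Proof. by rewrite modulusM modulus_cexp !ReE /= mul0r subr0 mulrC (mulrC t). Qed.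

Lemma laplace_cintegrable z : 0 < Re z -> cintegrable (fun t => cexp (- (t%:C * z)) * f t).
Proof.
move=> z0; apply: (cintegrable_le _ (laplace_modulus_integrable z0)).
  by apply: cmeasurableM mf; exact: cmeasurable_cexp.
by move=> t _; rewrite modulus_laplace_kernel.
Qed.

Lemma laplace_bounded d z : 0 < d -> d <= Re z ->
  modulus (laplace f z) <= 2 * \int[mu]_(t in D) (modulus (f t) * expR (- (d * t))).
Proof.
move=> d0 dz; apply: modulus_cintegral_le => //.
- exact: laplace_cintegrable (lt_le_trans d0 dz).
- exact: laplace_modulus_integrable.
move=> t t0; rewrite modulus_laplace_kernel ler_wpM2l ?modulus_ge0 // ler_expR lerN2.
by rewrite ler_wpM2r // ltW.
Qed.

(** Squaring [x * t / 4 <= expR (x * t / 4)] absorbs [t ^+ 2] at the cost of half the exponent. *)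
Let sqr_expR_le (x t : R) : 0 < x -> 0 < t -> t ^+ 2 * expR (- (x * t)) <= 16 / x ^+ 2 * expR (- (x / 2 * t)).
Proof.
move=> x0 t0.
have h : x * t / 4 <= expR (x * t / 4).
  by apply: le_trans (expR_ge1Dx _); rewrite lerDr.
have h2 : (x * t / 4) ^+ 2 <= expR (x * t / 2).
  rewrite (_ : x * t / 2 = 2%:R * (x * t / 4)); last by field.
  rewrite expRM_natl ler_pXn2r ?nnegrE ?expR_ge0 //.
  by rewrite divr_ge0 // mulr_ge0 // ltW.
rewrite (_ : - (x / 2 * t) = x * t / 2 + - (x * t)); last by field.
rewrite expRD mulrA ler_wpM2r ?expR_ge0 //.
have -> : t ^+ 2 = 16 / x ^+ 2 * (x * t / 4) ^+ 2 by field; exact: lt0r_neq0.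
by rewrite ler_wpM2l // divr_ge0 // sqr_ge0.
Qed.

(** The derivative is the transform of [- t f t]. In the remainder, the decay [expR (- (x * t))] is
    shared out by quarters: one pays for [expR (t * |h|)], one is dropped, one absorbs [t ^+ 2], and
    the last stays in [G]. *)
Lemma laplace_cderivable z : 0 < Re z -> cderivable (laplace f) z.
Proof.
move=> z0; set x := Re z in z0.
pose f' t := - (t%:C) * f t.
have mf' : cmeasurable f'.
  apply: cmeasurableM mf.
  rewrite (_ : (fun t : R => - t%:C) = fun t => (- t)%:C); last first.
    by apply/funext => t; apply: complex_ext; rewrite !ReE /= ?oppr0.
  by apply: cmeasurable_real; exact: oppr_measurable.
pose G t := modulus (f t) * expR (- (x / 4 * t)).
have x40 : 0 < x / 4 by rewrite divr_gt0.
have Gi : mu.-integrable D (EFin \o G) by exact: laplace_modulus_integrable.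
pose J := \int[mu]_(t in D) G t.
have J0 : 0 <= J by apply: Rintegral_ge0 => t _; rewrite mulr_ge0 ?expR_ge0 ?modulus_ge0.
have exp_le (a t : R) : 0 < t -> x / 4 <= a -> expR (- (a * t)) <= expR (- (x / 4 * t)).
  by move=> t0 ax; rewrite ler_expR lerN2 ler_wpM2r // ltW.
have fi' : cintegrable (fun t => cexp (- (t%:C * z)) * f' t).
  apply: (cintegrable_le _ (integrable_funZ (1 + 16 / x ^+ 2) Gi mD)).
    by apply: cmeasurableM mf'; exact: cmeasurable_cexp.
  move=> t t0; rewrite modulus_laplace_kernel -/x /f' modulusM modulusN modulus_real gtr0_norm //.
  have /= h := sqr_expR_le z0 t0.
  have h1 := exp_le (x / 2) t t0; have h2 := exp_le x t t0.
  have {h1 h2} [h1 h2] : expR (- (x / 2 * t)) <= expR (- (x / 4 * t)) /\ expR (- (x * t)) <= expR (- (x / 4 * t)).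
    have ? : x / 4 <= x / 2 by rewrite ler_pM2l // lef_pV2 ?posrE // ler_nat.
    have ? : x / 4 <= x by rewrite ler_piMr ?(ltW z0) // invf_le1 // ler1n.
    by split; [apply: h1|apply: h2].
  have c0 : 0 <= 16 / x ^+ 2 by rewrite divr_ge0 ?sqr_ge0.
  have := ler_wpM2l (modulus_ge0 (f t)) (absorb_le t0 (expR_gt0 _) h (ler_wpM2l c0 h1) h2).
  rewrite /G; congr (_ <= _); ring.
apply/cderivableP; exists (laplace f' z) => e e0.
(* Twice the coefficient of [modulus h ^+ 2] in the constant [c] below, times [J]; the 2 is the one
   in [modulus_cintegral_le]. *)
pose K := 128 / x ^+ 2 * 4 * J.
exists (Num.min (x / 4) (e / (K + 1))).
  have K0 : 0 <= K by rewrite !mulr_ge0 // invr_ge0 sqr_ge0.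
  by rewrite lt_min x40 divr_gt0 // ltr_wpDl.
move=> h; rewrite lt_min => /andP[hx he].
have hzx : x * (3 / 4) <= Re (h + z).
  rewrite ReD -/x; have := normRe_le h; have := ler_norm (- Re h); rewrite normrN; move: hx; lra.
have hz0 : 0 < Re (h + z) by apply: lt_le_trans hzx; rewrite mulr_gt0.
have iz := laplace_cintegrable z0; have ihz := laplace_cintegrable hz0.
pose k t := cexp (- (t%:C * z)) * ((cexp (- (t%:C * h)) - 1 - (- (t%:C * h))) * f t).
have kE : (fun t => cexp (- (t%:C * (h + z))) * f t - cexp (- (t%:C * z)) * f t -
    h * (cexp (- (t%:C * z)) * f' t)) = k.
  by apply/funext => t; rewrite /k mulrDr opprD cexpD /f'; ring.
have -> : laplace f (h + z) - laplace f z - laplace f' z * h = cintegral D k.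
  rewrite (mulrC _ h) cintegralZ // !cintegralB ?kE //; [exact: cintegrableB|exact: cintegrableZ].
pose c := 64 / x ^+ 2 * 4 * modulus h ^+ 2.
have bound t : 0 < t -> modulus (k t) <= c * G t.
  move=> t0; rewrite modulus_laplace_kernel -/x modulusM.
  have := cexp_sub_affine_le (- (t%:C * h)).
  rewrite modulusN modulusM modulus_real (gtr0_norm t0) => H.
  rewrite /G [leLHS]mulrAC [leLHS]mulrC [leRHS]mulrCA ler_wpM2l ?modulus_ge0 //.
  apply: (@le_trans _ _ (4 * (t * modulus h) ^+ 2 * expR (t * modulus h) * expR (- (x * t)))).
    by rewrite ler_wpM2r ?expR_ge0.
  apply: (@le_trans _ _ (4 * modulus h ^+ 2 * (t ^+ 2 * expR (- (x / 2 * t))))).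
    rewrite (_ : 4 * _ ^+ 2 * _ * _ =
      4 * modulus h ^+ 2 * (t ^+ 2 * (expR (t * modulus h) * expR (- (x * t))))); last by ring.
    apply: ler_wpM2l; first by rewrite mulr_ge0 // sqr_ge0.
    apply: ler_wpM2l; first exact: sqr_ge0.
    rewrite -expRD ler_expR.
    have : t * modulus h <= t * (x / 4) by rewrite ler_wpM2l ?(ltW t0) // ltW.
    have := mulr_gt0 z0 t0; lra.
  have x20 : 0 < x / 2 by rewrite divr_gt0.
  have := sqr_expR_le x20 t0.
  have -> : 16 / (x / 2) ^+ 2 = 64 / x ^+ 2 by field; exact: lt0r_neq0.
  have -> : x / 2 / 2 = x / 4 by field.
  move=> /(ler_wpM2l (_ : 0 <= 4 * modulus h ^+ 2)) H2.
  apply: le_trans (H2 (mulr_ge0 _ (sqr_ge0 _))) _ => //.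
  by rewrite /c le_eqVlt; apply/orP; left; apply/eqP; ring.
have cGi := integrable_funZ c Gi mD.
apply: le_trans (modulus_cintegral_le _ cGi bound) _.
  by rewrite -kE; apply: cintegrableB; [exact: cintegrableB|exact: cintegrableZ].
rewrite RintegralZl // -/J.
have -> : 2 * (c * J) = K * modulus h * modulus h by rewrite /c /K; field; exact: lt0r_neq0.
rewrite ler_wpM2r ?modulus_ge0 //.
have K0 : 0 <= K by rewrite !mulr_ge0 // invr_ge0 sqr_ge0.
have K1 : 0 < K + 1 by rewrite ltr_wpDl.
move: he; rewrite ltr_pdivlMr //; have := modulus_ge0 h; move: (modulus h) => m; move: K0; nra.
Qed.

End LaplaceTransform.

(** * Plancherel's theorem for the Laplace transform on a vertical line *)

Section LaplacePlancherel.
Variable R : realType.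
Local Notation C := R[i].
Local Notation mu := (@lebesgue_measure R).
Local Notation D := (`]0, +oo[%classic : set R).

Let mD : measurable D.
Proof. exact: measurable_itv. Qed.

Lemma ge0_integral_oppR (F : R -> \bar R) : measurable_fun setT F -> (forall y, 0 <= F y)%E ->
  (\int[mu]_y F (- y)%R = \int[mu]_y F y)%E.
Proof.
have split0 (G : R -> \bar R) : measurable_fun setT G -> (forall y, 0 <= G y)%E ->
    (\int[mu]_y G y = \int[mu]_(y in `]-oo, 0%R]) G y + \int[mu]_(y in `[0%R, +oo[) G y)%E.
  move=> mG G0.
  have -> : setT = `]-oo, 0] `|` `]0, +oo[ :> set R.
    by rewrite -set_itvNyy; apply: itv_bndbnd_setU; rewrite bnd_simp.
  rewrite ge0_integral_setU //.
  - by rewrite integral_itv_obnd_cbnd //; exact: measurable_funTS.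
  - exact: measurable_funTS.
  - apply/disj_setPS => x [] /=; rewrite !in_itv /= andbT => h1 h2.
    by have := le_lt_trans h1 h2; rewrite ltxx.
move=> mF F0.
have mG : measurable_fun setT (fun y : R => F (- y)).
  by apply: (measurableT_comp mF); exact: oppr_measurable.
have G0 y : (0 <= F (- y)%R)%E by [].
rewrite (split0 _ mG G0) (split0 _ mF F0) addeC; congr (_ + _)%E; last first.
  by rewrite -ge0_integration_by_substitution0.
rewrite ge0_integration_by_substitution0 //.
by apply: eq_integral => y _; rewrite opprK.
Qed.

Lemma ge0_integralT_Zl (k : R) (f : R -> R) : 0 <= k -> measurable_fun setT f -> (forall t, 0 <= f t) ->
  (k%:E * \int[mu]_t (f t)%:E = \int[mu]_t (k * f t)%:E)%E.
Proof.
by move=> k0 mf f0; rewrite -ge0_integralZl //;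
  [exact/measurable_EFinP|by move=> t _; rewrite lee_fin].
Qed.

Let ge0_integral_sum (F G : R -> \bar R) : measurable_fun setT F -> measurable_fun setT G ->
  (forall y, 0 <= F y)%E -> (forall y, 0 <= G y)%E ->
  (\int[mu]_y (F y + G y) = \int[mu]_y F y + \int[mu]_y G y)%E.
Proof. by move=> mF mG F0 G0; apply: ge0_integralD. Qed.

Variable f : R -> C.
Hypothesis mf : cmeasurable f.
Hypothesis fE : forall d, 0 < d ->
  (\int[mu]_(t in D) (modulus (f t) ^+ 2 * expR (- (d * t)))%:E < +oo)%E.

Let mexp := @measurable_expRN R.

Let restrict_re x := (fun t => expR (- (x * t)) * Re (f t)) \_ D.
Let restrict_im x := (fun t => expR (- (x * t)) * Im (f t)) \_ D.

Let part_integrable (g : R -> R) x : 0 < x -> measurable_fun D g ->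
  (forall t, `|g t| <= modulus (f t)) ->
  mu.-integrable setT (EFin \o ((fun t => expR (- (x * t)) * g t) \_ D)).
Proof.
move=> x0 mg gf; 
have H : mu.-integrable D (EFin \o (fun t => expR (- (x * t)) * g t)); last first.
  by have := (@integrable_mkcond _ _ _ mu D (EFin \o (fun t => expR (- (x * t)) * g t)) mD).1 H; rewrite restrict_EFin.
apply: (integrable_ray_le _ (laplace_modulus_integrable mf fE x0)).
  exact: measurable_rayM.
by move=> t _; rewrite mulrC normrM (ger0_norm (expR_ge0 _)) ler_wpM2r ?expR_ge0.
Qed.

Let part_sqr_integrable (g : R -> R) x : 0 < x -> measurable_fun D g ->
  (forall t, `|g t| <= modulus (f t)) ->
  mu.-integrable D (EFin \o (fun t => (expR (- (x * t)) * g t) ^+ 2)).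
Proof.
move=> x0 mg gf; have x20 : 0 < 2 * x by rewrite mulr_gt0.
apply: (integrable_ray_le _ (laplace_energy_integrable mf fE x20)).
  by apply: measurable_rayX; exact: measurable_rayM.
move=> t _; rewrite exprMn.
have -> : expR (- (x * t)) ^+ 2 = expR (- (2 * x * t)).
  by rewrite -expRM_natl; congr expR; rewrite -mulr_natl; ring.
rewrite mulrC normrM (ger0_norm (expR_ge0 _)) ler_wpM2r ?expR_ge0 // normrX ler_pXn2r ?nnegrE //.
exact: modulus_ge0.
Qed.

Let restrict_sqr (g : R -> R) : (fun t => (g \_ D) t ^+ 2) = (fun t => g t ^+ 2) \_ D.
Proof. by apply/funext => t; rewrite !patchE; case: ifP => // _; rewrite expr0n. Qed.

Let transform_restrict (g h : R -> R) : \int[mu]_t ((g \_ D) t * h t) = \int[mu]_(t in D) (g t * h t).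
Proof.
rewrite [RHS]Rintegral_mkcond; apply: eq_Rintegral => t _; rewrite !patchE.
by case: ifP => // _; rewrite mul0r.
Qed.

Let ray_expR_conj (x y : R) (w : C) (t : R) : cexp (- (t%:C * (x +i* y))) * w =
  ((expR (- (x * t)) * Re w * cos (y * t) + expR (- (x * t)) * Im w * sin (y * t)) +i*
   (expR (- (x * t)) * Im w * cos (y * t) - expR (- (x * t)) * Re w * sin (y * t))).
Proof.
apply: complex_ext; rewrite /= !(ReE, Re_cexp, Im_cexp) /= !mul0r subr0 addr0 cosN sinN (mulrC y) (mulrC x); ring.
Qed.

Let trig_integrable (g h : R -> R) : mu.-integrable setT (EFin \o (g \_ D)) -> continuous h ->
  (forall t, `|h t| <= 1) -> mu.-integrable D (EFin \o (fun t => g t * h t)).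
Proof.
move=> gi ch h1; apply: (integrable_mul_bounded (K := 1)) => //.
- by apply/(@integrable_mkcond _ _ _ mu D (EFin \o g) mD); rewrite restrict_EFin.
- exact: continuous_measurable_itv.
Qed.

Let cos_line y : continuous (fun t : R => cos (y * t)).
Proof.
rewrite (_ : (fun t => _) = fun t : R => cos (t * y)); last by apply/funext => t; rewrite mulrC.
by apply: continuous_scale; exact: continuous_cos.
Qed.

Let sin_line y : continuous (fun t : R => sin (y * t)).
Proof.
rewrite (_ : (fun t => _) = fun t : R => sin (t * y)); last by apply/funext => t; rewrite mulrC.
by apply: continuous_scale; exact: continuous_sin.
Qed.

Let p_integrable x : 0 < x -> mu.-integrable setT (EFin \o restrict_re x).
Proof. by move=> x0; apply: part_integrable => //; [case: mf|move=> t; exact: normRe_le]. Qed.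

Let q_integrable x : 0 < x -> mu.-integrable setT (EFin \o restrict_im x).
Proof. by move=> x0; apply: part_integrable => //; [case: mf|move=> t; exact: normIm_le]. Qed.

Let laplaceE x y : 0 < x -> laplace f (x +i* y) =
  (cos_transform (restrict_re x) y + sin_transform (restrict_im x) y) +i*
  (cos_transform (restrict_im x) y - sin_transform (restrict_re x) y).
Proof.
move=> x0; have pi_ := p_integrable x0; have qi_ := q_integrable x0.
rewrite /cos_transform /sin_transform !transform_restrict.
rewrite -RintegralD //; [|exact: trig_integrable pi_ (@cos_line y) (fun t => cos_max _)|
  exact: trig_integrable qi_ (@sin_line y) (fun t => sin_max _)].
rewrite -RintegralB //; [|exact: trig_integrable qi_ (@cos_line y) (fun t => cos_max _)|
  exact: trig_integrable pi_ (@sin_line y) (fun t => sin_max _)].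
rewrite /laplace /cintegral; congr (_ +i* _); apply: eq_Rintegral => t _;
  by rewrite ray_expR_conj.
Qed.


Let cos_transformN (g : R -> R) y : cos_transform g (- y) = cos_transform g y.
Proof. by apply: eq_Rintegral => t _; rewrite mulNr cosN. Qed.

Let sin_transformN (g : R -> R) y : mu.-integrable setT (EFin \o g) ->
  sin_transform g (- y) = - sin_transform g y.
Proof.
move=> gi; rewrite /sin_transform -[RHS]mulN1r -RintegralZl //.
  by apply: eq_Rintegral => t _; rewrite mulNr sinN; ring.
apply: (integrable_mul_bounded (K := 1)) => //; last by move=> t _; exact: sin_max.
by apply: continuous_measurable_fun; exact: sin_line.
Qed.

Let sqr_integrable (g : R -> R) x : 0 < x -> measurable_fun D g ->
  (forall t, `|g t| <= modulus (f t)) ->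
  mu.-integrable setT (EFin \o (fun t => ((fun t => expR (- (x * t)) * g t) \_ D) t ^+ 2)).
Proof.
move=> x0 mg gf; have H := part_sqr_integrable x0 mg gf.
have := (@integrable_mkcond _ _ _ mu D (EFin \o (fun t => (expR (- (x * t)) * g t) ^+ 2)) mD).1 H.
by rewrite restrict_EFin (restrict_sqr (fun t => expR (- (x * t)) * g t)).
Qed.

(** Expanding [|laplace f|^2] in the transforms of the damped real and imaginary parts leaves a
    cross term that is odd in [y]. Adding the integrand at [- y] cancels it, so [plancherel_real]
    computes twice the integral. *)
Lemma laplace_plancherel x : 0 < x ->
  (\int[mu]_y (modulus (laplace f (x +i* y)) ^+ 2)%:E =
   (2 * pi)%:E * \int[mu]_(t in D) (modulus (f t) ^+ 2 * expR (- (2 * x * t)))%:E)%E.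
Proof.
move=> x0; have [mre mim] := mf.
have pi_ := p_integrable x0; have qi_ := q_integrable x0.
have p2 := sqr_integrable x0 mre (fun t => normRe_le (f t)).
have q2 := sqr_integrable x0 mim (fun t => normIm_le (f t)).
have := plancherel_real pi_ p2; have := plancherel_real qi_ q2.
have mcp := measurable_cos_transform pi_; have msp := measurable_sin_transform pi_.
have mcq := measurable_cos_transform qi_; have msq := measurable_sin_transform qi_.
have spN y := sin_transformN y pi_; have sqN y := sin_transformN y qi_.
have cpN y := cos_transformN (restrict_re x) y; have cqN y := cos_transformN (restrict_im x) y.
set Eq := \int[mu]_t _; set Ep := \int[mu]_t _ => PQ PP.
have E0 : (\int[mu]_(t in D) (modulus (f t) ^+ 2 * expR (- (2 * x * t)))%:E = (Ep + Eq)%:E)%E.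
  have x20 : 0 < 2 * x by rewrite mulr_gt0.
  rewrite -EFin_Rintegral //; last exact: laplace_energy_integrable.
  have part (g : R -> R) : \int[mu]_t (((fun t => expR (- (x * t)) * g t) \_ D) t ^+ 2) =
      \int[mu]_(t in D) (g t ^+ 2 * expR (- (2 * x * t))).
    rewrite [RHS]Rintegral_mkcond; apply: eq_Rintegral => t _; rewrite !patchE.
    case: ifP => _; last by rewrite expr0n.
    rewrite exprMn mulrC; congr (_ * _); rewrite -expRM_natl; congr expR; ring.
  rewrite /Ep /Eq !part -RintegralD //.
  - congr EFin; apply: eq_Rintegral => t _; rewrite sqr_modulus; ring.
  - apply: eq_integrable_ray (part_sqr_integrable x0 mre (fun t => normRe_le (f t))) => t _.
    rewrite exprMn mulrC; congr (_ * _); rewrite -expRM_natl; congr expR; ring.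
  - apply: eq_integrable_ray (part_sqr_integrable x0 mim (fun t => normIm_le (f t))) => t _.
    rewrite exprMn mulrC; congr (_ * _); rewrite -expRM_natl; congr expR; ring.
rewrite E0.
pose F y := (modulus (laplace f (x +i* y)) ^+ 2)%:E.
have FE y : F y = ((cos_transform (restrict_re x) y + sin_transform (restrict_im x) y) ^+ 2 +
    (cos_transform (restrict_im x) y - sin_transform (restrict_re x) y) ^+ 2)%:E.
  by rewrite /F (laplaceE _ x0) sqr_modulus.
have mF : measurable_fun setT F.
  rewrite (funext FE); apply/measurable_EFinP.
  by apply: measurable_funD; apply: measurable_funX; [exact: measurable_funD|exact: measurable_funB].
have F0 y : (0 <= F y)%E by rewrite lee_fin sqr_ge0.
have mFN : measurable_fun setT (fun y : R => F (- y)).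
  by apply: (measurableT_comp mF); exact: oppr_measurable.
have : (\int[mu]_y F y + \int[mu]_y F y = (2 * (2 * pi * (Ep + Eq)))%:E)%E.
  have FN := ge0_integral_oppR mF F0.
  have -> : (\int[mu]_y F y + \int[mu]_y F y = \int[mu]_y (F y + F (- y)%R))%E.
    by rewrite (ge0_integral_sum mF mFN F0 (fun y => F0 (- y))) FN.
  pose P (y : R) := cos_transform (restrict_re x) y ^+ 2 + sin_transform (restrict_re x) y ^+ 2.
  pose Q (y : R) := cos_transform (restrict_im x) y ^+ 2 + sin_transform (restrict_im x) y ^+ 2.
  have P0 y : 0 <= P y by rewrite addr_ge0 ?sqr_ge0.
  have Q0 y : 0 <= Q y by rewrite addr_ge0 ?sqr_ge0.
  have mP : measurable_fun setT P by apply: measurable_funD; exact: measurable_funX.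
  have mQ : measurable_fun setT Q by apply: measurable_funD; exact: measurable_funX.
  have two0 : 0 <= 2 :> R by [].
  have m2 (g : R -> R) : measurable_fun setT g -> measurable_fun setT (fun y => (2 * g y)%:E).
    by move=> mg; apply/measurable_EFinP; apply: measurable_funM => //; exact: measurable_cst.
  have g2 (g : R -> R) : (forall y, 0 <= g y) -> forall y, (0 <= (2 * g y)%:E)%E.
    by move=> g0 y; rewrite lee_fin mulr_ge0.
  transitivity (\int[mu]_y ((2 * P y)%:E + (2 * Q y)%:E))%E.
    by apply: eq_integral => y _; rewrite !FE cpN cqN spN sqN -!EFinD; congr EFin; rewrite /P /Q; ring.
  rewrite (ge0_integral_sum (m2 P mP) (m2 Q mQ) (g2 P P0) (g2 Q Q0)).
  rewrite -(ge0_integralT_Zl two0 mP P0) -(ge0_integralT_Zl two0 mQ Q0) PP PQ.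
  by rewrite -!EFinM -EFinD; congr EFin; ring.
have I0 : (0 <= \int[mu]_y F y)%E by exact: integral_ge0.
(* An infinite integral would contradict the finite value of its double, so a real equation remains
   to be halved. *)
rewrite -/(\int[mu]_y F y)%E; move: I0; case: (\int[mu]_y F y)%E => [r||] //= _.
by rewrite -EFinD => -[rE]; rewrite -EFinM; congr EFin; move: rE; lra.
Qed.

End LaplacePlancherel.

(* A synonym of m carrying the sigma-finite structure that Fubini's theorem asks for. *)
Definition sigma_finite_copy d (T : measurableType d) (R : realType)
  (m : {measure set T -> \bar R}) (_ : sigma_finite setT m) : set T -> \bar R := m.

Section SigmaFiniteCopy.
Context d (T : measurableType d) (R : realType) (m : {measure set T -> \bar R}).
Variable H : sigma_finite setT m.

HB.instance Definition _ := Measure.copy (sigma_finite_copy H) m.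
HB.instance Definition _ := Measure_isSigmaFinite.Build d T R (sigma_finite_copy H) H.

Definition pack_sigma_finite : {sigma_finite_measure set T -> \bar R} := sigma_finite_copy H.

End SigmaFiniteCopy.

(** * Dyadic bounds for the exponential *)

Section DyadicDecay.
Variable R : realType.

(** [D] will be the doubling constant. Taylor's lower bound for the exponential at order [n.+1],
    with [2 * D <= 2 ^+ n.+1], yields a power of [2 ^+ k] that beats [D ^+ k] and leaves a geometric
    bound, in the form summed by [epsilon_trick0]. *)
Lemma dyadic_decay (D : R) : 1 <= D -> exists2 B : R, 0 <= B &
  forall k, expR (1 - 2 ^+ k / 2) * D ^+ k <= B / (2 ^ k.+1)%:R.
Proof.
move=> D1; have D0 : 0 <= D by apply: le_trans D1.
have [n Dn] : exists n, D <= n%:R by exists (Num.trunc D).+1; exact: ltW (truncnS_gt _).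
have D2 : 2 * D <= 2 ^+ n.+1.
  rewrite exprS ler_pM2l //; apply: le_trans Dn _.
  by rewrite -natrX ler_nat ltnW // ltn_expl.
have F0 : 0 < n.+1`!%:R :> R by rewrite ltr0n fact_gt0.
exists (2 * expR 1 * n.+1`!%:R * 2 ^+ n.+1); first by rewrite !mulr_ge0 ?expR_ge0 ?exprn_ge0 // ltW.
move=> k; set u : R := 2 ^+ k / 2.
have u0 : 0 < u by rewrite divr_gt0 ?exprn_gt0.
have e1 : expR (- u) <= n.+1`!%:R / u ^+ n.+1.
  have h : u ^+ n.+1 / n.+1`!%:R <= expR u.
    by apply: le_trans (expR_ge1Dxn n (ltW u0)); rewrite lerDr.
  rewrite expRN -(invrK n.+1`!%:R) -invfM lef_pV2 ?posrE ?expR_gt0 ?mulr_gt0 ?invr_gt0 ?exprn_gt0 //.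
  by rewrite mulrC.
have e2 : (2 * D) ^+ k <= (2 ^+ k) ^+ n.+1.
  by rewrite exprAC lerXn2r ?nnegrE ?exprn_ge0 // mulr_ge0.
have p0 : 0 < 2 ^+ k :> R by rewrite exprn_gt0.
rewrite expRD natrX (exprS 2 k).
have -> : expR 1 * expR (- u) * D ^+ k = expR 1 * (expR (- u) * D ^+ k) by rewrite mulrA.
have -> : 2 * expR 1 * n.+1`!%:R * 2 ^+ n.+1 / (2 * 2 ^+ k) = expR 1 * (n.+1`!%:R * 2 ^+ n.+1 / 2 ^+ k) :> R.
  by field; rewrite lt0r_neq0.
rewrite ler_pM2l ?expR_gt0 //.
apply: le_trans (ler_wpM2r (exprn_ge0 k D0) e1) _.
have -> : n.+1`!%:R / u ^+ n.+1 * D ^+ k = n.+1`!%:R * 2 ^+ n.+1 / 2 ^+ k * ((2 * D) ^+ k / (2 ^+ k) ^+ n.+1) :> R.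
  rewrite /u expr_div_n exprMn; field.
  by rewrite !lt0r_neq0 ?exprn_gt0.
rewrite ler_piMr //; last by rewrite ler_pdivrMr ?mul1r // exprn_gt0.
Qed.

(** One term suffices, that of the least [k] with [s < 2 ^+ k]. Minimality gives [2 ^+ k / 2 <= s]
    when [k] is positive, and the 1 in the exponent takes care of [k = 0]. *)
Lemma expRN_dyadic_le (s : R) : 0 <= s -> ((expR (- s))%:E <=
  \sum_(0 <= k <oo) (expR (1 - 2 ^+ k / 2) * \1_`]-oo, 2 ^+ k[ s)%:E)%E.
Proof.
move=> s0; have exk : exists k, s < 2 ^+ k.
  exists (Num.trunc s).+1; apply: lt_le_trans (truncnS_gt _) _.
  by rewrite -natrX ler_nat ltnW // ltn_expl.
have [k sk kmin] := find_ex_minn exk.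
have t0 i : (0 <= (expR (1 - 2 ^+ i / 2) * \1_`]-oo, 2 ^+ i[ s)%:E)%E.
  by rewrite lee_fin mulr_ge0 ?expR_ge0.
apply: (@le_trans _ _ (expR (1 - 2 ^+ k / 2) * \1_`]-oo, 2 ^+ k[ s)%:E); last first.
  apply: le_trans (nneseries_lim_ge k.+1 _) => //.
  by rewrite big_nat_recr //= leeDr // sume_ge0.
rewrite indicE mem_set ?mulr1; last by rewrite /= in_itv.
rewrite lee_fin ler_expR; case: k sk kmin => [|k] sk kmin; first by move: sk; rewrite expr0; lra.
have : 2 ^+ k <= s by rewrite leNgt; apply/negP => /kmin; rewrite ltnn.
by rewrite exprS; lra.
Qed.

End DyadicDecay.

(** * Size and regularity of the weight of a Zen measure *)

Section ZenWeight.
Variable R : realType.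
Variable nu : {measure set (measurableTypeR R) -> \bar R}.
Hypothesis hnu : zen_measure nu.
Local Notation D := (`[0, +oo[%classic : set R).

Let mD : measurable (D : set (measurableTypeR R)).
Proof. exact: measurable_itv. Qed.

Lemma zen_sigma_finite : sigma_finite setT nu.
Proof.
exists (fun n => if n is m.+1 then `[0, m.+1%:R[%classic else `]-oo, 0[%classic).
  apply/esym; rewrite -subTset => x _; have [x0|x0] := ltP x 0.
    by exists 0%N; rewrite //= in_itv.
  by exists (Num.trunc x).+1; rewrite //= in_itv /= x0 truncnS_gt.
case=> [|m]; split; try exact: measurable_itv.
  by rewrite (zen_carried hnu) ltry.
by have /andP[] := zen_pos_finite hnu (ltr0Sn R m).
Qed.

Lemma zen_mass r : 0 < r -> exists2 m, 0 < m & nu `[0%R, r[ = m%:E.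
Proof.
move=> r0; have /andP[] := zen_pos_finite hnu r0.
by case: (nu _) => // m; rewrite lte_fin => m0 _; exists m.
Qed.

Lemma zen_doubling_bound : exists2 K : R, 1 <= K &
  forall r, 0 < r -> (nu `[0%R, (2 * r)%R[ <= K%:E * nu `[0%R, r[)%E.
Proof.
have := zen_doubling hnu; set S := ereal_sup _ => Soo.
have ratio r : 0 < r -> (nu `[0%R, (2 * r)%R[ <= S * nu `[0%R, r[)%E.
  move=> r0; have [m m0 mE] := zen_mass r0.
  have : (nu `[0%R, (2 * r)%R[ / nu `[0%R, r[ <= S)%E by apply: ereal_sup_ubound; exists r.
  by rewrite mE inver (gt_eqF m0) lee_pdivrMr.
have S0 : (0 <= S)%E.
  have r0 : 0 < 1 :> R by []; have [m m0 mE] := zen_mass r0.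
  have := ratio _ r0; rewrite mE => /(le_trans (measure_ge0 nu _)).
  by rewrite pmule_lge0.
exists (Num.max 1 (fine S)); first by rewrite le_max lexx.
move=> r r0; apply: le_trans (ratio _ r0) _; rewrite lee_wpmul2r // -[leLHS]fineK ?ge0_fin_numE //.
by rewrite lee_fin le_max lexx orbT.
Qed.

(** The weight without its factor [2 * pi], in the extended reals, so that it can be estimated
    before its finiteness is known. *)
Definition decay_integral (t : R) : \bar R := (\int[nu]_(r in D) (expR (- (2 * r * t)))%:E)%E.

Lemma measurable_decay (t : R) : measurable_fun D (fun r : R => (expR (- (2 * r * t)))%:E).
Proof.
apply/measurable_EFinP; apply: measurable_funTS; apply: continuous_measurable_fun => r.
apply: (@continuous_comp _ _ _ (fun r : R => - (2 * r * t)) (@expR R)); last exact: continuous_expR.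
apply: cvgN; apply: cvgM; last exact: cvg_cst.
by apply: cvgM; [exact: cvg_cst|exact: cvg_id].
Qed.

Let mexp := measurable_decay.

Let le_integral_nu (A : set R) (f g : R -> \bar R) : measurable (A : set (measurableTypeR R)) ->
  measurable_fun A f -> measurable_fun A g -> (forall r, A r -> 0 <= f r)%E ->
  (forall r, A r -> f r <= g r)%E -> (\int[nu]_(r in A) f r <= \int[nu]_(r in A) g r)%E.
Proof. by move=> mA mf mg f0 fg; apply: ge0_le_integral. Qed.

Lemma decay_integral_ge0 t : (0 <= decay_integral t)%E.
Proof. by apply: integral_ge0 => r _; rewrite lee_fin expR_ge0. Qed.

Lemma decay_integral_lower b t : 0 < b -> 0 <= t ->
  ((expR (- (2 * b * t)))%:E * nu `[0%R, b[ <= decay_integral t)%E.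
Proof.
move=> b0 t0.
have sub : `[0, b[ `<=` D by move=> r; rewrite /= !in_itv /= => /andP[->].
apply: (@le_trans _ _ (\int[nu]_(r in `[0%R, b[) (expR (- (2 * r * t)))%:E)%E); last first.
  apply: (ge0_subset_integral nu _ mD (mexp t) _ sub); first exact: measurable_itv.
  by move=> r _; rewrite lee_fin expR_ge0.
rewrite -integral_cst; last exact: measurable_itv.
apply: le_integral_nu.
- exact: measurable_itv.
- exact: measurable_cst.
- exact: measurable_funS sub (mexp t).
- by move=> r _; rewrite lee_fin expR_ge0.
move=> r; rewrite /= in_itv /= => /andP[r0 rb]; rewrite lee_fin ler_expR lerN2.
by rewrite ler_wpM2r // ler_wpM2l // ltW.
Qed.

(** Cut the half-line at the points [2 ^+ k * a] with [a = (2 * t)^-1]: doubling lets the masses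
    grow at most like [M ^+ k], which the exponential beats. With [decay_integral_lower] at [b = a],
    the integral is comparable to the mass of [[0, a[]. *)
Lemma decay_integral_upper : exists2 K : R, 0 < K &
  forall t, 0 < t -> (decay_integral t <= K%:E * nu `[0%R, ((2 * t)^-1)%R[)%E.
Proof.
have [M M1 Mdbl] := zen_doubling_bound.
have M0 : 0 <= M by apply: le_trans M1.
have [B B0 HB] := dyadic_decay M1.
have nupow a k : 0 < a -> (nu `[0%R, (2 ^+ k * a)%R[ <= (M ^+ k)%:E * nu `[0%R, a[)%E.
  move=> a0; elim: k => [|k IH]; first by rewrite !expr0 mul1r mul1e.
  rewrite !exprS -mulrA; apply: le_trans (Mdbl _ _) _; first by rewrite mulr_gt0 // exprn_gt0.
  by rewrite EFinM -muleA lee_wpmul2l.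
exists (B + 1); first by rewrite ltr_wpDl.
move=> t t0; set a := (2 * t)^-1; have a0 : 0 < a by rewrite invr_gt0 mulr_gt0.
pose c k : R := expR (1 - 2 ^+ k / 2).
have c0 k : 0 <= c k by rewrite expR_ge0.
have ind0 k (r : R) : (0 <= ((c k)%:E * (\1_(`[0, 2 ^+ k * a[%classic : set (measurableTypeR R)) r)%:E))%E.
  by rewrite mule_ge0 // lee_fin.
have mind k : measurable_fun D (fun r : R => (\1_(`[0, 2 ^+ k * a[%classic : set (measurableTypeR R)) r)%:E).
  by apply/measurable_EFinP; apply: measurable_indic; exact: measurable_itv.
have mind' k : measurable_fun D (fun r : R => (c k)%:E * (\1_(`[0, 2 ^+ k * a[%classic : set (measurableTypeR R)) r)%:E)%E.
  by apply: emeasurable_funM => //; exact: measurable_cst.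
have H : (decay_integral t <= \sum_(0 <= k <oo) \int[nu]_(r in D)
    ((c k)%:E * (\1_(`[0, 2 ^+ k * a[%classic : set (measurableTypeR R)) r)%:E))%E.
  rewrite -integral_nneseries //; apply: le_integral_nu => //.
    by apply: (ge0_emeasurable_sum _ (fun k _ => mind' k)) => k r _ _; exact: ind0.
  move=> r; rewrite /= in_itv /= andbT => r0.
  have s0 : 0 <= 2 * r * t by rewrite !mulr_ge0 // ltW.
  apply: le_trans (expRN_dyadic_le s0) _; apply: lee_nneseries => k.
    by rewrite lee_fin mulr_ge0 // expR_ge0.
  move=> _; rewrite -EFinM lee_fin ler_wpM2l // !indicE.
  rewrite (_ : (r \in `[0, 2 ^+ k * a[%classic) = (2 * r * t \in `]-oo, 2 ^+ k[%classic)) //.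
  rewrite !mem_setE !in_itv /= r0 /= /a ltr_pdivlMr ?mulr_gt0 //.
  by rewrite mulrA (mulrC r).
apply: (le_trans H); apply: (@le_trans _ _ (\sum_(0 <= k <oo) ((B / (2 ^ k.+1)%:R)%:E * nu `[0%R, a[))%E).
  apply: lee_nneseries => k; first by move=> _ _; apply: integral_ge0 => r _; exact: ind0.
  move=> _; rewrite ge0_integralZl //; [|exact: mind|by rewrite lee_fin].
  rewrite (_ : (\int[nu]_(r in D) _)%E = nu (`[0%R, (2 ^+ k * a)%R[%classic `&` D)); last first.
    by apply: (@integral_indic _ (measurableTypeR R) R nu D mD); exact: measurable_itv.
  rewrite setIidl; last by move=> r; rewrite /= !in_itv /= => /andP[->].
  apply: (@le_trans _ _ ((c k)%:E * ((M ^+ k)%:E * nu `[0%R, a[))%E).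
    by rewrite lee_wpmul2l ?lee_fin //; exact: nupow.
  by rewrite muleA -EFinM lee_wpmul2r // lee_fin; exact: HB.
have [m m0 aE] := zen_mass a0; have {}m0 := ltW m0.
rewrite aE; under eq_eseriesr do rewrite muleC.
rewrite nneseriesZl; last by move=> k _; rewrite lee_fin divr_ge0.
rewrite muleC lee_wpmul2r ?lee_fin //.
apply: le_trans (epsilon_trick0 xpredT B0) _.
by rewrite lee_fin lerDl.
Qed.

Lemma decay_integral_lty t : 0 < t -> (decay_integral t < +oo)%E.
Proof.
move=> t0; have [K K0 HK] := decay_integral_upper; apply: le_lt_trans (HK _ t0) _.
have a0 : 0 < (2 * t)^-1 by rewrite invr_gt0 mulr_gt0.
have /andP[_ afin] := zen_pos_finite hnu a0.
by apply: lte_mul_pinfty => //; rewrite lee_fin ltW.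
Qed.

Lemma zen_weightE t : 0 < t -> ((zen_weight nu t)%:E = (2 * pi)%:E * decay_integral t)%E.
Proof.
move=> t0; rewrite /zen_weight /Rintegral EFinM -/(decay_integral t) fineK //.
by rewrite ge0_fin_numE ?decay_integral_ge0 // decay_integral_lty.
Qed.

Lemma zen_weight_le a s t : 0 < s -> 0 < t -> 0 <= a ->
  (decay_integral s <= a%:E * decay_integral t)%E -> zen_weight nu s <= a * zen_weight nu t.
Proof.
move=> s0 t0 a0 H; rewrite -lee_fin (EFinM a) !zen_weightE // muleCA lee_wpmul2l //.
by rewrite lee_fin mulr_ge0 // pi_ge0.
Qed.

(** Every interval [[0, d / 2[] has positive mass, so the weight decays more slowly than any
    exponential. This converts a finite weighted norm into the energy bounds behind the Laplace
    transform. *)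
Lemma zen_weight_lower d : 0 < d -> exists2 c : R, 0 < c &
  forall t, 0 < t -> c * expR (- (d * t)) <= zen_weight nu t.
Proof.
move=> d0; have d20 : 0 < d / 2 by rewrite divr_gt0.
have [m m0 E] := zen_mass d20.
exists (2 * pi * m); first by rewrite !mulr_gt0 // pi_gt0.
move=> t t0; rewrite -lee_fin zen_weightE // -mulrA EFinM lee_wpmul2l //.
  by rewrite lee_fin mulr_ge0 // pi_ge0.
have := decay_integral_lower d20 (ltW t0); rewrite E -EFinM mulrC.
by rewrite (_ : 2 * (d / 2) = d) //; field.
Qed.

Lemma zen_weight_gt0 t : 0 < t -> 0 < zen_weight nu t.
Proof.
move=> t0; have [c c0 H] := zen_weight_lower ltr01.
by apply: lt_le_trans (H _ t0); rewrite mulr_gt0 // expR_gt0.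
Qed.

Lemma zen_weight_nincr s t : 0 < s -> s <= t -> zen_weight nu t <= zen_weight nu s.
Proof.
move=> s0 st; have t0 := lt_le_trans s0 st.
rewrite -[leRHS]mul1r; apply: zen_weight_le => //; rewrite mul1e.
apply: le_integral_nu => //.
move=> r; rewrite /= in_itv /= andbT => r0.
by rewrite lee_fin ler_expR lerN2 ler_wpM2l // mulr_ge0.
Qed.

(** Halving [t] doubles the scale [(2 * t)^-1], which one application of doubling undoes. The factor
    [expR 1] compensates the value of the exponential at the edge of the interval of that length. *)
Let half_bound : exists2 K : R, 0 < K &
  forall t, 0 < t -> (decay_integral (t / 2) <= K%:E * decay_integral t)%E.
Proof.
have [M M1 Mdbl] := zen_doubling_bound; have M0 : 0 < M by apply: lt_le_trans M1.
have [K K0 HK] := decay_integral_upper.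
exists (K * M * expR 1); first by rewrite !mulr_gt0 ?expR_gt0.
move=> t t0; have t20 : 0 < t / 2 by rewrite divr_gt0.
apply: le_trans (HK _ t20) _; rewrite !EFinM -!muleA lee_wpmul2l ?lee_fin ?(ltW K0) //.
have a0 : 0 < (2 * t)^-1 by rewrite invr_gt0 mulr_gt0.
rewrite (_ : (2 * (t / 2))^-1 = 2 * (2 * t)^-1); last by field; rewrite lt0r_neq0.
apply: le_trans (Mdbl _ a0) _; rewrite lee_wpmul2l ?lee_fin ?(ltW M0) //.
have := decay_integral_lower a0 (ltW t0).
rewrite (_ : 2 * (2 * t)^-1 * t = 1); last by field; rewrite lt0r_neq0.
move=> /(lee_wpmul2l (_ : (0 <= (expR 1)%:E)%E)); rewrite lee_fin expR_ge0 => /(_ isT).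
by rewrite muleA -EFinM -expRD subrr expR0 mul1e.
Qed.

Lemma zen_weight_doubling : exists2 K : R, 0 < K &
  forall t, 0 < t -> zen_weight nu (t / 2) <= K * zen_weight nu t.
Proof.
have [K K0 HK] := half_bound; exists K => // t t0.
by apply: zen_weight_le; rewrite ?divr_gt0 ?(ltW K0) ?HK.
Qed.

(** Shortening the exponent [s] to [(1 - d) * s] raises the exponential by at most [4 * d] times its
    value at [s / 2], and [half_bound] controls the integral of the latter. The linear rate in [d]
    is what the lower norm bound consumes. *)
Lemma zen_weight_near : exists2 K : R, 0 <= K &
  forall t d, 0 < t -> 0 <= d <= 4^-1 -> zen_weight nu ((1 - d) * t) <= (1 + K * d) * zen_weight nu t.
Proof.
have [K K0 HK] := half_bound; exists (4 * K); first by rewrite mulr_ge0 // ltW.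
move=> t d t0 /andP[d0 d4]; have d1 : 0 < 1 - d by lra.
have Kd : 0 <= 4 * K * d by rewrite !mulr_ge0 // ltW.
apply: zen_weight_le => //; [exact: mulr_gt0|by rewrite addr_ge0|].
apply: (@le_trans _ _ (decay_integral t + (4 * d)%:E * decay_integral (t / 2))%E); last first.
  rewrite EFinD ge0_muleDl ?lee_fin // mul1e leeD2l // (mulrAC 4 K) (EFinM (4 * d)) -muleA.
  by rewrite lee_wpmul2l ?lee_fin ?mulr_ge0 // HK.
have e0 : (0 <= (4 * d)%:E)%E by rewrite lee_fin mulr_ge0.
have m4 : measurable_fun D (fun r : R => (4 * d)%:E * (expR (- (2 * r * (t / 2))))%:E)%E.
  by apply: emeasurable_funM; [exact: measurable_cst|exact: mexp].
have -> : (decay_integral t + (4 * d)%:E * decay_integral (t / 2) =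
    \int[nu]_(r in D) ((expR (- (2 * r * t)))%:E + (4 * d)%:E * (expR (- (2 * r * (t / 2))))%:E))%E.
  rewrite ge0_integralD // ?ge0_integralZl //.
  - exact: mexp.
  - exact: mexp.
  - by move=> r _; rewrite mule_ge0 // lee_fin expR_ge0.
apply: le_integral_nu => //; first by apply: emeasurable_funD.
move=> r; rewrite /= in_itv /= andbT => r0; rewrite -EFinM -EFinD lee_fin.
pose s := 2 * r * t; have s0 : 0 <= s by rewrite !mulr_ge0 // ltW.
have -> : - (2 * r * ((1 - d) * t)) = - s + d * s by rewrite /s; ring.
have -> : - (2 * r * (t / 2)) = - s / 2 by rewrite /s; field.
have -> : - (2 * r * t) = - s by [].
have h1 := expR_sub1_le (d * s).
(* The factors [s / 4] and [expR (d * s)] are each at most [expR (s / 4)], the second because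
   [d <= 4^-1]. *)
have h2 : d * s * expR (d * s) <= 4 * d * expR (s / 2).
  have -> : expR (s / 2) = expR (s / 4) * expR (s / 4) by rewrite -expRD; congr expR; field.
  have h3 : s / 4 <= expR (s / 4) by apply: le_trans (expR_ge1Dx _); rewrite lerDr.
  have -> : d * s * expR (d * s) = 4 * d * (s / 4 * expR (d * s)) by field.
  apply: ler_wpM2l; first by rewrite mulr_ge0.
  apply: ler_pM => //; first by rewrite divr_ge0.
  by rewrite ler_expR mulrC ler_wpM2l.
have -> : - s / 2 = - s + s / 2 by field.
rewrite !expRD (mulrCA (4 * d)) -[X in _ <= X + _]mulr1 -mulrDr ler_wpM2l ?expR_ge0 //.
lra.
Qed.

(** A parametric integral: the integrand is extended by 0 to the negative axis and Tonelli applies,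
    with [nu] packed as a sigma-finite measure. *)
Lemma measurable_zen_weight (E : set R) : measurable_fun E (zen_weight nu).
Proof.
apply: measurable_funTS; rewrite /zen_weight.
apply: measurable_funM; first exact: measurable_cst.
pose nu' : {sigma_finite_measure set (measurableTypeR R) -> \bar R} :=
  pack_sigma_finite zen_sigma_finite.
pose F (p : R * R) := (expR (- (2 * p.2 * p.1)) * \1_D p.2)%:E.
have F0 p : (0 <= F p)%E by rewrite lee_fin mulr_ge0 ?expR_ge0.
have mF : measurable_fun setT F.
  apply/measurable_EFinP; apply: measurable_funM.
    apply: (@measurableT_comp _ _ _ _ _ _ (@expR R)); first exact: measurable_expR.
    apply: measurableT_comp; first exact: oppr_measurable.
    apply: measurable_funM; last exact: measurable_fst.
    by apply: measurable_funM; [exact: measurable_cst|exact: measurable_snd].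
  by apply: measurable_sndR; apply: measurable_indic.
have := @measurable_fun_fubini_tonelli_F _ _ _ _ _ nu' F mF F0.
move=> H; apply: (@measurableT_comp _ _ _ _ _ _ (@fine R)); first exact: fine_measurable.
apply: eq_measurable_fun H => t _; rewrite /fubini_F [RHS]integral_mkcond.
apply: eq_integral => r _; rewrite /F patchE indicE /=.
by case: (r \in _); rewrite ?mulr1 ?mulr0.
Qed.

Lemma measurable_zen_weight_div (l : R) (E : set R) :
  measurable_fun E (fun t => zen_weight nu (t / l)).
Proof.
apply: measurable_funTS; apply: (measurableT_comp (measurable_zen_weight (E := setT))).
by apply: measurable_funM; [exact: measurable_id|exact: measurable_cst].
Qed.

End ZenWeight.

(** * Joint measurability on the plane *)

Section ProductMeasurability.
Variable R : realType.

Lemma measurable_open2 (U : set (R * R)) :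
  (forall p, U p -> exists2 e : R, 0 < e &
     forall q, `|q.1 - p.1| < e -> `|q.2 - p.2| < e -> U q) -> measurable U.
Proof.
move=> HU.
pose box (a b c d : rat) : set (R * R) :=
  `]ratr a, ratr b[%classic `*` `]ratr c, ratr d[%classic.
(* A box that is not contained in [U] contributes the empty set, so the four unions may range over
   all rationals. *)
pose part a b c d := [set p | box a b c d `<=` U /\ box a b c d p].
have -> : U = \bigcup_a \bigcup_b \bigcup_c \bigcup_d part a b c d.
  apply/seteqP; split=> [p Up|p [a _ [b _ [c _ [d _ [sub]]]]]]; last exact: sub.
  have [e e0 He] := HU _ Up.
  have bracket (x : R) : exists a b : rat, [/\ x - e < ratr a, ratr a < x, x < ratr b & ratr b < x + e].
    have xe : x - e < x by rewrite ltrBlDr ltrDl.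
    have ex : x < x + e by rewrite ltrDl.
    have [a] := rat_in_itvoo xe; have [b] := rat_in_itvoo ex.
    by rewrite !in_itv /= => /andP[b1 b2] /andP[a1 a2]; exists a, b.
  have [a [b [a1 a2 b1 b2]]] := bracket p.1.
  have [c [d [c1 c2 d1 d2]]] := bracket p.2.
  exists a => //; exists b => //; exists c => //; exists d => //; split.
    move=> q [/=]; rewrite !in_itv /= => /andP[q1 q2] /andP[q3 q4].
    by apply: He; rewrite ltr_norml; apply/andP; split; lra.
  by split; rewrite /= in_itv /= ?a2 ?b1 ?c2 ?d1.
do 4! (apply: bigcupT_measurable_rat => ?).
rewrite /part; set B := box _ _ _ _.
have [sub|nsub] := pselect (B `<=` U).
  rewrite (_ : [set p | _] = B); last by apply/seteqP; split=> p //= [].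
  by apply: measurableX; exact: measurable_itv.
rewrite (_ : [set p | _] = set0) //.
by apply/seteqP; split=> p //= [].
Qed.

Lemma measurable_continuous2 (a : R) (f : R * R -> R) :
  (forall p, a < p.1 -> forall e, 0 < e -> exists2 d, 0 < d &
     forall q, `|q.1 - p.1| < d -> `|q.2 - p.2| < d -> `|f q - f p| < e) ->
  measurable_fun [set p : R * R | a < p.1] f.
Proof.
move=> cf; apply: (measurability _ (@RGenOInfty.measurableE R)).
move=> _ [_ [c ->] <-]; apply: measurable_open2 => p [/= ap].
rewrite in_itv /= andbT => cp.
have e0 : 0 < f p - c by rewrite subr_gt0.
have [d d0 Hd] := cf p ap _ e0.
exists (Num.min d (p.1 - a)); first by rewrite lt_min d0 subr_gt0.
move=> q; rewrite !lt_min => /andP[q1 q1'] /andP[q2 _]; split.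
  by move: q1'; rewrite /= ltr_norml => /andP[]; lra.
rewrite /= in_itv /= andbT; have := Hd q q1 q2.
by rewrite ltr_norml => /andP[]; lra.
Qed.

Lemma measurable_sqr_modulus2 (F : R[i] -> R[i]) (e : R) :
  (forall z, 0 < Re z -> cderivable F z) ->
  measurable_fun [set p : R * R | - e < p.1] (fun p => modulus (F ((p.1 + e) +i* p.2)) ^+ 2).
Proof.
move=> dF; apply: measurable_funX; apply: measurable_continuous2 => p pe eps eps0.
have p0 : 0 < Re ((p.1 + e) +i* p.2) by move: pe; rewrite /=; lra.
have /cderivableP[L HL] := dF _ p0.
have L0 : 0 <= modulus L by exact: modulus_ge0.
have [r r0 Hr] := HL _ ltr01.
pose d := Num.min (r / 2) (eps / (2 * (modulus L + 2))).
have den0 : 0 < 2 * (modulus L + 2) by rewrite mulr_gt0 // ltr_wpDl.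
exists d; first by rewrite lt_min !divr_gt0.
move=> q q1 q2; set z := (p.1 + e) +i* p.2 in p0 HL Hr *.
pose h : R[i] := (q.1 - p.1) +i* (q.2 - p.2).
have -> : (q.1 + e) +i* q.2 = h + z by apply: complex_ext; rewrite !ReE /=; ring.
have hd : modulus h < 2 * d by apply: le_lt_trans (modulus_le _) _; rewrite /=; lra.
have hr : modulus h < r.
  by apply: lt_le_trans hd _; rewrite mulrC -ler_pdivlMr // ge_min lexx.
have := Hr h hr; rewrite mul1r => H1.
have h0 := modulus_ge0 h.
have : modulus (F (h + z) - F z) <= (modulus L + 1) * modulus h.
  rewrite -[F (h + z) - F z](subrK (L * h)).
  by apply: le_trans (modulusD _ _) _; rewrite modulusM mulrDl mul1r addrC lerD2l.
move=> H2; apply: (@le_lt_trans _ _ (modulus (F (h + z) - F z))).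
  have := modulusD (F (h + z) - F z) (F z); rewrite subrK.
  have := modulusD (F z - F (h + z)) (F (h + z)); rewrite subrK modulusB.
  by rewrite ler_norml => ? ?; apply/andP; split; lra.
apply: le_lt_trans H2 _; apply: (@le_lt_trans _ _ ((modulus L + 1) * (2 * d))).
  by rewrite ler_wpM2l ?addr_ge0 // ltW.
have : d <= eps / (2 * (modulus L + 2)) by rewrite ge_min lexx orbT.
rewrite ler_pdivlMr // => H3; apply: lt_le_trans H3.
have d0 : 0 < d by rewrite lt_min !divr_gt0.
by clearbody d; clear -d0 L0; nra.
Qed.

End ProductMeasurability.

(** * Integrals over the open ray *)

Section RayIntegral.
Variable R : realType.
Local Notation mu := (@lebesgue_measure R).
Local Notation T := (`]0, +oo[%classic : set R).

Lemma le_integral_ray (f g : R -> R) : measurable_fun T f -> measurable_fun T g ->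
  (forall t, 0 < t -> 0 <= f t) -> (forall t, 0 < t -> f t <= g t) ->
  (\int[mu]_(t in T) (f t)%:E <= \int[mu]_(t in T) (g t)%:E)%E.
Proof.
move=> mf mg f0 fg; apply: ge0_le_integral => //; try exact/measurable_EFinP.
  by move=> t; rewrite /= in_itv /= andbT => t0; rewrite lee_fin f0.
by move=> t; rewrite /= in_itv /= andbT => t0; rewrite lee_fin fg.
Qed.

Lemma integral_rayZ (k : R) (f : R -> R) : 0 <= k -> measurable_fun T f ->
  (forall t, 0 < t -> 0 <= f t) ->
  (\int[mu]_(t in T) (k * f t)%:E = k%:E * \int[mu]_(t in T) (f t)%:E)%E.
Proof.
move=> k0 mf f0; rewrite -ge0_integralZl //; try exact/measurable_EFinP.
  by move=> t; rewrite /= in_itv /= andbT => t0; rewrite lee_fin f0.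
Qed.

Lemma eq_integral_ray (f g : R -> \bar R) : (forall t, 0 < t -> f t = g t) ->
  (\int[mu]_(t in T) f t = \int[mu]_(t in T) g t)%E.
Proof. by move=> fg; apply: eq_integral => t; rewrite inE /= in_itv /= andbT => /fg. Qed.

Lemma monotone_ray_cvg (f : nat -> R -> R) (g : R -> R) : (forall n, measurable_fun T (f n)) ->
  (forall n t, 0 < t -> 0 <= f n t) ->
  (forall t, 0 < t -> {homo f^~ t : n m / (n <= m)%N >-> n <= m}) ->
  (forall t, 0 < t -> f n t @[n --> \oo] --> g t) ->
  (\int[mu]_(t in T) (f n t)%:E @[n --> \oo] --> \int[mu]_(t in T) (g t)%:E)%E.
Proof.
move=> mf f0 fnd fg.
have -> : (\int[mu]_(t in T) (g t)%:E = \int[mu]_(t in T) limn (fun n => (f n t)%:E))%E.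
  apply: eq_integral_ray => t t0; apply/esym/cvg_lim => //.
  by apply: cvg_EFin; [exact: nearW|exact: fg].
apply: (@cvg_monotone_convergence _ _ _ mu T _ (fun n t => (f n t)%:E)) => //.
- by move=> n; apply/measurable_EFinP; exact: mf.
- by move=> n t; rewrite /= in_itv /= andbT => t0; rewrite lee_fin f0.
- by move=> t; rewrite /= in_itv /= andbT => t0 n m nm; rewrite lee_fin; exact: fnd.
Qed.

End RayIntegral.

(** * The Zen norm and the isometry of the Laplace transform *)

Section ZenNorm.
Variable R : realType.
Local Notation C := R[i].
Local Notation mu := (@lebesgue_measure R).
Variable nu : {measure set (measurableTypeR R) -> \bar R}.
Hypothesis hnu : zen_measure nu.
Local Notation D := (`[0, +oo[%classic : set R).
Local Notation T := (`]0, +oo[%classic : set R).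

Let mD : measurable (D : set (measurableTypeR R)).
Proof. exact: measurable_itv. Qed.

Let nu' := pack_sigma_finite (zen_sigma_finite hnu).

Lemma zen_product_integral (G : R * R -> R) :
  measurable_fun (D `*` setT) G -> (forall p, 0 <= G p) ->
  (\int[nu \x mu]_(p in D `*` setT) (G p)%:E = \int[nu]_(r in D) \int[mu]_y (G (r, y))%:E)%E.
Proof.
move=> mG G0.
have mDT : measurable (D `*` [set: R] : set (measurableTypeR R * measurableTypeR R)).
  by apply: measurableX.
rewrite integral_mkcond.
have mF : measurable_fun setT ((fun p : R * R => (G p)%:E) \_ (D `*` setT)).
  by apply/(measurable_restrictT _ mDT); exact/measurable_EFinP.
have F0 (p : R * R) : (0 <= ((fun p : R * R => (G p)%:E) \_ (D `*` setT)) p)%E.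
  by rewrite patchE; case: ifP => // _; rewrite lee_fin.
have := @fubini_tonelli1 _ _ _ _ _ nu' mu _ mF F0 => H.
etransitivity; first exact: H.
rewrite [RHS]integral_mkcond; apply: eq_integral => r _; rewrite /fubini_F patchE.
case: ifPn => rD.
  apply: eq_integral => y _; rewrite patchE ifT // inE /=.
  by split => //; rewrite -inE.
rewrite integral0_eq // => y _; rewrite patchE ifF //.
by apply/negP; rewrite inE => -[Dr _]; move/negP: rD; apply; exact: mem_set.
Qed.

Lemma zen_tonelli (H : R * R -> R) : measurable_fun setT H -> (forall p, 0 <= H p) ->
  (\int[nu]_(r in D) \int[mu]_(t in T) (H (r, t))%:E =
   \int[mu]_(t in T) \int[nu]_(r in D) (H (r, t))%:E)%E.
Proof.
move=> mH H0.
pose K (p : R * R) := (H p * \1_D p.1 * \1_T p.2)%:E.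
have K0 p : (0 <= K p)%E by rewrite lee_fin !mulr_ge0.
have mK : measurable_fun setT K.
  apply/measurable_EFinP; apply: measurable_funM; first apply: measurable_funM => //.
    by apply: measurable_fstR; apply: measurable_indic.
  by apply: measurable_sndR; apply: measurable_indic; exact: measurable_itv.
have E : (\int[nu]_r \int[mu]_t K (r, t) = \int[mu]_t \int[nu]_r K (r, t))%E.
  exact: (@fubini_tonelli _ _ _ _ _ nu' mu K mK K0).
transitivity (\int[nu]_r \int[mu]_t K (r, t))%E.
  rewrite integral_mkcond; apply: eq_integral => r _; rewrite patchE.
  case: ifPn => rD.
    rewrite integral_mkcond; apply: eq_integral => t _; rewrite patchE /K /= !indicE rD mulr1.
    by case: (t \in _); rewrite ?mulr1 ?mulr0.
  by rewrite integral0_eq // => t _; rewrite /K /= !indicE (negbTE rD) mulr0 mul0r.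
rewrite E [RHS]integral_mkcond; apply: eq_integral => t _; rewrite patchE.
case: ifPn => tT.
  rewrite [RHS]integral_mkcond; apply: eq_integral => r _; rewrite patchE /K /= !indicE tT mulr1.
  by case: (r \in _); rewrite ?mulr1 ?mulr0.
by rewrite integral0_eq // => r _; rewrite /K /= !indicE (negbTE tT) mulr0.
Qed.

Section WeightTonelli.
Variables (g : R -> R) (e l : R).
Hypothesis mg : measurable_fun T g.
Hypothesis g0 : forall t, 0 <= g t.
Hypothesis l0 : 0 < l.

(** The extension by 0 off the open ray makes Tonelli available on the whole plane. *)
Let h := (fun t => 2 * pi * g t) \_ T.

Let mh : measurable_fun setT h.
Proof.
apply/(measurable_restrictT _ (measurable_itv _)).
by apply: measurable_rayM; [exact: measurable_cst|].
Qed.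

Let h0 t : 0 <= h t.
Proof. by rewrite /h patchE; case: ifP => // _; rewrite !mulr_ge0 ?pi_ge0. Qed.

Let hE t : 0 < t -> h t = 2 * pi * g t.
Proof. by move=> t0; rewrite /h patchE mem_set //= in_itv /= t0. Qed.

Let H (p : R * R) := h p.2 * expR (- (2 * ((p.1 + e) / l) * p.2)).

Let H0 p : 0 <= H p.
Proof. by rewrite mulr_ge0 ?expR_ge0. Qed.

Let mH : measurable_fun setT H.
Proof.
apply: measurable_funM; first exact: measurable_sndR.
apply: (@measurableT_comp _ _ _ _ _ _ (@expR R)); first exact: measurable_expR.
apply: measurableT_comp; first exact: oppr_measurable.
apply: measurable_funM; last exact: measurable_snd.
apply: measurable_funM; first exact: measurable_cst.
apply: measurable_funM; last exact: measurable_cst.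
by apply: measurable_funD; [exact: measurable_fst|exact: measurable_cst].
Qed.

Let HE r t : 0 < t -> 2 * pi * g t * expR (- (2 * ((r + e) / l) * t)) = H (r, t).
Proof. by move=> t0; rewrite /H /= hE. Qed.

(** Integrating [expR (- (2 * (r / l) * t))] over [nu] produces the weight at [t / l]. The isometry
    uses [l = 1], the composition bound the angular derivative. *)
Lemma weight_tonelli :
  (\int[nu]_(r in D) \int[mu]_(t in T) (2 * pi * g t * expR (- (2 * ((r + e) / l) * t)))%:E =
   \int[mu]_(t in T) (expR (- (2 * (e / l) * t)) * (g t * zen_weight nu (t / l)))%:E)%E.
Proof.
transitivity (\int[nu]_(r in D) \int[mu]_(t in T) (H (r, t))%:E)%E.
  by apply: eq_integral => r _; apply: eq_integral_ray => t t0; rewrite HE.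
rewrite (zen_tonelli mH H0); apply: eq_integral_ray => t t0.
have tl0 : 0 < t / l by rewrite divr_gt0.
rewrite (EFinM _ (_ * _)%R) (EFinM _ (zen_weight _ _)) (zen_weightE hnu tl0) /decay_integral.
have k0 : (0 <= (h t * expR (- (2 * (e / l) * t)))%:E)%E by rewrite lee_fin mulr_ge0 ?expR_ge0.
transitivity ((h t * expR (- (2 * (e / l) * t)))%:E * decay_integral nu (t / l))%E.
  rewrite /decay_integral -(ge0_integralZl nu mD (measurable_decay (t / l)) _ k0); last first.
    by move=> r _; rewrite lee_fin expR_ge0.
  apply: eq_integral => r _; rewrite /H -EFinM; congr EFin.
  rewrite -[RHS]mulrA; congr (_ * _); rewrite -expRD; congr expR => /=; field; exact: lt0r_neq0.
rewrite hE // !muleA -!EFinM -/(decay_integral nu (t / l)); congr (_%:E * _)%E; ring.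
Qed.

Lemma measurable_weight_section : measurable_fun D (fun r : R =>
  \int[mu]_(t in T) (2 * pi * g t * expR (- (2 * ((r + e) / l) * t)))%:E)%E.
Proof.
pose K (p : R * R) := (H p * \1_T p.2)%:E.
have K0 p : (0 <= K p)%E by rewrite lee_fin !mulr_ge0.
have mK : measurable_fun setT K.
  apply/measurable_EFinP; apply: measurable_funM => //.
  by apply: measurable_sndR; apply: measurable_indic; exact: measurable_itv.
have := @measurable_fun_fubini_tonelli_F _ _ _ _ _ mu K mK K0 => HK.
apply: measurable_funTS; apply: eq_measurable_fun HK => r _; rewrite /fubini_F.
rewrite [RHS]integral_mkcond; apply: eq_integral => t _; rewrite patchE /K /= indicE.
case: ifPn => [|_]; last by rewrite mulr0.
by rewrite inE /= in_itv /= andbT => t0; rewrite mulr1 HE.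
Qed.

End WeightTonelli.

(** The double integral of [zen_norm] at shift [e] in iterated form, to which Plancherel applies
    line by line. *)
Definition zen_slices (F : C -> C) (e : R) : \bar R :=
  (\int[nu]_(r in D) \int[mu]_y (modulus (F ((r + e) +i* y)) ^+ 2)%:E)%E.

Lemma sqre_poweR_half (x : \bar R) : (0 <= x)%E -> ((x `^ 2^-1) ^+ 2 = x)%E.
Proof.
case: x => [r| |] //; last by move=> _; rewrite poweRyr ?invr_eq0 // expe2 mulyy.
by rewrite lee_fin => r0; rewrite poweR_EFin -EFin_expe powR12_sqrt // sqr_sqrtr.
Qed.

Lemma zen_norm_ge0 F : (0 <= zen_norm nu F)%E.
Proof. exact: poweR_ge0. Qed.

Lemma zen_slicesE F e : (forall z, 0 < Re z -> cderivable F z) -> 0 < e ->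
  (\int[nu \x mu]_(p in D `*` setT) (modulus (F ((p.1 + e) +i* p.2)) ^+ 2)%:E = zen_slices F e)%E.
Proof.
move=> dF e0.
rewrite (@zen_product_integral (fun p => modulus (F ((p.1 + e) +i* p.2)) ^+ 2)) //.
  apply: (measurable_funS _ _ (measurable_sqr_modulus2 dF)).
    by apply: measurable_open2 => p pe; exists (p.1 + e); [move: pe => /=; lra|
       move=> q + _; rewrite /= ltr_norml => /andP[]; lra].
  by move=> p [/=]; rewrite in_itv /= andbT => p0 _; lra.
by move=> p; rewrite sqr_ge0.
Qed.

Lemma zen_norm_sqr F : (forall z, 0 < Re z -> cderivable F z) ->
  (zen_norm nu F ^+ 2 = ereal_sup [set zen_slices F e | e in [set e : R | (0 < e)%R]])%E.
Proof.
move=> dF; rewrite /zen_norm sqre_poweR_half.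
  by congr ereal_sup; apply/seteqP; split=> _ [e e0 <-]; exists e => //; rewrite zen_slicesE.
apply: (@le_trans _ _ (\int[nu \x mu]_(p in D `*` setT) (modulus (F ((p.1 + 1) +i* p.2)) ^+ 2)%:E)%E).
  by apply: integral_ge0 => p _; rewrite lee_fin sqr_ge0.
by apply: ereal_sup_ubound; exists 1 => //=.
Qed.

Lemma eq_zen_norm F G : (forall z, 0 < Re z -> F z = G z) -> zen_norm nu F = zen_norm nu G.
Proof.
move=> FG; rewrite /zen_norm; congr ((ereal_sup _) `^ _)%E; apply: eq_imagel => e /= e0.
apply: eq_integral => p; rewrite inE /= in_itv /= andbT => -[p0 _].
by rewrite FG //=; lra.
Qed.

Variable f : R -> C.
Hypothesis fw : weighted_L2 (zen_weight nu) f.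

Lemma weighted_cmeasurable : cmeasurable f.
Proof. by case: fw. Qed.

Let mmod := measurable_modulus weighted_cmeasurable.

Let mexp := @measurable_expRN R.

Let mweight : measurable_fun T (fun t => modulus (f t) ^+ 2 * zen_weight nu t).
Proof.
apply: measurable_rayM; last exact: measurable_zen_weight hnu _.
exact: measurable_rayX.
Qed.

Lemma weighted_energy d : 0 < d ->
  (\int[mu]_(t in T) (modulus (f t) ^+ 2 * expR (- (d * t)))%:E < +oo)%E.
Proof.
move=> d0; have [c c0 Hc] := zen_weight_lower hnu d0.
have [mre mim fin] := fw.
apply: (@le_lt_trans _ _ (c^-1%:E * \int[mu]_(t in T) (modulus (f t) ^+ 2 * zen_weight nu t)%:E)%E); last first.
  by apply: lte_mul_pinfty => //; rewrite lee_fin invr_ge0 ltW.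
rewrite -integral_rayZ ?invr_ge0 ?(ltW c0) //; last first.
  by move=> t t0; rewrite mulr_ge0 ?sqr_ge0 // ltW // (zen_weight_gt0 hnu).
apply: le_integral_ray.
- by apply: measurable_rayM => //; exact: measurable_rayX.
- by apply: measurable_rayM => //; exact: measurable_cst.
- by move=> t _; rewrite mulr_ge0 ?sqr_ge0 ?expR_ge0.
move=> t t0; rewrite mulrCA ler_wpM2l ?sqr_ge0 //.
by rewrite ler_pdivlMl // Hc.
Qed.

Lemma weighted_cderivable z : 0 < Re z -> cderivable (laplace f) z.
Proof. by apply: laplace_cderivable; [exact: weighted_cmeasurable|exact: weighted_energy]. Qed.

Lemma laplace_slices e : 0 < e -> (zen_slices (laplace f) e =
  \int[mu]_(t in T) (expR (- (2 * e * t)) * (modulus (f t) ^+ 2 * zen_weight nu t))%:E)%E.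
Proof.
move=> e0; have mf2 : measurable_fun T (fun t => modulus (f t) ^+ 2) by exact: measurable_rayX.
transitivity (\int[nu]_(r in D) \int[mu]_(t in T)
    (2 * pi * modulus (f t) ^+ 2 * expR (- (2 * ((r + e) / 1) * t)))%:E)%E.
  apply: eq_integral => r; rewrite inE /= in_itv /= andbT => r0.
  have re0 : 0 < r + e by rewrite ltr_wpDl.
  rewrite (laplace_plancherel weighted_cmeasurable weighted_energy re0) divr1.
  rewrite -integral_rayZ ?mulr_ge0 ?pi_ge0 //.
  - by apply: eq_integral_ray => t t0; rewrite mulrA.
  - exact: measurable_rayM.
  - by move=> t _; rewrite mulr_ge0 ?sqr_ge0 ?expR_ge0.
rewrite (weight_tonelli e mf2 (fun t => sqr_ge0 _) ltr01).
by apply: eq_integral_ray => t t0; rewrite !divr1.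
Qed.

(** By Plancherel the slice at [e] is the weighted integral damped by [expR (- (2 * e * t))], so the
    supremum over [e] is its monotone limit along [n.+1%:R^-1]. *)
Lemma zen_norm_laplace :
  (zen_norm nu (laplace f) ^+ 2 = \int[mu]_(t in T) (modulus (f t) ^+ 2 * zen_weight nu t)%:E)%E.
Proof.
have w0 t : 0 < t -> 0 <= modulus (f t) ^+ 2 * zen_weight nu t.
  by move=> t0; rewrite mulr_ge0 ?sqr_ge0 // ltW // (zen_weight_gt0 hnu).
rewrite (zen_norm_sqr weighted_cderivable); apply/eqP; rewrite eq_le; apply/andP; split.
  apply: ge_ereal_sup => _ [e /= e0 <-]; rewrite laplace_slices //; apply: le_integral_ray => //.
  - exact: measurable_rayM.
  - by move=> t t0; rewrite mulr_ge0 ?expR_ge0 ?w0.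
  - move=> t t0; rewrite ler_piMl ?w0 // expR_le1 oppr_le0 !mulr_ge0 // ltW //.
pose g n t := expR (- (2 * n.+1%:R^-1 * t)) * (modulus (f t) ^+ 2 * zen_weight nu t).
have e0 n : 0 < n.+1%:R^-1 :> R by rewrite invr_gt0 ltr0n.
have gcvg : (\int[mu]_(t in T) (g n t)%:E @[n --> \oo] -->
    \int[mu]_(t in T) (modulus (f t) ^+ 2 * zen_weight nu t)%:E)%E.
  apply: monotone_ray_cvg.
  - by move=> n; exact: measurable_rayM.
  - by move=> n t t0; rewrite mulr_ge0 ?expR_ge0 ?w0.
  - move=> t t0 n m nm; rewrite ler_wpM2r ?w0 // ler_expR lerN2 ler_wpM2r ?(ltW t0) //.
    by rewrite ler_wpM2l // lef_pV2 ?posrE ?ltr0n // ler_nat ltnS.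
  move=> t t0; rewrite -[X in _ --> X]mul1r; apply: cvgM; last exact: cvg_cst.
  rewrite -[X in _ --> X]expR0 -oppr0.
  apply: (@cvg_comp _ _ _ (fun n => - (2 * n.+1%:R^-1 * t)) (@expR R)); last exact: continuous_expR.
  apply: cvgN; rewrite -[X in _ --> X](mul0r t); apply: cvgM; last exact: cvg_cst.
  by rewrite -[X in _ --> X](mulr0 2); apply: cvgM; [exact: cvg_cst|exact: cvg_harmonic].
rewrite -(cvg_lim _ gcvg) //; apply: lime_le; first by apply/cvg_ex; eexists; exact: gcvg.
apply: nearW => n; rewrite -laplace_slices //.
by apply: ereal_sup_ubound; exists n.+1%:R^-1 => /=.
Qed.

Lemma zen_space_laplace : zen_space nu (laplace f).
Proof.
split; first by move=> z; exact: weighted_cderivable.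
have := zen_norm_laplace; have [_ _ fin] := fw; move: fin.
have := zen_norm_ge0 (laplace f); case: (zen_norm _ _) => // [r|] _ fin E; first by rewrite ltry.
by move: fin; rewrite -E expe2 mulyy.
Qed.

End ZenNorm.

(** * Subordination of line integrals under composition *)

Section LineSubordination.
Variable R : realType.
Local Notation C := R[i].
Local Notation mu := (@lebesgue_measure R).

Lemma eq_integrable_setT (g h : R -> R) : (forall t, g t = h t) ->
  mu.-integrable setT (EFin \o g) -> mu.-integrable setT (EFin \o h).
Proof. by move=> /funext ->. Qed.

Let le_integralT (f g : R -> \bar R) : measurable_fun setT f -> measurable_fun setT g ->
  (forall t, 0 <= f t)%E -> (forall t, f t <= g t)%E -> (\int[mu]_t f t <= \int[mu]_t g t)%E.
Proof. by move=> mf mg f0 fg; apply: ge0_le_integral. Qed.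

Lemma continuous_line_modulus (F : C -> C) (a : R) : (forall u, cderivable F (a +i* u)) ->
  continuous (fun u : R => modulus (F (a +i* u)) ^+ 2).
Proof.
move=> dF u.
have [cR _] := cderivable_continuous_line (@Re_lipschitz R) (dF u).
have [cI _] := cderivable_continuous_line (@Im_lipschitz R) (dF u).
rewrite (_ : (fun u => _) = fun u : R => Re (F (a +i* u)) ^+ 2 + Im (F (a +i* u)) ^+ 2); last first.
  by apply/funext => t; rewrite sqr_modulus.
apply: cvgD; under eq_fun do rewrite expr2; rewrite expr2.
  by apply: cvgM; exact: cR.
by apply: cvgM; exact: cI.
Qed.

Section SubharmonicMean.
Variables (F : C -> C) (b K a : R).
Hypothesis dF : forall w, b < Re w -> cderivable F w.
Hypothesis FK : forall w, b < Re w -> modulus (F w) <= K.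
Hypothesis ba : b < a.

Let K0 : 0 <= K.
Proof. by apply: le_trans (modulus_ge0 _) (@FK (a%:C) _). Qed.

(* Apply the Poisson formula to conj(F z)^2 F^2, whose value at z is |F z|^4. *)
Lemma sqr_modulus_le_poisson z : a < Re z ->
  ((pi * modulus (F z) ^+ 2)%:E <=
   \int[mu]_u (modulus (F (a +i* u)) ^+ 2 * poisson_kernel (Re z - a) (u - Im z))%:E)%E.
Proof.
move=> az; have c0 : 0 < Re z - a by rewrite subr_gt0.
pose A := modulus (F z) ^+ 2; have A0 : 0 <= A by rewrite sqr_ge0.
pose k := (F z)^*c ^+ 2.
have mk : modulus k = A by rewrite /k modulusX modulus_conj.
pose h w := k * (F w * F w).
have dh w : b < Re w -> cderivable h w.
  move=> bw; apply: cderivableM; first exact: cderivable_cst.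
  by apply: cderivableM; exact: dF.
have hK w : b < Re w -> modulus (h w) <= A * (K * K).
  move=> bw; rewrite /h modulusM mk (modulusM (F w)) ler_wpM2l // ler_pM ?modulus_ge0 //; exact: FK.
have hz : Re (h z) = A ^+ 2.
  have -> : h z = ((F z) * (F z)^*c) ^+ 2 by rewrite /h /k; ring.
  have -> : F z * (F z)^*c = A%:C.
    by apply: complex_ext; rewrite !ReE ?Re_conj ?Im_conj /= /A ?sqr_modulus; ring.
  by rewrite -rmorphXn.
have mF2 : measurable_fun setT (fun u : R => modulus (F (a +i* u)) ^+ 2).
  by apply: continuous_measurable_fun; apply: continuous_line_modulus => u; exact: dF.
have F2K u : `|modulus (F (a +i* u)) ^+ 2| <= K ^+ 2.
  by rewrite ger0_norm ?sqr_ge0 // ler_pXn2r ?nnegrE ?modulus_ge0 // FK.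
have Fi := integrable_mul_poisson_kernel (Im z) c0 mF2 F2K.
have Fi2 := integrable_funZ A Fi measurableT.
have mh : measurable_fun setT (fun u : R => Re (h (a +i* u))).
  apply: continuous_measurable_fun => u.
  by have [] := cderivable_continuous_line (f := @complex.Re R) (@Re_lipschitz R) (dh _ (ba : b < Re (a +i* u))).
have hi := integrable_mul_poisson_kernel (Im z) c0 mh (fun u => le_trans (normRe_le _) (hK _ (ba : b < Re (a +i* u)))).
have P := poisson_line dh hK ba az; rewrite hz in P.
rewrite -EFin_Rintegral // lee_fin; set I := \int[mu]_u _.
have : pi * A ^+ 2 <= A * I.
  rewrite -P -RintegralZl //; apply: le_Rintegral => // u _.
  rewrite mulrA ler_wpM2r ?poisson_kernel_ge0 //.
  by apply: le_trans (Re_le _) _; rewrite /h modulusM mk (modulusM (F _)) expr2.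
rewrite -/A; move: A0; rewrite le_eqVlt => /orP[/eqP <- _|A0]; last first.
  by rewrite expr2 mulrCA ler_pM2l.
by rewrite mulr0 Rintegral_ge0 // => u _; rewrite mulr_ge0 ?sqr_ge0 ?poisson_kernel_ge0.
Qed.

End SubharmonicMean.

Section Subordination.
Variables (phi : C -> C) (l : R).
Hypothesis dphi : forall z, 0 < Re z -> cderivable phi z.
Hypothesis phi_gt0 : forall z, 0 < Re z -> 0 < Re (phi z).
Hypothesis l0 : 0 < l.
Hypothesis ad : angular_derivative phi l%:C.

Variables (x a : R).
Hypothesis x0 : 0 < x.
Hypothesis a0 : 0 < a.
Hypothesis ax : a < x / l.

Let Re_phi_gt w : l * a < Re w -> a < Re (phi w).
Proof.
move=> lw; have w0 : 0 < Re w by apply: lt_trans lw; exact: mulr_gt0.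
apply: lt_le_trans (julia_ge dphi phi_gt0 l0 ad w0).
by rewrite ltr_pdivlMr // mulrC.
Qed.

Let lax : l * a < x.
Proof. by rewrite mulrC -ltr_pdivlMr. Qed.

Let kern y u := poisson_kernel (Re (phi (x +i* y)) - a) (u - Im (phi (x +i* y))).

Let gap_gt0 y : 0 < Re (phi (x +i* y)) - a.
Proof. by rewrite subr_gt0 Re_phi_gt. Qed.

Let kern_ge0 y u : 0 <= kern y u.
Proof. exact: poisson_kernel_ge0. Qed.

Let kernE y u : kern y u = Re (phi (x +i* y) - (a +i* u))^-1.
Proof.
rewrite ReV /kern /poisson_kernel sqr_modulus !ReE /=; congr (_ / (_ + _)).
by rewrite -sqrrN opprB.
Qed.

(** For fixed [u] the kernel is the real part of [h = (phi - (a + i u))^-1] on the line [Re = x].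
    Its integral is the limit, as [s] grows, of [s] times the Poisson integral at [x + s], which
    equals [pi * s * Re (h (x + s))]. *)
Lemma integral_kern_le u : (\int[mu]_y (kern y u)%:E <= (pi * l)%:E)%E.
Proof.
(* A point between [l * a] and [x]: to the right of it [Re (phi - c)] is at least [d > 0], so [h] is
   bounded on a half-plane larger than [Re > x]. *)
pose b := (l * a + x) / 2; have bx : b < x by rewrite /b; have := lax; lra.
have lab : l * a < b by rewrite /b; have := lax; lra.
pose d := b / l - a; have d0 : 0 < d by rewrite /d subr_gt0 ltr_pdivlMr // mulrC.
have b0 : 0 < b by apply: lt_trans lab; exact: mulr_gt0.
pose c : C := a +i* u; pose h w := (phi w - c)^-1.
have Rd w : b < Re w -> d <= Re (phi w - c).
  move=> bw; have w0 := lt_trans b0 bw.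
  rewrite !ReE /= lerB //; apply: le_trans (julia_ge dphi phi_gt0 l0 ad w0).
  by rewrite ler_wpM2r ?invr_ge0 // ltW.
have dh w : b < Re w -> cderivable h w.
  move=> bw; apply: cderivableV.
    by apply: Re_gt0_neq0; apply: lt_le_trans (Rd _ bw).
  apply: cderivableD; first exact: dphi (lt_trans b0 bw).
  by apply: cderivableN; exact: cderivable_cst.
have hK w : b < Re w -> modulus (h w) <= d^-1.
  move=> bw; have := le_trans (Rd _ bw) (Re_le _) => dm.
  by rewrite modulusV lef_pV2 ?posrE //; apply: lt_le_trans dm.
have kE y : kern y u = Re (h (x +i* y)) by exact: kernE.
have mk : measurable_fun setT (fun y => kern y u).
  rewrite (_ : (fun y => _) = fun y => Re (h (x +i* y))); last by apply/funext => y; exact: kE.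
  apply: continuous_measurable_fun => y.
  by have [] := cderivable_continuous_line (f := @complex.Re R) (@Re_lipschitz R) (dh _ (bx : b < Re (x +i* y))).
pose s n : R := n.+1%:R; have s0 n : 0 < s n by rewrite ltr0n.
have hi n : mu.-integrable setT (EFin \o (fun y => kern y u * poisson_kernel (s n) (y - 0))).
  apply: (integrable_mul_poisson_kernel 0 (s0 n) mk (K := d^-1)) => y.
  by rewrite kE; apply: le_trans (normRe_le _) (hK _ _).
have P n : (\int[mu]_y (kern y u * (s n * poisson_kernel (s n) y))%:E =
    (pi * (s n * Re (h ((x + s n)%:C))))%:E)%E.
  have xs : x < Re ((x + s n)%:C) by rewrite /= ltrDl.
  have := poisson_line dh hK bx xs; rewrite /= (addrC x) addrK => PE.
  rewrite mulrCA -PE -RintegralZl //; last first.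
    by apply: eq_integrable_setT (hi n) => y; rewrite subr0 kE.
  rewrite EFin_Rintegral //; last first.
    by apply: eq_integrable_setT (integrable_funZ (s n) (hi n) measurableT) => y; rewrite kE.
  by apply: eq_integral => y _; rewrite kE subr0 mulrCA.
(* Julia's lemma bounds [modulus (h (x + s))] by the inverse of [(x + s) / l - a], and [s] times
   that inverse is at most [l] because [l * a < x]. *)
have Pl n : pi * (s n * Re (h ((x + s n)%:C))) <= pi * l.
  rewrite ler_wpM2l ?pi_ge0 //.
  have z0 : 0 < Re ((x + s n)%:C) by rewrite /= addr_gt0.
  have m : (x + s n) / l - a <= modulus (phi (x + s n)%:C - c).
    apply: le_trans (Re_le _); rewrite !ReE /= lerB //.
    exact: (julia_ge dphi phi_gt0 l0 ad z0).
  have den : 0 < (x + s n) / l - a.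
    by rewrite subr_gt0 ltr_pdivlMr // mulrC; apply: lt_trans lax _; rewrite ltrDl.
  apply: (@le_trans _ _ (s n * ((x + s n) / l - a)^-1)).
    rewrite ler_wpM2l ?(ltW (s0 n)) //; apply: le_trans (Re_le _) _.
    by rewrite modulusV lef_pV2 ?posrE //; exact: lt_le_trans m.
  rewrite ler_pdivrMr // mulrBr mulrCA divff ?lt0r_neq0 // mulr1.
  by have := lax; have := s0 n; lra.
have kern0 y : 0 <= kern y u by exact: kern_ge0.
have cv := cvg_integral_poisson_kernel mk kern0.
rewrite -(cvg_lim _ cv) //; apply: lime_le; first by apply/cvg_ex; eexists; exact: cv.
by apply: nearW => n; rewrite P lee_fin.
Qed.

Variable F : C -> C.
Hypothesis dF : forall w, 0 < Re w -> cderivable F w.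
Hypothesis F_bounded : forall d, 0 < d -> exists K, forall w, d <= Re w -> modulus (F w) <= K.

(** Integrate [sqr_modulus_le_poisson] at [phi (x +i* y)] over [y]. Tonelli leaves, for each [u],
    the total kernel mass in [y], which [integral_kern_le] bounds by [pi * l]. *)
Lemma line_subordination :
  (\int[mu]_y (modulus (F (phi (x +i* y))) ^+ 2)%:E <=
   l%:E * \int[mu]_u (modulus (F (a +i* u)) ^+ 2)%:E)%E.
Proof.
have a20 : 0 < a / 2 by rewrite divr_gt0.
have [K FK] := F_bounded a20.
have a2a : a / 2 < a by rewrite ltr_pdivrMr // ltr_pMr // ltr1n.
have dF2 w : a / 2 < Re w -> cderivable F w by move=> aw; apply: dF; exact: lt_trans aw.
have FK2 w : a / 2 < Re w -> modulus (F w) <= K by move=> /ltW; exact: FK.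
have line y : {for y, continuous (fun t : R => Re (phi (x +i* t)))} /\ {for y, continuous (fun t : R => Im (phi (x +i* t)))}.
  have xy : 0 < Re (x +i* y) by [].
  have [cR _] := cderivable_continuous_line (f := @complex.Re R) (@Re_lipschitz R) (dphi xy).
  by have [cI _] := cderivable_continuous_line (f := @complex.Im R) (@Im_lipschitz R) (dphi xy).
pose g y := Re (phi (x +i* y)) - a; pose k y := Im (phi (x +i* y)).
have mg : measurable_fun setT g.
  apply: measurable_funB; last exact: measurable_cst.
  by apply: continuous_measurable_fun => y; have [] := line y.
have mk : measurable_fun setT k by apply: continuous_measurable_fun => y; have [] := line y.
pose N u := modulus (F (a +i* u)) ^+ 2.
have mN : measurable_fun setT N by apply: continuous_measurable_fun; apply: continuous_line_modulus => u; exact: dF.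
have N0 u : 0 <= N u by rewrite sqr_ge0.
have mkern : measurable_fun setT (fun p : R * R => kern p.1 p.2).
  pose den (p : R * R) := g p.1 ^+ 2 + (p.2 - k p.1) ^+ 2.
  have den0 p : 0 < den p by rewrite ltr_wpDr ?sqr_ge0 // exprn_gt0 // gap_gt0.
  have mden : measurable_fun setT den.
    apply: measurable_funD; apply: measurable_funX; first exact: measurable_fstR.
    by apply: measurable_funB; [exact: measurable_snd|exact: measurable_fstR].
  have M : measurable_fun setT (fun p : R * R => g p.1 * (den p)^-1).
    apply: measurable_funM; first exact: measurable_fstR.
    exact: (measurable_invr_gt0 measurableT mden (fun p _ => den0 p)).
  exact: M.
pose J (p : R * R) := (N p.2 * kern p.1 p.2)%:E.
have J0 p : (0 <= J p)%E by rewrite lee_fin mulr_ge0.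
have mJ : measurable_fun setT J.
  by apply/measurable_EFinP; apply: measurable_funM => //; exact: measurable_sndR.
have mean y : ((pi * modulus (F (phi (x +i* y))) ^+ 2)%:E <= \int[mu]_u J (y, u))%E.
  by apply: (sqr_modulus_le_poisson dF2 FK2 a2a); exact: Re_phi_gt.
have mFphi : measurable_fun setT (fun y : R => modulus (F (phi (x +i* y))) ^+ 2).
  apply: continuous_measurable_fun.
  apply: (@continuous_line_modulus (F \o phi)) => u.
  by apply: cderivable_comp; [exact: dphi|apply: dF; exact: phi_gt0].
have pi0 : 0 < pi :> R by exact: pi_gt0.
have step : (pi%:E * \int[mu]_y (modulus (F (phi (x +i* y))) ^+ 2)%:E <=
    pi%:E * (l%:E * \int[mu]_u (N u)%:E))%E.
  rewrite (ge0_integralT_Zl (ltW pi0) mFphi); last by move=> y; rewrite sqr_ge0.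
  apply: (@le_trans _ _ (\int[mu]_y \int[mu]_u J (y, u))%E).
    apply: le_integralT => [| |y|y] //.
    - by apply/measurable_EFinP; apply: measurable_funM => //; exact: measurable_cst.
    - exact: (measurable_fun_fubini_tonelli_F (m2 := mu) J mJ J0).
    - by rewrite lee_fin mulr_ge0 ?sqr_ge0 // ltW.
  have pl0 : 0 <= pi * l by rewrite mulr_ge0 // ltW.
  rewrite (lebesgue_tonelli mJ J0) muleA -EFinM (ge0_integralT_Zl pl0 mN N0).
  apply: le_integralT => [| |u|u].
  - exact: (measurable_fun_fubini_tonelli_G (m1 := mu) J mJ J0).
  - by apply/measurable_EFinP; apply: measurable_funM => //; exact: measurable_cst.
  - exact: integral_ge0.
  rewrite -(ge0_integralT_Zl (N0 u) (measurable_section2 u mkern)); last by move=> y; exact: kern_ge0.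
  by rewrite (mulrC _ (N u)) (EFinM (N u)) lee_wpmul2l ?lee_fin //; exact: integral_kern_le.
by move: step; rewrite lee_pmul2l // lte_fin.
Qed.

End Subordination.
End LineSubordination.

(** * Dilations of the ray *)

Section RayScaling.
Variable R : realType.
Local Notation mu := (@lebesgue_measure R).
Local Notation T := (`]0, +oo[%classic : set R).

(** Lebesgue measure is [k] times its image under multiplication by [k]: the two agree on half-open
    intervals, which determine it. *)
Lemma ge0_integral_scale_ray (k : R) (f : R -> R) : 0 < k -> measurable_fun T f ->
  (forall t, 0 < t -> 0 <= f t) ->
  (\int[mu]_(t in T) (f t)%:E = k%:E * \int[mu]_(t in T) (f (k * t))%:E)%E.
Proof.
move=> k0 mf f0.
pose s : measurableTypeR R -> measurableTypeR R := *%R k.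
have ms : measurable_fun [set: measurableTypeR R] s.
  by apply: measurable_funM; [exact: measurable_cst|exact: measurable_id].
have [m mE] : exists m : {measure set (measurableTypeR R) -> \bar R},
    (m : set (measurableTypeR R) -> \bar R) = pushforward mu s.
  by unshelve eexists (pushforward mu s : {measure set (measurableTypeR R) -> \bar R}); [exact: ms|].
pose mk : {measure set (measurableTypeR R) -> \bar R} := mscale (NngNum (ltW k0)) m.
have muE (A : set R) : measurable (A : set (measurableTypeR R)) -> mu A = mk A.
  apply: lebesgue_measure_unique => _ [[a b] _ <-].
  transitivity (k%:E * m `](a, b).1, (a, b).2]%classic)%E; last by [].
  have -> : m `](a, b).1, (a, b).2]%classic = mu (s @^-1` `]a, b]) by rewrite mE.
  have -> : s @^-1` `]a, b] = `](k^-1 * a), (k^-1 * b)]%classic.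
    by apply/seteqP; split=> x; rewrite /= !in_itv /= /s ltr_pdivrMl // ler_pdivlMl.
  rewrite !lebesgue_measure_itv /= !lte_fin ltr_pM2l ?invr_gt0 //.
  case: ifP => _; last by rewrite mule0.
  by rewrite -!EFinD -EFinM; congr EFin; field; exact: lt0r_neq0.
have mT : measurable (T : set (measurableTypeR R)) by exact: measurable_itv.
have f0' (t : measurableTypeR R) : T t -> (0 <= (f t)%:E)%E.
  by rewrite /= in_itv /= andbT => t0; rewrite lee_fin f0.
transitivity (\int[mk]_(t in T) (f t)%:E)%E.
  by apply: eq_measure_integral => A mA _; exact: muE.
rewrite ge0_integral_mscale //; last exact/measurable_EFinP.
congr (_ * _)%E; rewrite mE ge0_integral_pushforward //; last 2 first.
- exact/measurable_EFinP.
- by move=> t; rewrite inE => /f0'.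
have -> : s @^-1` T = T; last by [].
by apply/seteqP; split=> x; rewrite /= !in_itv /= !andbT /s pmulr_rgt0.
Qed.

End RayScaling.

(** * Reproducing kernels and the inequality they give *)

Section KernelInequality.
Variable R : realType.
Local Notation C := R[i].
Local Notation mu := (@lebesgue_measure R).
Local Notation T := (`]0, +oo[%classic : set R).
Variable nu : {measure set (measurableTypeR R) -> \bar R}.
Hypothesis hnu : zen_measure nu.
Local Notation w := (zen_weight nu).

Let mT : measurable T.
Proof. exact: measurable_itv. Qed.

Let mexp := @measurable_expRN R.

Let minv k : 0 < k -> measurable_fun T (fun t => (w (t / k))^-1).
Proof.
move=> k0; apply: measurable_invr_gt0 => // [|t]; first exact: measurable_zen_weight_div.
by rewrite /= in_itv /= andbT => t0; apply: zen_weight_gt0; rewrite ?divr_gt0.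
Qed.

Let minv1 : measurable_fun T (fun t => (w t)^-1).
Proof.
have := minv ltr01; have -> : (fun t => (w (t / 1))^-1) = fun t => (w t)^-1; last by [].
by apply/funext => t; rewrite divr1.
Qed.

(** For [Re p = x] this is [|exp (- t conj p) / w t|^2 * w t], where [exp (- t conj p) / w t] is the
    function whose Laplace transform is the reproducing kernel at [p]. *)
Definition reproducing_density (x t : R) : R := expR (- (2 * x * t)) / w t.

Lemma measurable_reproducing_density x : measurable_fun T (reproducing_density x).
Proof. by apply: measurable_rayM; [exact: mexp|exact: minv1]. Qed.

Lemma reproducing_density_ge0 x t : 0 < t -> 0 <= reproducing_density x t.
Proof. by move=> t0; rewrite divr_ge0 ?expR_ge0 // ltW // (zen_weight_gt0 hnu). Qed.

Lemma reproducing_density_integrable x : 0 < x ->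
  mu.-integrable T (EFin \o reproducing_density x).
Proof.
move=> x0; have [c c0 Hc] := zen_weight_lower hnu x0.
apply: (integrable_ray_le _ (integrable_funZ c^-1 (integrable_expR x0) mT)).
  exact: measurable_reproducing_density.
move=> t t0; rewrite ger0_norm ?reproducing_density_ge0 // /reproducing_density.
have wt := zen_weight_gt0 hnu t0.
rewrite ler_pdivrMr // -(mulrA c^-1) ler_pdivlMl //.
have -> : - (2 * x * t) = - (x * t) + - (x * t) by ring.
by rewrite expRD mulrCA ler_wpM2l ?expR_ge0 // Hc.
Qed.

(* kappa x is the value at z = p, with Re p = x, of the reproducing kernel of A^2_nu at p. *)
Definition reproducing_diagonal x : R := \int[mu]_(t in T) reproducing_density x t.

Local Notation kappa := reproducing_diagonal.

Lemma reproducing_diagonalE x : 0 < x ->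
  ((kappa x)%:E = \int[mu]_(t in T) (reproducing_density x t)%:E)%E.
Proof. by move=> x0; rewrite EFin_Rintegral //; exact: reproducing_density_integrable. Qed.

Lemma reproducing_diagonal_gt0 x : 0 < x -> 0 < kappa x.
Proof.
move=> x0; rewrite -lte_fin reproducing_diagonalE //.
have w1 := zen_weight_gt0 hnu ltr01.
pose c := expR (- (4 * x)) / w 1; have c0 : 0 < c by rewrite divr_gt0 ?expR_gt0.
pose I : R -> R := \1_(`[1, 2]%classic : set R).
have mI : measurable_fun T I by apply: measurable_indic; exact: measurable_itv.
have I1 : (\int[mu]_(t in T) (I t)%:E = 1)%E.
  transitivity (mu (`[1, 2]%classic `&` T)).
    by apply: (@integral_indic _ (measurableTypeR R) R mu T mT); exact: measurable_itv.
  rewrite setIidl; last first.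
    by move=> t; rewrite /= !in_itv /= => /andP[t1 _]; rewrite andbT (lt_le_trans ltr01).
  have m12 : mu `[1, 2] = 1%:E :> \bar R.
    by rewrite lebesgue_measure_itv /= lte_fin ltr1n -EFinD; congr EFin; lra.
  exact: m12.
apply: (@lt_le_trans _ _ (c%:E * \int[mu]_(t in T) (I t)%:E)%E).
  by rewrite I1 mule1 lte_fin.
rewrite -integral_rayZ ?(ltW c0) //; apply: le_integral_ray.
- by apply: measurable_rayM; [exact: measurable_cst|exact: mI].
- exact: measurable_reproducing_density.
- by move=> t _; apply: mulr_ge0; [exact: ltW|].
move=> t t0; rewrite /I indicE; case: (boolP (t \in _)) => [|_]; last first.
  by rewrite mulr0; exact: reproducing_density_ge0.
rewrite inE /= in_itv /= => /andP[t1 t2]; rewrite mulr1.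
apply: ler_pM; [exact: expR_ge0|by rewrite invr_ge0 ltW|by rewrite ler_expR lerN2; nra|].
rewrite lef_pV2; [|exact: w1|exact: zen_weight_gt0].
exact: zen_weight_nincr.
Qed.

Lemma reproducing_diagonal_scale B x : 0 < B -> 0 < x ->
  ((kappa (B * x))%:E = B^-1%:E * \int[mu]_(t in T) (expR (- (2 * x * t)) / w (t / B))%:E)%E.
Proof.
move=> B0 x0; have Bi0 : 0 < B^-1 by rewrite invr_gt0.
rewrite reproducing_diagonalE ?mulr_gt0 //.
rewrite (ge0_integral_scale_ray Bi0 (measurable_reproducing_density _)); last first.
  by move=> t t0; exact: reproducing_density_ge0.
have E : (\int[mu]_(t in T) (reproducing_density (B * x) (B^-1 * t))%:E =
    \int[mu]_(t in T) (expR (- (2 * x * t)) / w (t / B))%:E)%E.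
  apply: eq_integral_ray => t t0; rewrite /reproducing_density (mulrC B^-1).
  by congr (expR (- _) / _)%:E; field; exact: lt0r_neq0.
by rewrite E.
Qed.

(** Rescaling [t] in [kappa (B * x)] moves the dilation from the exponential to the weight, where
    the hypothesis compares integrands. The case [a = 1] serves the existence of the angular
    derivative, a value near the infimum serves the lower norm bound. *)
Lemma reproducing_diagonal_dilate a B x : 0 <= a -> 0 < B -> 0 < x ->
  (forall t, 0 < t -> a * w (t / B) <= w t) -> a * kappa x <= B * kappa (B * x).
Proof.
move=> a0 B0 x0 H.
rewrite -lee_fin (EFinM B) (reproducing_diagonal_scale B0 x0) muleA -EFinM divff ?lt0r_neq0 // mul1e.
rewrite EFinM (reproducing_diagonalE x0) -integral_rayZ //; last 2 first.
- exact: measurable_reproducing_density.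
- by move=> t t0; exact: reproducing_density_ge0.
apply: le_integral_ray.
- by apply: measurable_rayM; [exact: measurable_cst|exact: measurable_reproducing_density].
- by apply: measurable_rayM; [exact: mexp|exact: minv].
- by move=> t t0; apply: mulr_ge0 => //; exact: reproducing_density_ge0.
move=> t t0; rewrite /reproducing_density mulrCA; apply: ler_wpM2l; first exact: expR_ge0.
have tB : 0 < t / B by rewrite divr_gt0.
rewrite ler_pdivrMr; last exact: zen_weight_gt0.
by rewrite mulrC ler_pdivlMr ?H //; exact: zen_weight_gt0.
Qed.

Let Re_laplace (g : R -> C) z :
  Re (laplace g z) = \int[mu]_(t in T) Re (cexp (- (t%:C * z)) * g t).
Proof. by []. Qed.

Variable phi : C -> C.
Hypothesis phi_gt0 : forall z, 0 < Re z -> 0 < Re (phi z).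
Hypothesis hsurj : laplace_surjective nu.
Hypothesis phi_space : forall F, zen_space nu F -> zen_space nu (F \o phi).

(* Test on the normalised reproducing kernel at phi z; 2ab <= s a^2 + b^2 / s replaces Cauchy-Schwarz. *)
Lemma reproducing_diagonal_le N z : 0 < N ->
  (forall F, zen_space nu F -> (zen_norm nu F <= 1)%E -> (zen_norm nu (F \o phi) ^+ 2 <= N%:E)%E) ->
  0 < Re z -> kappa (Re (phi z)) <= N * kappa (Re z).
Proof.
move=> N0 HN z0; set p := phi z; have p0 : 0 < Re p by exact: phi_gt0.
have k0 := reproducing_diagonal_gt0 p0; set k := kappa (Re p) in k0 *.
pose q := Num.sqrt k; have q0 : 0 < q by rewrite sqrtr_gt0.
have qk : q ^+ 2 = k by rewrite sqr_sqrtr // ltW.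
(* The kernel at [p] has squared norm [kappa (Re p) = q ^+ 2], hence the division by [q]. *)
pose f t : C := cexp (- (t%:C * p^*c)) * (q^-1 / w t)%:C.
have wt t : 0 < t -> 0 < w t by exact: zen_weight_gt0.
have mf : cmeasurable f.
  apply: cmeasurableM; first exact: cmeasurable_cexp.
  by apply: cmeasurable_real; apply: measurable_rayM; [exact: measurable_cst|exact: minv1].
have fmod t : 0 < t -> modulus (f t) ^+ 2 * w t = k^-1 * reproducing_density (Re p) t.
  move=> t0; rewrite /f modulusM modulus_cexp modulus_real !ReE /= mul0r subr0.
  rewrite ger0_norm ?divr_ge0 ?invr_ge0 ?(ltW q0) ?(ltW (wt _ t0)) // /reproducing_density -qk.
  rewrite exprMn -expRM_natl (_ : 2%:R * - (t * Re p) = - (2 * Re p * t)); last by ring.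
  by field; rewrite !lt0r_neq0 ?wt.
have f2 : (\int[mu]_(t in T) (modulus (f t) ^+ 2 * w t)%:E = 1)%E.
  rewrite (eq_integral_ray (g := fun t => (k^-1 * reproducing_density (Re p) t)%:E)); last first.
    by move=> t t0; rewrite fmod.
  rewrite integral_rayZ ?invr_ge0 ?(ltW k0) //.
  - by rewrite -reproducing_diagonalE // -EFinM mulVf // lt0r_neq0.
  - exact: measurable_reproducing_density.
  - by move=> t t0; exact: reproducing_density_ge0.
have fw : weighted_L2 w f by case: mf => m1 m2; split => //; rewrite f2 ltry.
have Fs := zen_space_laplace hnu fw.
have F1 : (zen_norm nu (laplace f) <= 1)%E.
  have := zen_norm_laplace hnu fw; rewrite f2; have := zen_norm_ge0 nu (laplace f).
  case: (zen_norm _ _) => [r| |] //.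
  rewrite lee_fin -EFin_expe => r0 [] r1; rewrite lee_fin -(@ler_pXn2r _ 2) ?nnegrE //.
  by rewrite r1 expr1n.
(* Surjectivity turns [F \o phi] into a transform [laplace g], and the isometry bounds the weighted
   norm of [g]. *)
have [g gw gE] := hsurj (phi_space Fs).
have gN : (\int[mu]_(t in T) (modulus (g t) ^+ 2 * w t)%:E <= N%:E)%E.
  rewrite -(zen_norm_laplace hnu gw) -(@eq_zen_norm R nu (laplace f \o phi) _ gE).
  exact: HN.
have value : Re (laplace f p) = q.
  rewrite Re_laplace.
  transitivity (\int[mu]_(t in T) (q^-1 * reproducing_density (Re p) t)).
    apply: eq_Rintegral => t Dt; have t0 : 0 < t by move: Dt; rewrite inE /= in_itv /= andbT.
    have ReMr (u : C) (r : R) : Re (u * r%:C) = Re u * r by rewrite ReM /= mulr0 subr0.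
    rewrite /f mulrA -cexpD ReMr Re_cexp !ReE /= !mul0r.
    rewrite !(subr0, addr0) mulrN opprK addNr cos0 mulr1.
    rewrite mulrCA /reproducing_density; congr (_ * (expR _ / _)); ring.
  rewrite RintegralZl //; last exact: reproducing_density_integrable.
  by rewrite -/(kappa _) -/k -qk expr2 mulrA mulVf ?mul1r // lt0r_neq0.
(* The minimiser of [s * N + s^-1 * kappa (Re z)] in the extremal case [q ^+ 2 = N * kappa (Re z)];
   in general it turns [H] into [q ^+ 2 <= N * kappa (Re z)]. *)
pose s := q / N; have s0 : 0 < s by rewrite divr_gt0.
have gwi : mu.-integrable T (EFin \o (fun t => modulus (g t) ^+ 2 * w t)).
  apply: ge0_integrable => //.
  - apply: measurable_rayM; last exact: measurable_zen_weight hnu _.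
    by apply: measurable_rayX; apply: measurable_modulus; case: gw.
  - move=> t; rewrite /= in_itv /= andbT => t0.
    by rewrite mulr_ge0 ?sqr_ge0 // ltW // wt.
  - by apply: le_lt_trans gN _; rewrite ltry.
have zi := reproducing_density_integrable z0.
have [gi _] := laplace_cintegrable (weighted_cmeasurable gw) (weighted_energy hnu gw) z0.
have H : 2 * q <= s * N + s^-1 * kappa (Re z).
  have -> : q = Re (laplace g z) by rewrite -value -(gE z z0).
  apply: (@le_trans _ _ (s * \int[mu]_(t in T) (modulus (g t) ^+ 2 * w t) + s^-1 * kappa (Re z))); last first.
    by rewrite lerD2r ler_wpM2l ?(ltW s0) // -lee_fin EFin_Rintegral.
  rewrite Re_laplace /reproducing_diagonal -!RintegralZl // -RintegralD //; [|exact: integrable_funZ..].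
  apply: le_Rintegral => //; [exact: integrable_funZ|apply: integrable_funD => //; exact: integrable_funZ|].
  move=> t Dt; have t0 : 0 < t by move: Dt; rewrite /= in_itv /= andbT.
  have h := Re_le (cexp (- (t%:C * z)) * g t); rewrite modulus_laplace_kernel in h.
  have := wt _ t0; set W := w t => W0; set m := modulus (g t) in h *.
  set E := expR _ in h; have -> : reproducing_density (Re z) t = E ^+ 2 / W.
    by rewrite /reproducing_density -expRM_natl; congr (expR _ / _); ring.
  have : 2 * (m * E) <= s * (m ^+ 2 * W) + s^-1 * (E ^+ 2 / W).
    have -> : s * (m ^+ 2 * W) + s^-1 * (E ^+ 2 / W) =
       2 * (m * E) + (s * W)^-1 * (s * W * m - E) ^+ 2 by field; rewrite !lt0r_neq0.
    by rewrite lerDl mulr_ge0 ?sqr_ge0 // invr_ge0 mulr_ge0 // ltW.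
  lra.
have : q * (2 * q) <= q * (s * N + s^-1 * kappa (Re z)) by rewrite ler_wpM2l // ltW.
have -> : q * (s * N + s^-1 * kappa (Re z)) = q ^+ 2 + N * kappa (Re z).
  by rewrite /s; field; rewrite !lt0r_neq0.
rewrite -qk !expr2; lra.
Qed.

End KernelInequality.

(** * Norm bounds for the composition operator *)

Section CompositionBounds.
Variable R : realType.
Local Notation C := R[i].
Local Notation mu := (@lebesgue_measure R).
Local Notation D := (`[0, +oo[%classic : set R).
Local Notation T := (`]0, +oo[%classic : set R).

Lemma sqre_le (x y : \bar R) : (0 <= x)%E -> (0 <= y)%E -> (x ^+ 2 <= y ^+ 2)%E -> (x <= y)%E.
Proof.
case: x => [x| |]; case: y => [y| |] //.
- by rewrite -!EFin_expe !lee_fin => x0 y0; rewrite ler_pXn2r ?nnegrE.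
- by move=> _ _ _; rewrite leey.
Qed.

Lemma sqre_homo (x y : \bar R) : (0 <= x)%E -> (x <= y)%E -> (x ^+ 2 <= y ^+ 2)%E.
Proof. by move=> x0 xy; rewrite !expe2 lee_pmul. Qed.

(** [F] is controlled only on the right half-plane, so the integrand is set to 0 elsewhere before
    Tonelli is applied. *)
Lemma measurable_line_section (F : C -> C) (e : R) : 0 < e ->
  (forall z, 0 < Re z -> cderivable F z) ->
  measurable_fun D (fun r : R => \int[mu]_y (modulus (F ((r + e) +i* y)) ^+ 2)%:E)%E.
Proof.
move=> e0 dF; pose A : set (R * R) := [set p | - e < p.1].
pose f (p : R * R) := (modulus (F ((p.1 + e) +i* p.2)) ^+ 2)%:E.
have mA : measurable A.
  apply: measurable_open2 => p pe; exists (p.1 + e); first by move: pe; rewrite /A /=; lra.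
  by move=> q + _; rewrite /A /= ltr_norml => /andP[]; lra.
have mf : measurable_fun A f by apply/measurable_EFinP; exact: measurable_sqr_modulus2.
have mK : measurable_fun setT (f \_ A) by apply/(measurable_restrictT _ mA).
have K0 p : (0 <= (f \_ A) p)%E by rewrite patchE; case: ifP => // _; rewrite lee_fin sqr_ge0.
have H := @measurable_fun_fubini_tonelli_F _ _ _ _ _ mu _ mK K0.
have HD : measurable_fun D (fubini_F mu (f \_ A)) by exact: measurable_funTS.
apply: eq_measurable_fun HD => r; rewrite inE => Dr.
have r0 : 0 <= r by move: Dr; rewrite /= in_itv /= andbT.
by apply: eq_integral => y _; rewrite patchE ifT // inE /A /=; lra.
Qed.

Variable nu : {measure set (measurableTypeR R) -> \bar R}.
Hypothesis hnu : zen_measure nu.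
Local Notation w := (zen_weight nu).

Let mD : measurable (D : set (measurableTypeR R)).
Proof. exact: measurable_itv. Qed.

(** Iterate the doubling bound [n] times with [l <= 2 ^+ n]; monotonicity of the weight fills the
    gap between [l] and [2 ^+ n]. *)
Lemma zen_weight_dilate l : 0 < l -> exists2 S, 0 < S & forall t, 0 < t -> w (t / l) <= S * w t.
Proof.
move=> l0; have [K K0 HK] := zen_weight_doubling hnu.
have pow n t : 0 < t -> w (t / 2 ^+ n) <= K ^+ n * w t.
  move=> t0; elim: n => [|n IH]; first by rewrite !expr0 divr1 mul1r.
  have p0 : 0 < 2 ^+ n :> R by exact: exprn_gt0.
  have -> : t / 2 ^+ n.+1 = t / 2 ^+ n / 2 by rewrite exprS; field; exact: lt0r_neq0.
  apply: (le_trans (HK (t / 2 ^+ n) (divr_gt0 t0 p0))).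
  by rewrite exprS -(mulrA K); apply: ler_wpM2l; [exact: ltW|exact: IH].
pose n := (Num.trunc l).+1.
have ln : l <= 2 ^+ n.
  apply: le_trans (ltW (truncnS_gt l)) _; rewrite -natrX ler_nat ltnW //.
  exact: ltn_expl.
exists (K ^+ n); first exact: exprn_gt0.
move=> t t0; apply: le_trans (pow n t t0); apply: (zen_weight_nincr hnu).
  by rewrite divr_gt0 // exprn_gt0.
by rewrite ler_pM2l // lef_pV2 ?posrE ?exprn_gt0.
Qed.

Hypothesis hsurj : laplace_surjective nu.
Variable phi : C -> C.
Hypothesis dphi : forall z, 0 < Re z -> cderivable phi z.
Hypothesis phi_gt0 : forall z, 0 < Re z -> 0 < Re (phi z).

Section AngularDerivative.
Variable l : R.
Hypothesis l0 : 0 < l.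
Hypothesis ad : angular_derivative phi l%:C.

(** The line at [r + e] is compared with the line at [(r + e / 2) / l]: one half of [e] buys the
    strict inequality asked for by [line_subordination], the other survives as an exponential factor
    at most 1. *)
Lemma zen_slices_composition f e : weighted_L2 w f -> 0 < e ->
  (zen_slices nu (laplace f \o phi) e <=
   l%:E * \int[mu]_(t in T) (modulus (f t) ^+ 2 * w (t / l))%:E)%E.
Proof.
move=> fw e0; have e20 : 0 < e / 2 by rewrite divr_gt0.
have mf := weighted_cmeasurable fw; have fE := weighted_energy hnu fw.
have mf2 : measurable_fun T (fun t => modulus (f t) ^+ 2).
  by apply: measurable_rayX; exact: measurable_modulus.
have f20 t : 0 <= modulus (f t) ^+ 2 by exact: sqr_ge0.
have dF z : 0 < Re z -> cderivable (laplace f) z by exact: laplace_cderivable.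
have dFphi z : 0 < Re z -> cderivable (laplace f \o phi) z.
  by move=> z0; apply: cderivable_comp; [exact: dphi|apply: dF; exact: phi_gt0].
have Fb d : 0 < d -> exists K, forall z, d <= Re z -> modulus (laplace f z) <= K.
  by move=> d0; eexists => z dz; exact: (laplace_bounded mf fE d0 dz).
pose J r := (\int[mu]_(t in T) (2 * pi * modulus (f t) ^+ 2 * expR (- (2 * ((r + e / 2) / l) * t)))%:E)%E.
have J0 r : (0 <= J r)%E.
  by apply: integral_ge0 => t _; rewrite lee_fin !mulr_ge0 ?pi_ge0 ?expR_ge0 ?modulus_ge0.
have mJ : measurable_fun D J by exact: measurable_weight_section.
have ll0 : (0 <= l%:E)%E by rewrite lee_fin ltW.
apply: (@le_trans _ _ (\int[nu]_(r in D) (l%:E * J r))%E).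
  apply: ge0_le_integral => //.
  - by move=> r _; apply: integral_ge0 => y _; rewrite lee_fin sqr_ge0.
  - exact: measurable_line_section.
  - by apply: emeasurable_funM => //; exact: measurable_cst.
  move=> r; rewrite /= in_itv /= andbT => r0.
  have x0 : 0 < r + e by rewrite ltr_wpDl.
  have a0 : 0 < (r + e / 2) / l by rewrite divr_gt0 // ltr_wpDl.
  have ax : (r + e / 2) / l < (r + e) / l.
    by rewrite ltr_pM2r ?invr_gt0 // ltrD2l ltr_pdivrMr // ltr_pMr // ltr1n.
  apply: le_trans (line_subordination dphi phi_gt0 l0 ad x0 a0 ax dF Fb) _.
  apply: lee_wpmul2l => //; rewrite (laplace_plancherel mf fE a0) -integral_rayZ.
  - by rewrite le_eqVlt; apply/orP; left; apply/eqP; apply: eq_integral_ray => t _; rewrite mulrA.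
  - by rewrite mulr_ge0 // pi_ge0.
  - apply: measurable_rayM => //.
    exact: measurable_expRN.
  - by move=> t _; rewrite mulr_ge0 ?expR_ge0.
rewrite ge0_integralZl //.
apply: lee_wpmul2l => //; rewrite (weight_tonelli hnu (e / 2) mf2 f20 l0).
have mwl := measurable_zen_weight_div hnu l (E := T).
have fw0 t : 0 < t -> 0 <= modulus (f t) ^+ 2 * w (t / l).
  by move=> t0; apply: mulr_ge0 => //; apply: ltW; apply: (zen_weight_gt0 hnu); rewrite divr_gt0.
have mfw : measurable_fun T (fun t => modulus (f t) ^+ 2 * w (t / l)) by exact: measurable_rayM.
apply: le_integral_ray => //.
- apply: measurable_rayM => //.
  exact: measurable_expRN.
- by move=> t t0; rewrite mulr_ge0 ?expR_ge0 ?fw0.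
move=> t t0; rewrite ler_piMl ?fw0 // expR_le1 oppr_le0 !mulr_ge0 ?invr_ge0 // ltW //.
Qed.

(** Surjectivity represents [F] as [laplace f]; the slice bound is uniform in the shift, and [HS]
    then trades [w (t / l)] for [S * w t]. *)
Lemma zen_norm_composition_le S F : 0 <= S -> (forall t, 0 < t -> w (t / l) <= S * w t) ->
  zen_space nu F -> (zen_norm nu (F \o phi) ^+ 2 <= (l * S)%:E * zen_norm nu F ^+ 2)%E.
Proof.
move=> S0 HS Fs; have [f fw FE] := hsurj Fs.
have mf := weighted_cmeasurable fw; have fE := weighted_energy hnu fw.
have -> : zen_norm nu F = zen_norm nu (laplace f) by exact: eq_zen_norm.
have -> : zen_norm nu (F \o phi) = zen_norm nu (laplace f \o phi).
  by apply: eq_zen_norm => z z0; apply: FE; exact: phi_gt0.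
have dF z : 0 < Re z -> cderivable (laplace f) z by exact: laplace_cderivable.
have dFphi z : 0 < Re z -> cderivable (laplace f \o phi) z.
  by move=> z0; apply: cderivable_comp; [exact: dphi|apply: dF; exact: phi_gt0].
apply: (@le_trans _ _ ((l * S)%:E * \int[mu]_(t in T) (modulus (f t) ^+ 2 * w t)%:E)%E); last first.
  apply: lee_wpmul2l; first by rewrite lee_fin mulr_ge0 // ltW.
  by rewrite (zen_norm_laplace hnu fw).
rewrite (zen_norm_sqr hnu dFphi); apply: ge_ereal_sup => _ [e /= e0 <-].
apply: le_trans (zen_slices_composition fw e0) _.
have mf2 : measurable_fun T (fun t => modulus (f t) ^+ 2).
  by apply: measurable_rayX; exact: measurable_modulus.
have mw := measurable_zen_weight hnu (E := T).
have mwl := measurable_zen_weight_div hnu l (E := T).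
rewrite EFinM -muleA; apply: lee_wpmul2l; first by rewrite lee_fin ltW.
have w0 t : 0 < t -> 0 <= w t by move=> t0; apply: ltW; exact: zen_weight_gt0.
have mfw : measurable_fun T (fun t => modulus (f t) ^+ 2 * w t) by exact: measurable_rayM.
rewrite -integral_rayZ //; last by move=> t t0; apply: mulr_ge0; [exact: sqr_ge0|exact: w0].
apply: le_integral_ray.
- exact: measurable_rayM.
- by apply: measurable_rayM => //; exact: measurable_cst.
- by move=> t t0; apply: mulr_ge0; [exact: sqr_ge0|apply: w0; exact: divr_gt0].
by move=> t t0; rewrite [leRHS]mulrCA; apply: ler_wpM2l; [exact: sqr_ge0|exact: HS].
Qed.

Lemma bounded_composition_angular : bounded_composition nu phi.
Proof.
have [S S0 HS] := zen_weight_dilate l0.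
have lS0 : 0 <= l * S by rewrite mulr_ge0 // ltW.
have H F (Fs : zen_space nu F) := zen_norm_composition_le (ltW S0) HS Fs.
have HM F : zen_space nu F -> (zen_norm nu (F \o phi) <= (Num.sqrt (l * S))%:E * zen_norm nu F)%E.
  move=> Fs; apply: sqre_le; [exact: zen_norm_ge0|by rewrite mule_ge0 ?lee_fin ?sqrtr_ge0 ?zen_norm_ge0|].
  by rewrite (expe2 (_ * _)%E) muleACA -EFinM -expr2 sqr_sqrtr // -expe2 H.
split; last by exists (Num.sqrt (l * S)).
move=> F Fs; have [dF Foo] := Fs; split.
  by move=> z z0; apply: (@cderivable_comp R phi F); [exact: dphi|apply: dF; exact: phi_gt0].
by apply: le_lt_trans (HM _ Fs) _; apply: lte_mul_pinfty => //; rewrite lee_fin sqrtr_ge0.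
Qed.

End AngularDerivative.

(** A member of the unit ball makes the supremum in [composition_norm] nonnegative. *)
Lemma zen_unit_ball_zero : exists2 F, zen_space nu F & (zen_norm nu F <= 1)%E.
Proof.
pose f (t : R) : C := 0.
have E : (\int[mu]_(t in T) (modulus (f t) ^+ 2 * w t)%:E = 0)%E.
  by apply: integral0_eq => t _; rewrite modulus0 expr0n mul0r.
have fw : weighted_L2 w f.
  by split; [exact: measurable_cst|exact: measurable_cst|rewrite E ltry].
exists (laplace f); first exact: zen_space_laplace.
apply: sqre_le => //; first exact: zen_norm_ge0.
by rewrite (zen_norm_laplace hnu fw) E expe_ge0.
Qed.

Lemma composition_norm_ge0 : (0 <= composition_norm nu phi)%E.
Proof.
have [F Fs F1] := zen_unit_ball_zero.
apply: (@le_trans _ _ (zen_norm nu (F \o phi))); first exact: zen_norm_ge0.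
by apply: ereal_sup_ubound; exists F.
Qed.

(** If [Re (phi z) < Re z / N], then [L = Re z / Re (phi z)] exceeds [N >= 1]. Monotonicity of the
    weight gives [L * kappa (Re z) <= kappa (Re (phi z))], against the kernel inequality with
    constant [N]; hence [Re (phi z) >= Re z / N] throughout. *)
Lemma angular_derivative_bounded : bounded_composition nu phi ->
  exists2 l : R, 0 < l & angular_derivative phi l%:C.
Proof.
move=> [phi_space [M HM]]; pose B := Num.max 1 M; pose N := B ^+ 2.
have B1 : 1 <= B by rewrite le_max lexx.
have B0 : 0 < B by apply: lt_le_trans B1.
have N1 : 1 <= N by rewrite exprn_ege1.
have N0 : 0 < N by apply: lt_le_trans N1.
have HN F : zen_space nu F -> (zen_norm nu F <= 1)%E -> (zen_norm nu (F \o phi) ^+ 2 <= N%:E)%E.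
  move=> Fs F1; rewrite /N EFin_expe; apply: sqre_homo; first exact: zen_norm_ge0.
  apply: le_trans (HM _ Fs) _; apply: (@le_trans _ _ (B%:E * zen_norm nu F)%E).
    by apply: lee_wpmul2r; [exact: zen_norm_ge0|rewrite lee_fin le_max lexx orbT].
  by rewrite -[leRHS]mule1; apply: lee_wpmul2l => //; rewrite lee_fin ltW.
have Ni0 : 0 < N^-1 by rewrite invr_gt0.
apply: (julia_angular_derivative dphi Ni0).
move=> z z0; rewrite leNgt; apply/negP => lt.
have p0 := phi_gt0 z0; pose L := Re z / Re (phi z).
have NL : N < L by move: lt; rewrite ltr_pdivlMl // /L ltr_pdivlMr.
have L0 : 0 < L by rewrite divr_gt0.
have k0 := reproducing_diagonal_gt0 hnu z0.
have wL t : 0 < t -> 1 * w (t / L^-1) <= w t.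
  move=> t0; rewrite mul1r invrK; apply: (zen_weight_nincr hnu) => //.
  by rewrite ler_peMr ?(ltW t0) // (le_trans N1) // ltW.
have := reproducing_diagonal_dilate hnu ler01 (_ : 0 < L^-1) z0 wL; rewrite invr_gt0 => /(_ L0).
have -> : L^-1 * Re z = Re (phi z) by rewrite /L; field; rewrite !lt0r_neq0.
rewrite mul1r ler_pdivlMl // => h1.
have h2 := reproducing_diagonal_le hnu phi_gt0 hsurj phi_space N0 HN z0.
have : N * reproducing_diagonal nu (Re z) < L * reproducing_diagonal nu (Re z) by rewrite ltr_pM2r.
by rewrite ltNge (le_trans h1 h2).
Qed.

Let s (n : nat) : C := (n.+1%:R)%:C.

Let s_nontangential := @nontangential_nat R.

(** Along the integers the ratio [th n] tends to [l^-1], so [w (t / th n)] is nearly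
    [w (l * t) <= w t / m]. Dilation by [th n] in the kernel inequality gives
    [m <= N * th n * (1 + K * d n)], and the limit is the claim. *)
Lemma composition_lower l m N : 0 < l -> angular_derivative phi l%:C ->
  (forall F, zen_space nu F -> zen_space nu (F \o phi)) -> 0 < N ->
  (forall F, zen_space nu F -> (zen_norm nu F <= 1)%E -> (zen_norm nu (F \o phi) ^+ 2 <= N%:E)%E) ->
  0 < m -> (forall t, 0 < t -> m <= w t / w (l * t)) -> l * m <= N.
Proof.
move=> l0 ad phi_space N0 HN m0 Hm.
pose th n := Re (phi (s n)) / n.+1%:R.
have s0 n : 0 < n.+1%:R :> R by rewrite ltr0n.
have thl n : l^-1 <= th n.
  have := julia_ge dphi phi_gt0 l0 ad (s0 n : 0 < Re (s n)).
  by rewrite /th ler_pdivlMr // mulrC.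
have li0 : 0 < l^-1 by rewrite invr_gt0.
have th0 n : 0 < th n by apply: lt_le_trans (thl n).
have thc : th n @[n --> \oo] --> l^-1.
  have r := angular_derivative_ratio (lt0r_neq0 l0) ad s_nontangential.
  have rp : Re (phi (s n) / s n) @[n --> \oo] --> l^-1 by exact: (cvg_complex_Re _ r).
  suff <- : (fun n => Re (phi (s n) / s n)) = th by exact: rp.
  apply/funext => n; rewrite /s -fmorphV ReM /= mulr0 subr0 //.
(* Chosen so that [(1 - d n) * (l * t) = t / th n]; Julia's bound [l^-1 <= th n] makes it
   nonnegative. *)
pose d n := 1 - (l * th n)^-1.
have dc : d n @[n --> \oo] --> 0.
  rewrite -[X in _ --> X](subrr 1); apply: cvgB; first exact: cvg_cst.
  rewrite -[X in _ --> X]invr1 -(divff (lt0r_neq0 l0)); apply: cvgV.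
    by rewrite divff ?lt0r_neq0 // oner_eq0.
  by apply: cvgM => //; exact: cvg_cst.
have d0 n : 0 <= d n.
  have lth : 0 < l * th n by exact: mulr_gt0 (th0 n).
  rewrite subr_ge0 invf_le1 //.
  by rewrite -(divff (lt0r_neq0 l0)) ler_pM2l.
have [K K0 HK] := zen_weight_near hnu.
have bound n : d n <= 4^-1 -> m <= N * (th n * (1 + K * d n)).
  move=> d4; have Kd : 0 < 1 + K * d n by rewrite ltr_wpDr // mulr_ge0.
  (* The loss [1 + K * d n] is the factor by which [w (t / th n)] may exceed [w (l * t)]. *)
  pose a := m / (1 + K * d n); have a0 : 0 < a by rewrite divr_gt0.
  have wa t : 0 < t -> a * w (t / th n) <= w t.
    move=> t0; have lt0 : 0 < l * t by rewrite mulr_gt0.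
    have := HK (l * t) (d n) lt0; rewrite d0 d4 => /(_ isT).
    have -> : (1 - d n) * (l * t) = t / th n.
      by rewrite /d; field; rewrite !lt0r_neq0.
    have := Hm t t0; rewrite ler_pdivlMr; last exact: zen_weight_gt0.
    move=> h1 h2; rewrite /a mulrAC ler_pdivrMr //.
    apply: le_trans (ler_wpM2l (ltW m0) h2) _.
    by rewrite mulrCA mulrC ler_wpM2r // ltW.
  have := reproducing_diagonal_dilate hnu (ltW a0) (th0 n) (s0 n : 0 < Re (s n)) wa.
  have -> : th n * Re (s n) = Re (phi (s n)) by rewrite /th /= divfK // lt0r_neq0.
  have h2 := reproducing_diagonal_le hnu phi_gt0 hsurj phi_space N0 HN (s0 n : 0 < Re (s n)).
  move=> /le_trans/(_ (ler_wpM2l (ltW (th0 n)) h2)).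
  rewrite mulrA ler_pM2r; last exact: (reproducing_diagonal_gt0 hnu (s0 n : 0 < Re (s n))).
  by rewrite /a ler_pdivrMr // mulrAC mulrC mulrA.
have rc : N * (th n * (1 + K * d n)) @[n --> \oo] --> N * l^-1.
  apply: cvgM; first exact: cvg_cst.
  rewrite -[X in _ --> X]mulr1; apply: cvgM => //.
  rewrite -[X in _ --> X](addr0 1); apply: cvgD; first exact: cvg_cst.
  by rewrite -[X in _ --> X](mulr0 K); apply: cvgM => //; exact: cvg_cst.
have : m <= N * l^-1.
  rewrite -(cvg_lim _ rc) //; apply: limr_ge; first by apply/cvg_ex; eexists; exact: rc.
  have q0 : 0 < 4^-1 :> R by [].
  have /cvgrPdist_le/(_ _ q0) := dc.
  by apply: filterS => n; rewrite sub0r normrN ger0_norm // => /bound.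
by rewrite ler_pdivlMr // mulrC.
Qed.

End CompositionBounds.

Theorem theorem5 (R : realType)
    (nu : {measure set (measurableTypeR R) -> \bar R}) (phi : R[i] -> R[i])
    (hnu : zen_measure nu) (hsurj : laplace_surjective nu)
    (hphi : holomorphic_on_half_plane phi)
    (hself : forall z, half_plane z -> half_plane (phi z)) :
  (bounded_composition nu phi <->
     exists2 lambda : R, 0 < lambda & angular_derivative phi lambda%:C) /\
  (bounded_composition nu phi ->
     forall lambda : R, 0 < lambda -> angular_derivative phi lambda%:C ->
       (lambda%:E * ereal_inf [set (zen_weight nu t / zen_weight nu (lambda * t))%:E
                                | t in [set t : R | (0 < t)%R]]
          <= composition_norm nu phi ^+ 2)%E /\
       (composition_norm nu phi ^+ 2
          <= lambda%:E * ereal_sup [set (zen_weight nu (t / lambda) / zen_weight nu t)%:E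
                                     | t in [set t : R | (0 < t)%R]])%E).
Proof.
have dphi z : 0 < Re z -> cderivable phi z by exact: hphi.
have phi_gt0 z : 0 < Re z -> 0 < Re (phi z) by exact: hself.
split.
  split; first exact: (angular_derivative_bounded hnu hsurj dphi phi_gt0).
  by move=> [l l0 ad]; exact: (bounded_composition_angular hnu hsurj dphi phi_gt0 l0 ad).
move=> [phi_space _] l l0 ad.
have w_gt0 t : 0 < t -> 0 < zen_weight nu t by exact: zen_weight_gt0.
have c0 : (0 <= composition_norm nu phi)%E by exact: composition_norm_ge0.
split.
  have ball F : zen_space nu F -> (zen_norm nu F <= 1)%E ->
      (zen_norm nu (F \o phi) ^+ 2 <= composition_norm nu phi ^+ 2)%E.
    move=> Fs F1; apply: sqre_homo; first exact: zen_norm_ge0.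
    by apply: ereal_sup_ubound; exists F.
  set A := [set _ | _ in _].
  have A0 : (0 <= ereal_inf A)%E.
    apply: le_ereal_inf_tmp => _ [t /= t0 <-].
    by rewrite lee_fin divr_ge0 // ltW // w_gt0 // mulr_gt0.
  have A1 t : 0 < t -> (ereal_inf A <= (zen_weight nu t / zen_weight nu (l * t))%:E)%E.
    by move=> t0; apply: ereal_inf_lbound; exists t.
  (* An infinite norm makes the lower bound trivial; in the finite case the value at [t = 1] keeps
     the infimum finite. *)
  move: c0 ball; case: (composition_norm nu phi) => [c| |] // c0 ball; last first.
    by rewrite expe2 mulyy leey.
  move: A0 A1; case: (ereal_inf A) => [m| |] // m0 A1; last first.
    by have := A1 1 ltr01; rewrite leye_eq.
  rewrite -EFin_expe -EFinM lee_fin; rewrite lee_fin in m0.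
  move: m0; rewrite le_eqVlt => /orP[/eqP <-|m0]; first by rewrite mulr0 sqr_ge0.
  (* [composition_lower] asks for a positive [N], and [c] might be 0, so [c ^+ 2] is enlarged by
     [e]. *)
  apply/ler_addgt0Pr => e e0.
  apply: (composition_lower hnu hsurj dphi phi_gt0 l0 ad phi_space _ _ m0).
  - by rewrite ltr_wpDl // sqr_ge0.
  - move=> F Fs F1; apply: le_trans (ball _ Fs F1) _.
    by rewrite -EFin_expe lee_fin lerDl ltW.
  - by move=> t t0; rewrite -lee_fin; exact: A1.
set A := [set _ | _ in _].
have A1 t : 0 < t -> ((zen_weight nu (t / l) / zen_weight nu t)%:E <= ereal_sup A)%E.
  by move=> t0; apply: ereal_sup_ubound; exists t.
(* An infinite supremum makes the upper bound trivial; the value at [t = 1] rules out minus infinity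
   and gives [0 <= S]. *)
have := A1 1 ltr01; move: A1; case: (ereal_sup A) => [S| |] // A1; last first.
  by move=> _; rewrite gt0_muley ?lte_fin // leey.
rewrite lee_fin => S1; have S0 : 0 <= S.
  by apply: le_trans S1; rewrite divr_ge0 // ltW // w_gt0 // divr_gt0.
have HS t : 0 < t -> zen_weight nu (t / l) <= S * zen_weight nu t.
  by move=> t0; have := A1 t t0; rewrite lee_fin ler_pdivrMr // w_gt0.
have lS0 : 0 <= l * S by rewrite mulr_ge0 // ltW.
have -> : (l%:E * S%:E = (Num.sqrt (l * S))%:E ^+ 2)%E by rewrite -EFin_expe sqr_sqrtr.
apply: sqre_homo => //; apply: ge_ereal_sup => _ [F [Fs F1] <-].
apply: sqre_le; rewrite ?zen_norm_ge0 ?lee_fin ?sqrtr_ge0 // -EFin_expe sqr_sqrtr //.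
apply: le_trans (zen_norm_composition_le hnu hsurj dphi phi_gt0 l0 ad S0 HS Fs) _.
rewrite -[leRHS]mule1; apply: lee_wpmul2l; first by rewrite lee_fin.
rewrite -[leRHS](_ : (1 ^+ 2 = 1)%E); last by rewrite expe2 mule1.
by apply: sqre_homo; first exact: zen_norm_ge0.
Qed.
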